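(* Let $p\in\mathbb N$, let $\mathcal A=\{a_0,\dots,a_p\}\subset\mathbb C$ be a set of $p+1$ distinct points, and for each $n\in\mathbb N$ let $\rho_0(n),\dots,\rho_p(n)\in\mathbb C$, $\Phi_n(z)=-\sum_{k=0}^p\frac{\rho_k(n)}{2}\log(z-a_k)$, $\varphi_n=\operatorname{Re}\Phi_n$. Let $\mu_n=\sum_{k=1}^n\delta_{\zeta_k^{(n)}}$, $n\in\mathbb N$, be a discrete $(\mathcal A,\varphi_n)$-critical measure. If for a subsequence $\mathcal N\subset\mathbb N$ the limits $$\lim_{n\in\mathcal N}\frac{\rho_k(n)}{n}=\rho_k,\qquad k=0,1,\dots,p,$$ exist, then any weak-* limit point $\mu$ of the normalized measures $\{\mu_n/n\}$, $n\in\mathcal N$, is a continuous $(\mathcal A,\varphi)$-critical measure with respect to the external field $\varphi=\operatorname{Re}\Phi$, $\Phi(z)=-\sum_{k=0}^p\frac{\rho_k}{2}\log(z-a_k)$. In particular, if $$\operatorname{Re}\sum_{k=0}^p\rho_k>-\frac12,$$ then $\mu$ is a unit (total mass $1$) continuous $(\mathcal A,\varphi)$-critical measure.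
   Context: Discrete critical measures. For $\mu=\sum_{k=1}^n\delta_{\zeta_k}$ put $\mathcal E(\mu)=\sum_{i\ne j}\log\frac1{|\zeta_i-\zeta_j|}$ and $\mathcal E_\varphi(\mu)=\mathcal E(\mu)+2\sum_{k=1}^n\varphi(\zeta_k)$, where $\varphi=\operatorname{Re}\Phi$ and $\Phi$ is possibly multivalued but $\Phi'$ is single-valued in $\mathbb C\setminus\mathcal A$. The measure $\mu$, with $\zeta_i\ne\zeta_j$ for $i\neq j$ and $\operatorname{supp}(\mu)\subset\mathbb C\setminus\mathcal A$, is a discrete $(\mathcal A,\varphi)$-critical measure if $\frac{\partial}{\partial\zeta_k}\mathcal E_\varphi(\zeta_1,\dots,\zeta_n)=0$ for $k=1,\dots,n$, where $\frac{\partial}{\partial z}=\frac12(\frac\partial{\partial x}-i\frac\partial{\partial y})$ (and $2\,\partial\varphi/\partial z=\Phi'$). Continuous critical measures. For a finite real (signed) Borel measure $\mu$ with compact support in $\mathbb C$, $E(\mu)=\iint\log\frac1{|x-y|}\,d\mu(x)d\mu(y)$ and $E_\varphi(\mu)=E(\mu)+2\int\varphi\,d\mu$. A smooth complex-valued function $h$ generates the local variation $z\mapsto z^t=z+t\,h(z)$, $t\in\mathbb C$ small, and $\mu^t$ is defined by $d\mu^t(x^t)=d\mu(x)$. $\mu$ is a continuous $(\mathcal A,\varphi)$-critical measure if for every smooth $h$ with $h|_{\mathcal A}\equiv0$, $\frac{d}{dt}E_\varphi(\mu^t)|_{t=0}=\lim_{t\to0}\frac{E_\varphi(\mu^t)-E_\varphi(\mu)}{t}=0$.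 When $\varphi=\operatorname{Re}\Phi$ is multivalued (with $\Phi'$ single-valued), the increments $\varphi(z^t)-\varphi(z)$ are computed by continuation of $\Phi$ along the short segment from $z$ to $z^t$.
   Formalization: Without the bound on Re Σρ_k, μ may lack compact support; then only h moving a bounded part of μ are tested. E_φ(μ^t)−E_φ(μ) is read as the integral of the kernel increments, since atoms of μ at points of A can make both energies infinite. *)

(* Defs.v *)
From HB Require Import structures.
From mathcomp Require Import all_boot all_order all_algebra.
From mathcomp Require Import all_classical all_reals all_analysis.
From mathcomp Require Import measurable_realfun complex ring.

Set Implicit Arguments.
Unset Strict Implicit.
Unset Printing Implicit Defensive.

Import Order.TTheory GRing.Theory Num.Theory.
Import numFieldNormedType.Exports.

Local Open Scope classical_set_scope.
Local Open Scope ring_scope.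
Local Open Scope complex_scope.

(* The instances of numFieldNormedType are keyed on abstract structures and do
   not reach the concrete type R[i], hence these copies of R[i]^o. *)
HB.instance Definition _ (R : realType) := GRing.ComAlgebra.copy R[i] R[i]^o.
HB.instance Definition _ (R : realType) := NormedModule.copy R[i] R[i]^o.

(* R[i] with its Borel sigma-algebra. *)
Definition borelC (R : realType) := g_sigma_algebraType (@open R[i]).

Section Defs.
Variable R : realType.
Local Notation C := R[i].
Implicit Types (x y z w t : C) (A : set C) (F h T : C -> C) (g : C -> R)
  (mu : {finite_measure set (borelC R) -> \bar R}).

(* The modulus as an element of R; `|z| is valued in R[i]. *)
Definition Cabs z : R := Normc.normc z.

Definition line_x g z : R -> R := fun s => g (z + s%:C).
Definition line_y g z : R -> R := fun s => g (z + s *i).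
Definition pdx g z : R := derive1 (line_x g z) 0.
Definition pdy g z : R := derive1 (line_y g z) 0.

Definition wirtinger g z : C := 2^-1 * ((pdx g z)%:C - 'i * (pdy g z)%:C).

(* Differentiability class C^k in the real sense. *)
Fixpoint Ck (k : nat) g : Prop :=
  continuous g /\
  if k is k'.+1 then
    [/\ forall z, derivable (line_x g z) 0 1, forall z, derivable (line_y g z) 0 1,
        Ck k' (pdx g) & Ck k' (pdy g)]
  else True.

Definition smoothC h : Prop :=
  forall k, Ck k (fun z => complex.Re (h z)) /\ Ck k (fun z => complex.Im (h z)).

Definition logk x y : R := - ln (Cabs (x - y)).

(* A possibly multivalued external field phi = Re Phi is represented by the
   single-valued derivative F = Phi'.  [dphi F z w] is phi(w) - phi(z) where
   Phi is continued along the segment [z, w], i.e. the real part of the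
   integral of Phi' over this segment. *)
Definition dphi F z w : R :=
  Rintegral lebesgue_measure `[0%R, 1%R]%classic
    (fun s : R => complex.Re (F (z + s%:C * (w - z)) * (w - z))).

(* Phi' for Phi(z) = - \sum_k rho_k / 2 * log (z - a_k). *)
Definition dPhi (p : nat) (a rho : 'I_p.+1 -> C) : C -> C :=
  fun z => - \sum_(k < p.+1) rho k / 2 * (z - a k)^-1.

(* An n-point configuration is given by the values z 0, ..., z n.-1. *)
Definition disc_energy (n : nat) (z : nat -> C) : R :=
  \sum_(0 <= i < n) \sum_(0 <= j < n | j != i) logk (z i) (z j).

(* E_phi(z) for the local branches of phi that vanish at the points z0 k; other
   branches change it by an additive constant only. *)
Definition disc_energy_phi F (n : nat) (z0 z : nat -> C) : R :=
  disc_energy n z + 2 * \sum_(0 <= k < n) dphi F (z0 k) (z k).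

Definition disc_critical A F (n : nat) (z : nat -> C) : Prop :=
  [/\ forall i j, (i < n)%N -> (j < n)%N -> z i = z j -> i = j,
      forall k, (k < n)%N -> ~ A (z k) &
      forall k, (k < n)%N ->
        wirtinger (fun w => disc_energy_phi F n z
                              (fun j => if j == k then w else z j)) (z k) = 0].

Definition disc_measure (n : nat) (z : nat -> C) :
    {measure set (borelC R) -> \bar R} :=
  msum (fun k => dirac (z k : borelC R)) n.

Definition normalized_measure (n : nat) (z : nat -> C) :
    {measure set (borelC R) -> \bar R} :=
  mscale (n%:R^-1)%:nng (disc_measure n z).

Definition variation h t z : C := z + t * h z.

(* E(T_* mu) - E(mu), computed by integrating the increments of the kernel.
   Lemma [denergyE] below: this is the difference of the two energies whenever
   they are finite.  Integrating the increments is needed because mu may have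
   atoms at points of A, where both energies are infinite; a pair (x, x)
   contributes 0, as ln 0 = 0. *)
Definition denergy mu T : R :=
  Rintegral (mu \x mu)%E setT (fun p => logk (T p.1) (T p.2) - logk p.1 p.2).

(* E_phi(T_* mu) - E_phi(mu). *)
Definition denergy_phi F mu T : R :=
  denergy mu T + 2 * Rintegral mu setT (fun z => dphi F z (T z)).

Definition compact_supp mu : Prop :=
  exists r : R, mu [set z | r < Cabs z] = 0%E.

(* The first conjunct excludes the indeterminate increments (+oo) - (+oo) on
   the diagonal, except at the points of A, which the variations do not move.
   The last hypothesis on h says that only a bounded part of mu is moved: it
   holds for every h when mu has compact support, and it gives a meaning to the
   definition when the support of mu is not compact. *)
Definition cont_critical A F mu : Prop :=
  (forall z, ~ A z -> mu [set z] = 0%E) /\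
  forall h, smoothC h -> (forall z, A z -> h z = 0) ->
    (exists r : R, mu [set z | r < Cabs z /\ h z <> 0] = 0%E) ->
    (denergy_phi F mu (variation h t))%:C / t @[t --> (0 : C)^'] --> (0 : C).

(* mu is a cluster point of (nu n), n in N, for the weak-* topology (duality
   with the compactly supported continuous functions): every basic
   neighbourhood of mu contains nu n for infinitely many n in N. *)
Definition weak_limit_point (N : set nat)
    (nu : nat -> {measure set (borelC R) -> \bar R}) mu : Prop :=
  forall (m : nat) (f : 'I_m -> C -> R),
    (forall i, continuous (f i)) ->
    (forall i, exists r : R, forall z, r < Cabs z -> f i z = 0) ->
    forall (e : R) (n0 : nat), 0 < e ->
    exists n, [/\ N n, (n0 <= n)%N &
      forall i, `|Rintegral (nu n) setT (f i) - Rintegral mu setT (f i)| < e].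

End Defs.

(* Consistency of [denergy] with the energies themselves, where log (1/0) = +oo. *)
Section Energy.
Variable R : realType.
Local Notation C := R[i].

Definition logke (x y : C) : \bar R := if x == y then +oo%E else (logk x y)%:E.

Definition energy (nu : set (borelC R) -> \bar R) : \bar R :=
  (\int[nu]_x \int[nu]_y logke x y)%E.

Lemma lip1_continuous (f : C -> R) :
  (forall x y, `|f x - f y| <= Cabs (x - y)) -> continuous f.
Proof.
move=> lf x; have FF := @nbhs_filter C x; apply/(@cvgrPdist_lt _ _ _ _ FF) => e e0.
have H : nbhs x (ball x e%:C) by apply: nbhsx_ballx; rewrite ltcR.
apply: filterS H => y xy; apply: le_lt_trans (lf x y) _.
have : `|x - y| < e%:C by [].
by rewrite /Cabs; case: (x - y) => a b; rewrite normc_def /= ltcR.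
Qed.

Lemma continuous_Re : continuous (@complex.Re R).
Proof.
apply: lip1_continuous => -[a b] [c d] /=.
by rewrite /Cabs /= -sqrtr_sqr; apply: ler_wsqrtr; rewrite lerDl sqr_ge0.
Qed.

Lemma continuous_Im : continuous (@complex.Im R).
Proof.
apply: lip1_continuous => -[a b] [c d] /=.
by rewrite /Cabs /= -sqrtr_sqr; apply: ler_wsqrtr; rewrite lerDr sqr_ge0.
Qed.

Lemma continuous_borelC (f : C -> R) :
  continuous f -> measurable_fun [set: borelC R] f.
Proof.
move=> /continuousP cf; apply: (measurability _ (RGenOpens.measurableE R)).
move=> _ [_ [a [b ->] <-]]; rewrite setTI; apply: sub_sigma_algebra.
by apply: cf; exact: interval_open.
Qed.

Lemma measurable_Cdist :
  measurable_fun [set: borelC R * borelC R] (fun p => Cabs ((p.1 : C) - p.2)).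
Proof.
rewrite [X in measurable_fun _ X](_ : _ = (fun p => Num.sqrt
   ((complex.Re (p.1 : C) - complex.Re (p.2 : C)) ^+ 2 +
    (complex.Im (p.1 : C) - complex.Im (p.2 : C)) ^+ 2))); last first.
  by apply/funext => -[[a b] [c d]].
apply: measurableT_comp.
  by apply: continuous_measurable_fun; exact: sqrt_continuous.
have mRe := continuous_borelC continuous_Re.
have mIm := continuous_borelC continuous_Im.
have m1 (f : C -> R) : measurable_fun [set: borelC R] f ->
  measurable_fun [set: borelC R * borelC R] (fun p => f p.1).
  by move=> mf; exact: measurableT_comp mf measurable_fst.
have m2 (f : C -> R) : measurable_fun [set: borelC R] f ->
  measurable_fun [set: borelC R * borelC R] (fun p => f p.2).
  by move=> mf; exact: measurableT_comp mf measurable_snd.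
by apply: measurable_funD; apply: measurable_funX; apply: measurable_funB;
  [exact: m1|exact: m2|exact: m1|exact: m2].
Qed.

Lemma measurable_logk :
  measurable_fun [set: borelC R * borelC R] (fun p => logk p.1 p.2).
Proof.
apply: measurableT_comp => //.
by apply: measurableT_comp measurable_Cdist; exact: measurable_ln.
Qed.

Lemma measurable_logke :
  measurable_fun [set: borelC R * borelC R] (fun p => logke p.1 p.2).
Proof.
apply: measurable_fun_ifT => //; last first.
  by apply/measurable_EFinP; exact: measurable_logk.
rewrite [X in measurable_fun _ X](_ : _ =
  (fun p => Cabs ((p.1 : C) - p.2) == 0)); last first.
  apply/funext => -[x y] /=; rewrite -subr_eq0; apply/eqP/eqP => [->|].
    exact: Normc.normc0.
  exact: Normc.eq0_normc.
by apply: measurable_fun_eqr => //; exact: measurable_Cdist.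
Qed.

Lemma integral_pushforwardT (mu : {measure set (borelC R) -> \bar R})
    (T : {mfun borelC R >-> borelC R}) (f : borelC R -> \bar R) :
  measurable_fun setT f ->
  (\int[pushforward mu T]_x f x = \int[mu]_x f (T x))%E.
Proof.
move=> mf; rewrite integralE [RHS]integralE.
congr (_ - _)%E.
  rewrite ge0_integral_pushforward//; last by apply: measurable_funepos.
  by rewrite preimage_setT; apply: eq_integral => x _; rewrite /= ?funeposE ?funenegE.
rewrite ge0_integral_pushforward//; last by apply: measurable_funeneg.
by rewrite preimage_setT; apply: eq_integral => x _; rewrite /= ?funeposE ?funenegE.
Qed.

Lemma measurable_int_snd (mu : {finite_measure set (borelC R) -> \bar R})
    (g : borelC R * borelC R -> \bar R) : measurable_fun setT g ->
  measurable_fun setT (fun x : borelC R => \int[mu]_y g (x, y))%E.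
Proof.
move=> mg; rewrite [X in measurable_fun _ X](_ : _ = (fun x : borelC R =>
    \int[mu]_y (g^\+ (x, y)) - \int[mu]_y (g^\- (x, y)))%E).
  apply: emeasurable_funB; apply: (@measurable_fun_fubini_tonelli_F _ _ (borelC R) (borelC R)) => //.
    by apply: measurable_funepos.
  by apply: measurable_funeneg.
apply/funext => x; rewrite integralE.
by congr (_ - _)%E; apply: eq_integral => y _; rewrite ?funeposE ?funenegE.
Qed.

Lemma denergyE (mu : {finite_measure set (borelC R) -> \bar R})
    (T : {mfun borelC R >-> borelC R}) :
  (mu \x mu)%E.-integrable setT (fun p => logke p.1 p.2) ->
  (mu \x mu)%E.-integrable setT (fun p => logke (T p.1) (T p.2)) ->
  ((denergy mu T)%:E = energy (pushforward mu T) - energy mu)%E.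
Proof.
move=> i1 i2.
have -> : energy mu = (\int[mu \x mu]_p logke p.1 p.2)%E.
  by rewrite -integral12_prod_meas1.
have -> : energy (pushforward mu T) = (\int[mu \x mu]_p logke (T p.1) (T p.2))%E.
  have mT : measurable_fun setT T by [].
  rewrite -integral12_prod_meas1//= /energy.
  have -> : (fun x : borelC R => \int[pushforward mu T]_y logke x y)%E =
            (fun x : borelC R => \int[mu]_y logke x (T y))%E.
    apply/funext => x; rewrite integral_pushforwardT //.
    by apply: (measurableT_comp measurable_logke (pair1_measurable x)).
  rewrite integral_pushforwardT //.
  apply: (@measurable_int_snd mu (fun p => logke p.1 (T p.2))).
  have m2 : measurable_fun [set: borelC R * borelC R] (fun p => (p.1, T p.2)).
    by apply: measurable_fun_pair => //; exact: measurableT_comp mT measurable_snd.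
  exact: (measurableT_comp measurable_logke m2).
have E : (\int[mu \x mu]_p (logk (T p.1) (T p.2) - logk p.1 p.2)%:E =
    \int[mu \x mu]_p (logke (T p.1) (T p.2) - logke p.1 p.2))%E.
  have [m1 _] := integrableP _ _ _ i1; have [m2 _] := integrableP _ _ _ i2.
  apply: ae_eq_integral => //.
  - apply/measurable_EFinP; apply: measurable_funB; last exact: measurable_logk.
    have mT : measurable_fun setT T by [].
    have mTT : measurable_fun [set: borelC R * borelC R] (fun p => (T p.1, T p.2)).
      by apply: measurable_fun_pair;
        [exact: measurableT_comp mT measurable_fst|exact: measurableT_comp mT measurable_snd].
    exact: (measurableT_comp measurable_logk mTT).
  - exact: emeasurable_funB.
  - have := integrable_ae measurableT i1; have := integrable_ae measurableT i2.
    apply: filterS2 => p f2 f1 _; move: (f1 Logic.I) (f2 Logic.I).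
    by rewrite /logke; case: ifP => // _; case: ifP.
rewrite -integralB// -E /denergy /Rintegral fineK// E.
by apply: integrable_fin_num => //; exact: integrableB.
Qed.
End Energy.

(* Consistency of [dphi] with the single-valued field
   phi(u) = - \sum_k r_k / 2 * ln |u - a_k| obtained for real charges r_k. *)
Section RealField.
Variable R : realType.
Local Notation C := R[i].

Let qd (x y : R) (dx dy s : R) : R := (x + s * dx) ^+ 2 + (y + s * dy) ^+ 2.
Let fd (x y dx dy s : R) : R := (dx * (x + s * dx) + dy * (y + s * dy)) * (qd x y dx dy s)^-1.

Local Lemma qdD x y dx dy (s : R) : is_derive s (1:R) (qd x y dx dy)
  (2 * (dx * (x + s * dx) + dy * (y + s * dy))).
Proof.
pose p : {poly R} := (x%:P + dx *: 'X) ^+ 2 + (y%:P + dy *: 'X) ^+ 2.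
have -> : qd x y dx dy = horner p.
  by apply/funext => u; rewrite /qd /p !hornerE; ring.
apply: (is_derive_eq (is_derive_poly p s)).
rewrite /p !expr2 !(derivD,derivM,derivZ,derivX,derivC) !hornerE /=; ring.
Qed.

Local Lemma fd_cont x y dx dy (s : R) : 0 < qd x y dx dy s -> {for s, continuous (fd x y dx dy)}.
Proof.
move=> q0.
have cl (a b : R) : {for s, continuous (fun s : R => a + s * b)}.
  by apply: cvgD; [exact: cvg_cst|apply: cvgM; [exact: cvg_id|exact: cvg_cst]].
apply: cvgM; first by apply: cvgD; apply: cvgM; [exact: cvg_cst|exact: cl|exact: cvg_cst|exact: cl].
apply: cvgV; first by rewrite gt_eqF.
have [d _] := qdD x y dx dy s.
by apply/differentiable_continuous/derivable1_diffP.
Qed.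

Local Lemma Gd x y dx dy (s : R) : 0 < qd x y dx dy s ->
  is_derive s (1:R) (fun s => ln (qd x y dx dy s) / 2) (fd x y dx dy s).
Proof.
move=> q0.
have H1 := qdD x y dx dy s.
have H2 := @is_derive1_ln R _ q0.
have H3 := is_derive1_comp H2 H1.
have H4 := @is_deriveZ R R R (@ln R \o qd x y dx dy) 2^-1 s 1 _ H3.
rewrite [X in is_derive _ _ X _](_ : _ = 2^-1 \*: (@ln R \o qd x y dx dy)); last first.
  by apply/funext => u; rewrite /= /GRing.scale /= mulrC.
apply: (is_derive_eq H4).
by rewrite /fd /GRing.scale /=; field; rewrite gt_eqF.
Qed.

Lemma ln_Cabs (z : C) : z != 0 ->
  ln (Cabs z) = ln (complex.Re z ^+ 2 + complex.Im z ^+ 2) / 2.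
Proof.
case: z => x y z0; rewrite /Cabs /=.
have q0 : 0 < x ^+ 2 + y ^+ 2.
  rewrite lt_neqAle addr_ge0 ?sqr_ge0// andbT eq_sym paddr_eq0 ?sqr_ge0//.
  by move: z0; rewrite eq_complex /= !sqrf_eq0.
rewrite -[in RHS](sqr_sqrtr (ltW q0)) lnXn ?sqrtr_gt0// -[_ *+ 2]mulr_natr mulfK ?pnatr_eq0.
all: rewrite ?sqrtr_gt0 ?pnatr_eq0 //.
Qed.

Local Lemma q_gt0 (z w a : C) (s : R) : z + s%:C * (w - z) != a ->
  0 < qd (complex.Re (z - a)) (complex.Im (z - a)) (complex.Re (w - z)) (complex.Im (w - z)) s.
Proof.
rewrite -subr_eq0 /qd; case: z w a => [z1 z2] [w1 w2] [a1 a2] /=.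
rewrite eq_complex /= => H.
rewrite lt_neqAle addr_ge0 ?sqr_ge0// andbT eq_sym paddr_eq0 ?sqr_ge0//.
rewrite !sqrf_eq0; apply: contra H => /andP[/eqP E1 /eqP E2]; apply/andP; split.
  by apply/eqP; apply: etrans _ E1; ring.
by apply/eqP; apply: etrans _ E2; ring.
Qed.

Local Lemma Re_div (z w a : C) (s r : R) : z + s%:C * (w - z) != a ->
  complex.Re (r%:C / 2 * (z + s%:C * (w - z) - a)^-1 * (w - z)) =
  r / 2 * fd (complex.Re (z - a)) (complex.Im (z - a)) (complex.Re (w - z)) (complex.Im (w - z)) s.
Proof.
move=> /q_gt0; rewrite /fd.
have -> : r%:C / 2 = (r / 2)%:C :> C by rewrite rmorphM fmorphV rmorphD rmorph1.
case: z w a => [z1 z2] [w1 w2] [a1 a2]; rewrite /qd /= => q0.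
have q1 := lt0r_neq0 q0; move: (r / 2) => c.
have -> : z1 + (s * (w1 - z1) - 0 * (w2 - z2)) - a1 = z1 - a1 + s * (w1 - z1) by ring.
have -> : z2 + (s * (w2 - z2) + 0 * (w1 - z1)) - a2 = z2 - a2 + s * (w2 - z2) by ring.
move: q1; set u := z1 - a1 + s * (w1 - z1); set v := z2 - a2 + s * (w2 - z2); move=> q1.
by field.
Qed.

Lemma dphi_real (p : nat) (a : 'I_p.+1 -> C) (r : 'I_p.+1 -> R) (z w : C) :
  (forall k (s : R), 0 <= s <= 1 -> z + s%:C * (w - z) != a k) ->
  let phi (u : C) := - \sum_(k < p.+1) r k / 2 * ln (Cabs (u - a k)) in
  dphi (dPhi a (fun k => (r k)%:C)) z w = phi w - phi z.
Proof.
move=> za phi.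
pose x k := complex.Re (z - a k); pose y k := complex.Im (z - a k).
pose dx := complex.Re (w - z); pose dy := complex.Im (w - z).
have q0 k (s : R) : 0 <= s <= 1 -> 0 < qd (x k) (y k) dx dy s.
  by move=> /(za k s); exact: q_gt0.
pose f (k : 'I_p.+1) : R -> R := (- (r k / 2)) \*: fd (x k) (y k) dx dy.
pose G (k : 'I_p.+1) : R -> R := (- (r k / 2)) \*: (fun s => ln (qd (x k) (y k) dx dy s) / 2).
have dG (s : R) : 0 <= s <= 1 -> is_derive s (1:R) (\sum_(k < p.+1) G k) (\sum_(k < p.+1) f k s).
  by move=> s01; apply: is_derive_sum => k; apply: is_deriveZ; apply: Gd; exact: q0.
have cG (s : R) : 0 <= s <= 1 -> {for s, continuous (\sum_(k < p.+1) G k)}.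
  by move=> /dG[d _]; apply/differentiable_continuous/derivable1_diffP.
have cf (s : R) : 0 <= s <= 1 -> {for s, continuous (fun s => \sum_(k < p.+1) f k s)}.
  move=> s01; rewrite /prop_for /continuous_at; apply: cvg_big => [|k _]; first exact: add_continuous.
  by apply: cvgZl_tmp; apply: fd_cont; exact: q0.

have cfE : {within `[0, 1], continuous (fun s => \sum_(k < p.+1) f k s)}.
  by apply: continuous_in_subspaceT => s; rewrite inE /= in_itv /= => /cf.
have FTC := @continuous_FTC2 R _ (\sum_(k < p.+1) G k) 0 1 ltr01 cfE.
rewrite /dphi /Rintegral.
rewrite (_ : integral _ _ _ = (\int[lebesgue_measure]_(s in `[0%R, 1%R]) (\sum_(k < p.+1) f k s)%:E)%E); last first.
  apply: eq_integral => s; rewrite inE /= in_itv /= => s01; congr EFin.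
  rewrite /dPhi mulNr mulr_suml raddfN /= raddf_sum -sumrN.
  apply: eq_bigr => k _. rewrite [X in - X](@Re_div _ _ (a k) s (r k)); last exact: za.
  by rewrite /f /= /GRing.scale /= mulNr.
rewrite FTC.
- rewrite /= !fct_sumE -sumrB /phi -opprB opprK -sumrN addrC -big_split /=.
  rewrite -sumrN; apply: eq_bigr => k _.
  have z0 : z - a k != 0.
    by rewrite subr_eq0; have := za k 0; rewrite lexx ler01 mul0r addr0; exact.
  have w0 : w - a k != 0.
    by rewrite subr_eq0; have := za k 1; rewrite lexx ler01 mul1r subrKC; exact.
  rewrite !ln_Cabs// /G /= /GRing.scale /= /qd /x /y /dx /dy !mul0r !mul1r !addr0.
  have -> : complex.Re (z - a k) + complex.Re (w - z) = complex.Re (w - a k).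
    by case: (z) (w) (a k) => [z1 z2] [w1 w2] [a1 a2] /=; ring.
  have -> : complex.Im (z - a k) + complex.Im (w - z) = complex.Im (w - a k).
    by case: (z) (w) (a k) => [z1 z2] [w1 w2] [a1 a2] /=; ring.
  by ring.
- split.
  + by move=> s; rewrite in_itv /= => /andP[s0 s1]; have [] := dG s; rewrite // !ltW.
  + by apply: cvg_at_right_filter; apply: cG; rewrite lexx ler01.
  + by apply: cvg_at_left_filter; apply: cG; rewrite lexx ler01.
- move=> s; rewrite in_itv /= => /andP[s0 s1]; rewrite derive1E.
  have s01 : 0 <= s <= 1 by rewrite !ltW.
  by have [_ ->] := dG s s01.
Qed.
End RealField.

(* Main.v *)
Require Import Defs.
From HB Require Import structures.
From mathcomp Require Import all_boot all_order all_algebra.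
From mathcomp Require Import all_classical all_reals all_analysis.
From mathcomp Require Import complex.
From mathcomp Require Import measurable_realfun ring lra.

Import Order.TTheory GRing.Theory Num.Theory.
Import numFieldNormedType.Exports.

Local Open Scope classical_set_scope.
Local Open Scope ring_scope.
Local Open Scope complex_scope.

(** Testing the equilibrium equations of a discrete critical measure against an
   arbitrary displacement [h] of its points [z_1, ..., z_n] gives the identity

     sum_(i <> j) (h z_i - h z_j) / (z_i - z_j)
       + sum_i sum_k rho_k (h z_i) / (z_i - a_k) = 0,

   and criticality of a continuous measure says that the first variation of its
   energy, which has the same form with integrals instead of sums, vanishes for
   all smooth [h] that are zero at the charges.  After division by [n ^ 2] one
   has to pass to a weak limit in a double sum whose kernel, the divided
   difference of [h], is bounded but not continuous on the diagonal, and in a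
   single sum whose kernel is not continuous at the charges.

   The diagonal is harmless away from the charges because zeros do not cluster
   there: a disc of radius [e] at distance of order [d] from the charges carries
   at most a fraction of order [sqrt (e / d)] of the zeros, uniformly in [n]
   ([zeros_concentration]).  This comes from the same identity, with [h] the
   projection onto the small disc, localized by a cut-off: the projection is a
   monotone map, so that all pairs of zeros contribute an almost nonnegative real
   part, and each pair in the disc contributes almost 1.  In particular the limit
   has no atoms off the charges ([no_atoms]).  For fields vanishing near the
   charges one can therefore regularize the kernel at a small cost and pass to
   the limit ([weak_crit_bound]), double averages being reduced to single ones by
   a partition of unity ([avg2_cvg]).

   Near the charges nothing has to be known about the zeros.  A Lipschitz field
   that vanishes at the charges is the limit of fields vanishing near them, with
   the same Lipschitz bound up to a factor: truncate its small values.  The first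
   variation of the limit measure passes to this limit by dominated convergence,
   even if this measure has atoms at the charges ([weak_crit0]).

   Criticality follows since the increments of the energy along a small Lipschitz
   displacement vanishing at the charges are given by the first variation up to a
   quadratic error ([denergy_phi_expand]), a smooth field being replaced by a
   compactly supported Lipschitz one that agrees with it where the measure lives.

   Finally, the equation of the zero of largest modulus shows that the zeros stay
   bounded when the total charge has real part greater than [-1/2]
   ([zeros_bounded]), so that no mass escapes to infinity. *)

(** * The modulus and the real part *)

Section Modulus.
Set Implicit Arguments.
Unset Strict Implicit.
Variable R : realType.
Local Notation C := R[i].
Implicit Types x y z u : C.

Lemma sub_subl (r s t : R) : r - s - (r - t) = t - s.
Proof. by ring. Qed.

Lemma maxr_dist (r s t : R) :
  `|Order.max r s - Order.max r t| <= `|s - t|.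
Proof.
case: (leP r s) => ?; case: (leP r t) => ?; rewrite ler_norml;
  case: (ger0P (s - t)) => ?; apply/andP; split; lra.
Qed.

Lemma minr_dist (r s t : R) :
  `|Order.min r s - Order.min r t| <= `|s - t|.
Proof.
case: (leP r s) => ?; case: (leP r t) => ?; rewrite ler_norml;
  case: (ger0P (s - t)) => ?; apply/andP; split; lra.
Qed.

Lemma Cabs0 : Cabs (0 : C) = 0 :> R.
Proof. exact: Normc.normc0. Qed.

Lemma Cabs1 : Cabs (1 : C) = 1 :> R.
Proof. exact: Normc.normc1. Qed.

Lemma CabsM x y : Cabs (x * y) = Cabs x * Cabs y.
Proof. exact: Normc.normcM. Qed.

Lemma CabsV x : Cabs x^-1 = (Cabs x)^-1.
Proof. exact: Normc.normcV. Qed.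

Lemma CabsN x : Cabs (- x) = Cabs x.
Proof. exact: normcN. Qed.

Lemma CabsB x y : Cabs (x - y) = Cabs (y - x).
Proof. by rewrite -CabsN opprB. Qed.

Lemma Cabs_ge0 x : 0 <= Cabs x.
Proof. by case: x => a b; exact: sqrtr_ge0. Qed.

Lemma Cabs_eq0 x : (Cabs x == 0) = (x == 0).
Proof.
by apply/eqP/eqP => [|->]; [exact: Normc.eq0_normc|exact: Cabs0].
Qed.

Lemma Cabs_gt0 x : (0 < Cabs x) = (x != 0).
Proof. by rewrite lt_neqAle Cabs_ge0 andbT eq_sym Cabs_eq0. Qed.

Lemma Cabs_sqr x : Cabs x ^+ 2 = complex.Re x ^+ 2 + complex.Im x ^+ 2.
Proof. by case: x => a b; rewrite /Cabs /= sqr_sqrtr// addr_ge0 ?sqr_ge0. Qed.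

Lemma CabsD x y : Cabs (x + y) <= Cabs x + Cabs y.
Proof. exact: le_normcD. Qed.

Lemma Cabs_sub_le x y : Cabs (x - y) <= Cabs x + Cabs y.
Proof. by rewrite -[leRHS](congr1 (+%R _) (CabsN y)) CabsD. Qed.

Lemma Cabs_triangle x y z : Cabs (x - z) <= Cabs (x - y) + Cabs (y - z).
Proof. by rewrite -[x - z](subrKA y) CabsD. Qed.

Lemma Cabs_dist x y : `|Cabs x - Cabs y| <= Cabs (x - y).
Proof.
have H z u : Cabs z - Cabs u <= Cabs (z - u) by rewrite lerBlDr -{1}(subrK u z) CabsD.
by rewrite ler_norml H lerNl opprB CabsB H.
Qed.

Lemma Cabs_real (r : R) : Cabs r%:C = `|r|.
Proof. by rewrite /Cabs /= expr0n addr0 sqrtr_sqr. Qed.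

Lemma Cabs_conj x : Cabs (conjc x) = Cabs x.
Proof. by case: x => a b; rewrite /Cabs /= sqrrN. Qed.

Lemma Re_le_Cabs x : `|complex.Re x| <= Cabs x.
Proof.
by rewrite -ler_sqr ?nnegrE ?Cabs_ge0// Cabs_sqr real_normK ?num_real// lerDl sqr_ge0.
Qed.

Lemma Im_le_Cabs x : `|complex.Im x| <= Cabs x.
Proof.
by rewrite -ler_sqr ?nnegrE ?Cabs_ge0// Cabs_sqr real_normK ?num_real// lerDr sqr_ge0.
Qed.

Lemma Cabs_le_ReIm x : Cabs x <= `|complex.Re x| + `|complex.Im x|.
Proof.
rewrite -ler_sqr ?nnegrE ?Cabs_ge0 ?addr_ge0// Cabs_sqr sqrrD !real_normK ?num_real//.
by rewrite lerD2r lerDl mulrn_wge0// mulr_ge0.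
Qed.

Lemma ReD x y : complex.Re (x + y) = complex.Re x + complex.Re y.
Proof. by case: x y => ? ? [] ? ?. Qed.

Lemma ReN x : complex.Re (- x) = - complex.Re x.
Proof. by case: x. Qed.

Lemma ReB x y : complex.Re (x - y) = complex.Re x - complex.Re y.
Proof. by rewrite ReD ReN. Qed.

Lemma ReM x y : complex.Re (x * y) =
  complex.Re x * complex.Re y - complex.Im x * complex.Im y.
Proof. by case: x y => ? ? [] ? ?. Qed.

Lemma ReMr (r : R) x : complex.Re (r%:C * x) = r * complex.Re x.
Proof. by rewrite ReM /= mul0r subr0. Qed.

Lemma ReM2 x : complex.Re (2 * x) = 2 * complex.Re x.
Proof. by rewrite !mulr_natl mulr2n ReD -mulr2n. Qed.

Lemma ReMi x : complex.Re ('i * x) = - complex.Im x.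
Proof. by rewrite mulrC ReiNIm. Qed.

Lemma Re_sum I (s : seq I) (P : pred I) (f : I -> C) :
  complex.Re (\sum_(i <- s | P i) f i) = \sum_(i <- s | P i) complex.Re (f i).
Proof. by apply: (big_morph _ ReD). Qed.

Lemma Cabs_sum I (s : seq I) (P : pred I) (f : I -> C) :
  Cabs (\sum_(i <- s | P i) f i) <= \sum_(i <- s | P i) Cabs (f i).
Proof.
elim/big_rec2: _ => [|i y1 y2 _ H]; first by rewrite Cabs0.
by apply: le_trans (CabsD _ _) _; rewrite lerD2l.
Qed.

Lemma normB_sqr x y : Cabs (x - y) ^+ 2 =
  Cabs x ^+ 2 + Cabs y ^+ 2 - 2 * complex.Re (x * conjc y).
Proof. by case: x y => a b [c d]; rewrite !Cabs_sqr /=; ring. Qed.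

(** The quadratic control of the error serves both for the derivatives of the
   discrete energy and for the variations of the continuous one. *)
Lemma ln_Cabs_1D u : Cabs u <= 4^-1 ->
  `|ln (Cabs (1 + u)) - complex.Re u| <= 6 * Cabs u ^+ 2.
Proof.
move=> u4; have u0 := Cabs_ge0 u.
have u1 : 1 + u != 0.
  apply: contraTN u4 => /eqP/(canRL (addKr 1)); rewrite addr0 => ->.
  by rewrite CabsN Cabs1 -ltNge; lra.
rewrite ln_Cabs//.
have au := Re_le_Cabs u; have bu := Cabs_sqr u.
move: au bu; rewrite ReD /= (_ : complex.Im (1 + u) = complex.Im u); last first.
  by case: (u) => a b /=; rewrite add0r.
move: (complex.Re u) (complex.Im u) => a b; rewrite ler_norml => /andP[a1 a2] bu.
set q := Cabs u in u0 u4 a1 a2 bu *.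
pose v := 2 * a + q ^+ 2.
have -> : (1 + a) ^+ 2 + b ^+ 2 = 1 + v by rewrite /v bu; ring.
have v1 : - (9 / 4 * q) <= v by rewrite /v; nra.
have v2 : v <= 9 / 4 * q by rewrite /v; nra.
have v3 : 7 / 16 <= 1 + v by lra.
have vp : 0 < 1 + v by lra.
have up : ln (1 + v) <= v by apply: le_ln1Dx; lra.
have lo : v - v ^+ 2 / (1 + v) <= ln (1 + v).
  have Iv : (1 + v)^-1 - 1 = - v + v ^+ 2 / (1 + v) by field; lra.
  have : ln (1 + ((1 + v)^-1 - 1)) <= (1 + v)^-1 - 1.
    by apply: le_ln1Dx; rewrite ltrBrDr addNr invr_gt0.
  by rewrite (addrC 1) subrK lnV ?posrE// Iv; lra.
have vq : v ^+ 2 / (1 + v) <= 81 / 7 * q ^+ 2.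
  rewrite ler_pdivrMr//.
  have : v ^+ 2 <= 81 / 16 * q ^+ 2 by nra.
  have := sqr_ge0 q; nra.
have aE : a = (v - q ^+ 2) / 2 by rewrite /v; field.
have := sqr_ge0 q.
by rewrite ler_norml {}aE; set q2 := q ^+ 2 in vq * => q20; lra.
Qed.

(** Displacements whose difference is small relative to the distance of the two
   points multiply [x - y] by a factor close to 1. *)
Lemma logk_expand x y u v : Cabs (u - v) <= 4^-1 * Cabs (x - y) ->
  `|logk (x + u) (y + v) - logk x y + complex.Re ((u - v) / (x - y))| <=
  6 * (Cabs (u - v) / Cabs (x - y)) ^+ 2.
Proof.
have E : x + u - (y + v) = x - y + (u - v) by ring.
rewrite /logk {}E; move: (u - v) => {u v} z.
have [->|xy] := eqVneq x y.
  rewrite subrr Cabs0 mulr0 => z0.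
  have -> : z = 0 by apply/eqP; rewrite -Cabs_eq0; apply/eqP/le_anti; rewrite z0 Cabs_ge0.
  by rewrite addr0 Cabs0 !mul0r expr0n /= mulr0 subrr add0r normr0.
have xy0 : x - y != 0 by rewrite subr_eq0.
move: xy0; move: (x - y) => {xy x y} w w0 zw.
have p0 : 0 < Cabs w by rewrite Cabs_gt0.
have := @ln_Cabs_1D (z / w).
rewrite CabsM CabsV ler_pdivrMr// => /(_ zw).
have -> : w + z = w * (1 + z / w) by field.
rewrite CabsM lnM ?posrE// ?Cabs_gt0//; last first.
  apply: contraTneq zw => /(canRL (addKr 1)); rewrite addr0 => H.
  have -> : z = - w by rewrite -[z](divfK w0) H mulN1r.
  by rewrite CabsN -ltNge; lra.
by rewrite -normrN; congr (`| _ | <= _); ring.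
Qed.

End Modulus.

(** * Measurability and integration of bounded functions *)

Section Measurability.
Set Implicit Arguments.
Unset Strict Implicit.
Variable R : realType.
Local Notation C := R[i].

Lemma measurable_invr : measurable_fun [set: R] (@GRing.inv R).
Proof.
rewrite -(setUv [set 0 : R]); apply/measurable_funU => //; first exact: measurableC.
split; first exact: measurable_fun_set1.
apply: open_continuous_measurable_fun; first by apply: closed_openC; exact: closed_eq.
by move=> x; rewrite inE /= => /eqP x0; exact: inv_continuous.
Qed.

Context d (T : measurableType d).
Implicit Types f g : T -> C.

(** Measurability for complex functions, componentwise: it makes sense on
   products without comparing the product of Borel sigma-algebras with the
   Borel sigma-algebra of the product. *)
Definition Cmeas f := measurable_fun setT (fun x => complex.Re (f x)) /\
  measurable_fun setT (fun x => complex.Im (f x)).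

Lemma Cmeas_cst (c : C) : Cmeas (fun=> c).
Proof. by split; exact: measurable_cst. Qed.

Lemma CmeasD f g : Cmeas f -> Cmeas g -> Cmeas (fun x => f x + g x).
Proof.
move=> [f1 f2] [g1 g2]; split.
  by under eq_fun do rewrite ReD; exact: measurable_funD.
rewrite (_ : (fun x => _) = (fun x => complex.Im (f x) + complex.Im (g x))).
  exact: measurable_funD.
by apply/funext => x; case: (f x) (g x) => ? ? [].
Qed.

Lemma CmeasN f : Cmeas f -> Cmeas (fun x => - f x).
Proof.
move=> [f1 f2]; split.
  by under eq_fun do rewrite ReN; exact: measurableT_comp.
rewrite (_ : (fun x => _) = (fun x => - complex.Im (f x))).
  exact: measurableT_comp.
by apply/funext => x; case: (f x).
Qed.

Lemma CmeasB f g : Cmeas f -> Cmeas g -> Cmeas (fun x => f x - g x).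
Proof. by move=> mf mg; apply: CmeasD => //; exact: CmeasN. Qed.

Lemma CmeasM f g : Cmeas f -> Cmeas g -> Cmeas (fun x => f x * g x).
Proof.
move=> [f1 f2] [g1 g2]; split.
  by under eq_fun do rewrite ReM; apply: measurable_funB; exact: measurable_funM.
rewrite (_ : (fun x => _) = (fun x => complex.Re (f x) * complex.Im (g x) +
    complex.Im (f x) * complex.Re (g x))).
  by apply: measurable_funD; exact: measurable_funM.
by apply/funext => x; case: (f x) (g x) => ? ? [].
Qed.

Lemma Cmeas_real (r : T -> R) : measurable_fun setT r -> Cmeas (fun x => (r x)%:C).
Proof. by move=> mr; split => //=; exact: measurable_cst. Qed.

Lemma Cmeas_conj f : Cmeas f -> Cmeas (fun x => conjc (f x)).
Proof.
move=> [f1 f2]; split.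
  rewrite (_ : (fun x => _) = (fun x => complex.Re (f x)))//.
  by apply/funext => x; case: (f x).
rewrite (_ : (fun x => _) = (fun x => - complex.Im (f x))); first exact: measurableT_comp.
by apply/funext => x; case: (f x).
Qed.

Lemma measurable_Cabs f : Cmeas f -> measurable_fun setT (fun x => Cabs (f x)).
Proof.
move=> [f1 f2]; rewrite (_ : (fun x => _) = (fun x => Num.sqrt
    (complex.Re (f x) ^+ 2 + complex.Im (f x) ^+ 2))); last first.
  by apply/funext => x; case: (f x).
apply: measurableT_comp.
  by apply: continuous_measurable_fun; exact: sqrt_continuous.
by apply: measurable_funD; exact: measurable_funX.
Qed.

Lemma CmeasV f : Cmeas f -> Cmeas (fun x => (f x)^-1).
Proof.
move=> mf.
have -> : (fun x => (f x)^-1) = (fun x => ((Cabs (f x) ^+ 2)^-1)%:C * conjc (f x)).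
  apply/funext => x; rewrite Cabs_sqr; case: (f x) => a b /=.
  by apply/eqP; rewrite eq_complex /= !mul0r subr0 addr0 mulrC eqxx /= mulrN mulrC.
apply: CmeasM; last exact: Cmeas_conj.
apply: Cmeas_real; apply: (measurableT_comp measurable_invr).
by apply: measurable_funX; exact: measurable_Cabs.
Qed.

Lemma Cmeas_sum (I : Type) (s : seq I) (f : I -> T -> C) :
  (forall i, Cmeas (f i)) -> Cmeas (fun x => \sum_(i <- s) f i x).
Proof.
move=> mf; elim: s => [|i s IH].
  by under eq_fun do rewrite big_nil; exact: Cmeas_cst.
by under eq_fun do rewrite big_cons; exact: CmeasD.
Qed.

End Measurability.

Section BoundedIntegral.
Set Implicit Arguments.
Unset Strict Implicit.
Variable R : realType.
Context d (T : measurableType d) (mu : {measure set T -> \bar R}).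
Implicit Types (D : set T) (f g : T -> R).

Lemma integrable_bnd D f M : measurable D -> (mu D < +oo)%E ->
  measurable_fun D f -> (forall x, D x -> `|f x| <= M) ->
  mu.-integrable D (EFin \o f).
Proof.
move=> mD Dfin mf fM; apply: measurable_bounded_integrable => //.
exists M; split; first exact: num_real.
by move=> x Mx y Dy /=; apply: le_trans (fM y Dy) (ltW Mx).
Qed.

Lemma Rintegral_dist D f g M : measurable D -> (mu D < +oo)%E ->
  mu.-integrable D (EFin \o f) -> mu.-integrable D (EFin \o g) ->
  (forall x, D x -> `|f x - g x| <= M) ->
  `|Rintegral mu D f - Rintegral mu D g| <= M * fine (mu D).
Proof.
move=> mD Dfin if_ ig fgM; rewrite -RintegralB// -Rintegral_cst//.
have iB : mu.-integrable D (EFin \o (fun x => f x - g x)).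
  by have := integrableB mD if_ ig; apply: eq_integrable => // x _; rewrite /= EFinB.
apply: le_trans (le_normr_Rintegral _ _) _ => //.
apply: le_Rintegral => //; first exact: integrable_norm iB.
by apply: (@integrable_bnd _ _ `|M|) => //; exact: measurable_cst.
Qed.

Lemma Rintegral_bounded_cvg (f_ : nat -> T -> R) f (M : R) :
  (mu setT < +oo)%E -> (forall k, measurable_fun setT (f_ k)) ->
  (forall k x, `|f_ k x| <= M) ->
  (forall x, f_ k x @[k --> \oo] --> f x) ->
  Rintegral mu setT (f_ k) @[k --> \oo] --> Rintegral mu setT f.
Proof.
move=> fin mf fM ff.
have mlim : measurable_fun setT f.
  by apply: (measurable_fun_cvg mf) => x _; exact: ff.
have iM : mu.-integrable setT (EFin \o cst M).
  by apply: (@integrable_bnd _ _ `|M|) => //; exact: measurable_cst.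
have mfE k : measurable_fun setT (EFin \o f_ k) by exact/measurable_EFinP.
have mE : measurable_fun setT (EFin \o f) by exact/measurable_EFinP.
have cE : {ae mu, forall x, setT x -> (EFin \o f_ k) x @[k --> \oo] --> (EFin \o f) x}.
  by apply: aeW => x _; apply/fine_cvgP; split; [exact: nearW|exact: ff].
have bE : {ae mu, forall x k, setT x -> (`|(EFin \o f_ k) x| <= (EFin \o cst M) x)%E}.
  by apply: aeW => x k _; rewrite /= lee_fin.
have [if_ _] := dominated_convergence measurableT mfE mE cE iM bE.
rewrite -[X in _ --> X -> _]fineK; last exact: integrable_fin_num.
by move/fine_cvg.
Qed.

Lemma Rintegral_sum (I : Type) (s : seq I) (f : I -> T -> R) :
  (forall i, mu.-integrable setT (EFin \o f i)) ->
  mu.-integrable setT (EFin \o (fun x => \sum_(i <- s) f i x)) /\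
  Rintegral mu setT (fun x => \sum_(i <- s) f i x) = \sum_(i <- s) Rintegral mu setT (f i).
Proof.
move=> if_; elim: s => [|i s [IH1 IH2]].
  have -> : (fun x => \sum_(i <- [::]) f i x) = cst 0 by apply/funext => x; rewrite big_nil.
  by rewrite big_nil Rintegral_cst// mul0r; split => //; exact: integrable0.
have -> : (fun x => \sum_(j <- i :: s) f j x) = (fun x => f i x + \sum_(j <- s) f j x).
  by apply/funext => x; rewrite big_cons.
rewrite big_cons RintegralD// IH2; split => //.
by apply: (@eq_integrable _ _ _ _ _ _ _ _ _ (integrableD measurableT (if_ i) IH1)).
Qed.

End BoundedIntegral.

(** * First-order expansion of the external field *)

Section FieldExpansion.
Set Implicit Arguments.
Unset Strict Implicit.
Variables (R : realType) (p : nat) (a rho : 'I_p.+1 -> R[i]).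
Local Notation C := R[i].
Implicit Types z w : C.

Lemma Cmeas_dPhi d (T : measurableType d) (f : T -> C) :
  Cmeas f -> Cmeas (fun x => dPhi a rho (f x)).
Proof.
move=> mf; apply: CmeasN; apply: Cmeas_sum => k.
apply: CmeasM; first exact: Cmeas_cst.
by apply: CmeasV; apply: CmeasB => //; exact: Cmeas_cst.
Qed.

(** A displacement by at most half the distance to every charge stays away from
   the poles; a charge sitting at the base point forces the displacement to be
   zero, and contributes nothing. *)
Lemma dPhi_expand z w (s : R) : 0 <= s <= 1 ->
  (forall k, Cabs w <= 2^-1 * Cabs (z - a k)) ->
  `|complex.Re (dPhi a rho (z + s%:C * w) * w) - complex.Re (dPhi a rho z * w)| <=
  \sum_(k < p.+1) Cabs (rho k) * (Cabs w / Cabs (z - a k)) ^+ 2.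
Proof.
move=> /andP[s0 s1] wza; rewrite -ReB -mulrBl /dPhi -opprD mulNr ReN normrN.
rewrite -sumrB mulr_suml; apply: le_trans (Re_le_Cabs _) _.
apply: le_trans (Cabs_sum _ _ _) _; apply: ler_sum => k _.
rewrite -mulrBr -2!mulrA CabsM; apply: ler_wpM2l; first exact: Cabs_ge0.
have wz := wza k; have w0 := Cabs_ge0 w.
have [E|za] := eqVneq z (a k).
  move: wz; rewrite E subrr Cabs0 mulr0 => wz.
  have -> : w = 0 by apply/eqP; rewrite -Cabs_eq0; apply/eqP/le_anti; rewrite wz w0.
  by rewrite !mulr0 Cabs0 !mul0r expr0n.
set v := z - a k in wz *.
have v0 : v != 0 by rewrite subr_eq0.
have vp : 0 < Cabs v by rewrite Cabs_gt0.
have vw : 2^-1 * Cabs v <= Cabs (v + s%:C * w).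
  have := Cabs_sub_le (v + s%:C * w) (s%:C * w); rewrite addrK CabsM Cabs_real ger0_norm//.
  by move: wz; nra.
have vsw0 : v + s%:C * w != 0 by rewrite -Cabs_gt0 (lt_le_trans _ vw)// mulr_gt0// invr_gt0.
have -> : z + s%:C * w - a k = v + s%:C * w by rewrite /v; ring.
have -> : 2^-1 * (((v + s%:C * w)^-1 - v^-1) * w) =
    - (2^-1 * (s%:C * w ^+ 2) / ((v + s%:C * w) * v)).
  by field; rewrite v0 vsw0.
rewrite CabsN expr2 !(CabsM, CabsV) Cabs_real ger0_norm//.
have -> : Cabs (2 : C) = 2 :> R.
  by rewrite (_ : 2 = (2 : R)%:C) ?Cabs_real ?ger0_norm// rmorphD rmorph1.
have vswp : 0 < Cabs (v + s%:C * w) by rewrite Cabs_gt0.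
move: (Cabs w) (Cabs v) (Cabs (v + _)) wz vw vp vswp w0 => x y q wz vw vp qp w0.
have -> : 2^-1 * (s * (x * x)) * (q * y)^-1 = (s * (2^-1 * (y / q))) * (x / y) ^+ 2.
  by field; rewrite !gt_eqF.
have yq : y / q <= 2 by rewrite ler_pdivrMr//; lra.
have yq0 : 0 <= y / q by rewrite divr_ge0// ltW.
by rewrite ler_piMl ?sqr_ge0//; nra.
Qed.

Lemma dphi_expand z w : (forall k, Cabs w <= 2^-1 * Cabs (z - a k)) ->
  `|dphi (dPhi a rho) z (z + w) - complex.Re (dPhi a rho z * w)| <=
  \sum_(k < p.+1) Cabs (rho k) * (Cabs w / Cabs (z - a k)) ^+ 2.
Proof.
move=> wza; set M := \sum_(k < _) _.
pose l : R := complex.Re (dPhi a rho z * w).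
have m01 : lebesgue_measure `[0%R, 1%R]%classic = 1%E :> \bar R.
  by rewrite lebesgue_measure_itv /= lte_fin ltr01 oppr0 adde0.
have mD : measurable `[0%R, 1%R : R]%classic by [].
have fin : (lebesgue_measure `[0%R, 1%R : R]%classic < +oo)%E by rewrite m01 ltry.
have -> : dphi (dPhi a rho) z (z + w) = Rintegral lebesgue_measure `[0%R, 1%R]%classic
    (fun s : R => complex.Re (dPhi a rho (z + s%:C * w) * w)).
  by rewrite /dphi (_ : z + w - z = w) ?[z + w]addrC ?addrK.
have -> : complex.Re (dPhi a rho z * w) =
    Rintegral lebesgue_measure `[0%R, 1%R]%classic (fun s : R => l).
  by rewrite Rintegral_cst// [X in fine X]m01 mulr1.
apply: (@le_trans _ _ (M * fine (lebesgue_measure `[0%R, 1%R : R]%classic))); last first.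
  by rewrite [X in fine X]m01 mulr1.
have H x : `[0%R, 1%R]%classic x ->
    `|complex.Re (dPhi a rho (z + x%:C * w) * w) - l| <= M.
  by rewrite /= in_itv /= => x01; exact: dPhi_expand x01 wza.
apply: Rintegral_dist => //.
- apply: (@integrable_bnd _ _ _ _ _ _ (M + `|l|)) => //.
    apply: measurable_funTS; apply: (CmeasM _ (Cmeas_cst _ _)).1; apply: Cmeas_dPhi.
    apply: CmeasD; first exact: Cmeas_cst.
    by apply: CmeasM; [exact: Cmeas_real|exact: Cmeas_cst].
  move=> x /H; rewrite -lerBlDr; apply: le_trans.
  by rewrite lerBlDr -{1}[X in `|X|](subrK l) ler_normD.
- by apply: (@integrable_bnd _ _ _ _ _ _ `|l|) => //; exact: measurable_cst.
Qed.

End FieldExpansion.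

(** * The discrete equilibrium equations *)

Section DiscreteEquilibrium.
Set Implicit Arguments.
Unset Strict Implicit.
Variable R : realType.
Local Notation C := R[i].

Lemma near0S (P Q : R -> Prop) : (\forall s \near (0 : R), P s) ->
  (forall s, P s -> Q s) -> \forall s \near (0 : R), Q s.
Proof. by move=> nP PQ; near=> s; apply: PQ; near: s. Unshelve. all: by end_near. Qed.

Lemma near0S2 (P Q S : R -> Prop) : (\forall s \near (0 : R), P s) ->
  (\forall s \near (0 : R), Q s) ->
  (forall s, P s -> Q s -> S s) -> \forall s \near (0 : R), S s.
Proof.
by move=> nP nQ PQ; near=> s; apply: PQ; near: s.
Unshelve. all: by end_near. Qed.

(** A form of differentiability at 0 that is stable under finite sums and is what
   the expansions of the kernel and of the field provide. *)
Definition quad_expand (f : R -> R) (l : R) :=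
  exists M, \forall s \near (0 : R), `|f s - s * l| <= M * s ^+ 2.

Lemma quad_expand_sum I (r : seq I) (P : pred I) (f : I -> R -> R) (l : I -> R) :
  (forall i, P i -> quad_expand (f i) (l i)) ->
  quad_expand (fun s => \sum_(i <- r | P i) f i s) (\sum_(i <- r | P i) l i).
Proof.
move=> fl; elim: r => [|i r [M IH]].
  exists 0; apply: filterE => s; by rewrite !big_nil mulr0 subrr normr0 mul0r.
have [Pi|nPi] := boolP (P i); last first.
  by exists M; apply: (near0S IH) => s; rewrite !big_cons (negbTE nPi).
have [M' IH'] := fl i Pi; exists (M' + M).
apply: (near0S2 IH IH') => {IH IH'} s IH IH'; rewrite !big_cons Pi mulrDr opprD addrACA mulrDl.
by apply: le_trans (ler_normD _ _) _; exact: lerD.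
Qed.

Lemma quad_expand_eq f g l : f =1 g -> quad_expand g l -> quad_expand f l.
Proof. by move=> /funext ->. Qed.

Lemma quad_expandD f g l m : quad_expand f l -> quad_expand g m ->
  quad_expand (fun s => f s + g s) (l + m).
Proof.
move=> [M H] [M' H']; exists (M + M').
apply: (near0S2 H H') => {H H'} s H H'; rewrite mulrDr opprD addrACA mulrDl.
by apply: le_trans (ler_normD _ _) _; exact: lerD.
Qed.

Lemma quad_expandZ c f l : quad_expand f l -> quad_expand (fun s => c * f s) (c * l).
Proof.
move=> [M H]; exists (`|c| * M); apply: (near0S H) => {H} s H.
by rewrite mulrCA -mulrBr normrM -mulrA ler_wpM2l.
Qed.

Lemma near0_scale_le (w c : R) : 0 < c -> \forall s \near (0 : R), `|s| * w <= c.
Proof.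
move=> c0.
have d0 : 0 < c / (`|w| + 1) by rewrite divr_gt0// ltr_wpDl.
have := @nbhs0_le R R _ d0; move/near0S; apply => s sd; apply: (@le_trans _ _ (`|s| * (`|w| + 1))).
  by rewrite ler_wpM2l// (le_trans (ler_norm w))// lerDl.
by rewrite -ler_pdivlMr ?ltr_wpDl.
Qed.

Lemma quad_expand_derive1 (g f : R -> R) l : (forall s, f s = g s - g 0) ->
  quad_expand f l -> derive1 g 0 = l.
Proof.
move=> fg [M H]; apply/cvg_lim => //; apply/cvgrPdist_le => e e0.
rewrite near_withinE /=.
have := @near0_scale_le `|M| e e0.
move/near0S2 => /(_ _ _ H); apply => {H} s Ms H s0; rewrite addr0 -fg distrC.
have -> : s^-1 *: f s - l = s^-1 * (f s - s * l).
  by rewrite /GRing.scale /= mulrBr mulKf.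
rewrite normrM normfV ler_pdivrMl ?normr_gt0//; apply: le_trans H _.
apply: le_trans (ler_wpM2r (sqr_ge0 _) (ler_norm M)) _.
by rewrite -real_normK ?num_real// expr2 mulrA [leLHS]mulrC ler_wpM2l// mulrC.
Qed.

(** Its real part is minus the derivative of the discrete energy in the direction
   [u].  Being complex linear in [u], it vanishes for all [u] as soon as the real
   and imaginary coordinate derivatives of the energy do. *)
Definition equilibrium (F : C -> C) (n : nat) (z u : nat -> C) : C :=
  \sum_(0 <= i < n) \sum_(0 <= j < n | j != i) (u i - u j) / (z i - z j) -
  2 * \sum_(0 <= i < n) F (z i) * u i.

Lemma equilibrium_lin F n z (c : C) u v :
  equilibrium F n z (fun i => c * u i + v i) =
  c * equilibrium F n z u + equilibrium F n z v.
Proof.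
rewrite /equilibrium.
have -> : \sum_(0 <= i < n) F (z i) * (c * u i + v i) =
    c * (\sum_(0 <= i < n) F (z i) * u i) + \sum_(0 <= i < n) F (z i) * v i.
  by rewrite mulr_sumr -big_split; apply: eq_bigr => i _ /=; ring.
have -> : \sum_(0 <= i < n) \sum_(0 <= j < n | j != i)
      (c * u i + v i - (c * u j + v j)) / (z i - z j) =
    c * (\sum_(0 <= i < n) \sum_(0 <= j < n | j != i) (u i - u j) / (z i - z j)) +
    \sum_(0 <= i < n) \sum_(0 <= j < n | j != i) (v i - v j) / (z i - z j).
  rewrite mulr_sumr -big_split; apply: eq_bigr => i _ /=.
  by rewrite mulr_sumr -big_split; apply: eq_bigr => j _ /=; ring.
ring.
Qed.

Lemma equilibrium0 F n z : equilibrium F n z (fun=> 0) = 0.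
Proof.
rewrite /equilibrium big1 => [|i _]; last first.
  by rewrite big1// => j _; rewrite subr0 mul0r.
rewrite big1 => [|i _]; last by rewrite mulr0.
by rewrite mulr0 subr0.
Qed.

Lemma equilibrium_eq F n z u v : (forall i, (i < n)%N -> u i = v i) ->
  equilibrium F n z u = equilibrium F n z v.
Proof.
move=> uv; rewrite /equilibrium; congr (_ - 2 * _).
  rewrite !big_mkord; apply: eq_bigr => i _; rewrite !big_mkord.
  by apply: eq_bigr => j _; rewrite !uv.
by rewrite !big_mkord; apply: eq_bigr => i _; rewrite uv.
Qed.

Lemma equilibrium_sum F n z (s : seq nat) (c : nat -> C) (v : nat -> nat -> C) :
  equilibrium F n z (fun i => \sum_(k <- s) c k * v k i) =
  \sum_(k <- s) c k * equilibrium F n z (v k).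
Proof.
elim: s => [|k s IH].
  under [X in equilibrium _ _ _ X]eq_fun do rewrite big_nil.
  by rewrite big_nil equilibrium0.
under [X in equilibrium _ _ _ X]eq_fun do rewrite big_cons.
by rewrite big_cons equilibrium_lin IH.
Qed.

Variables (p : nat) (a rho : 'I_p.+1 -> C).
Local Notation F := (dPhi a rho).

Lemma energy_expand n (z u : nat -> C) :
  (forall i j, (i < n)%N -> (j < n)%N -> z i = z j -> i = j) ->
  (forall i, (i < n)%N -> ~ range a (z i)) ->
  quad_expand
    (fun s => disc_energy_phi F n z (fun j => z j + s%:C * u j) - disc_energy_phi F n z z)
    (- complex.Re (equilibrium F n z u)).
Proof.
move=> zinj zA.
have dphi0 w : dphi F w w = 0.
  rewrite /dphi /Rintegral integral0_eq// => s _ /=.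
  by rewrite subrr !mulr0.
have -> : - complex.Re (equilibrium F n z u) =
    \sum_(0 <= i < n) \sum_(0 <= j < n | j != i) (- complex.Re ((u i - u j) / (z i - z j)))
    + 2 * \sum_(0 <= i < n) complex.Re (F (z i) * u i).
  rewrite /equilibrium ReB opprB addrC ReM2 !Re_sum -sumrN; congr (_ + _).
  by apply: eq_bigr => i _; rewrite Re_sum sumrN.
apply: (@quad_expand_eq _ (fun s => \sum_(0 <= i < n) \sum_(0 <= j < n | j != i)
       (logk (z i + s%:C * u i) (z j + s%:C * u j) - logk (z i) (z j))
     + 2 * \sum_(0 <= i < n) dphi F (z i) (z i + s%:C * u i))).
  move=> s; rewrite /disc_energy_phi [X in _ - (_ + 2 * X)]big1 ?mulr0 ?addr0//.
  rewrite addrAC; congr (_ + _); rewrite /disc_energy -sumrB.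
  by apply: eq_bigr => i _; rewrite sumrB.
apply: quad_expandD.
  rewrite big_mkord; under eq_fun do rewrite big_mkord.
  apply: quad_expand_sum => i _.
  rewrite big_mkord; under eq_fun do rewrite big_mkord.
  apply: quad_expand_sum => j ij.
  have zij : z i - z j != 0.
    by rewrite subr_eq0; apply: contraNneq ij => /zinj -> //; rewrite ltn_ord.
  exists (6 * (Cabs (u i - u j) / Cabs (z i - z j)) ^+ 2).
  have := @near0_scale_le (Cabs (u i - u j)) (4^-1 * Cabs (z i - z j)).
  rewrite mulr_gt0 ?invr_gt0 ?Cabs_gt0// => /(_ isT).
  move/near0S; apply => s sij.
  have := @logk_expand R (z i) (z j) (s%:C * u i) (s%:C * u j).
  rewrite -(mulrBr s%:C) -(mulrA s%:C) ReMr CabsM Cabs_real => /(_ sij).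
  rewrite mulrN (opprK (s * _)) => /le_trans; apply.
  by rewrite -[`|s| * _ / _]mulrA exprMn mulrCA real_normK ?num_real// mulrC.
apply: quad_expandZ.
rewrite big_mkord; under eq_fun do rewrite big_mkord.
apply: quad_expand_sum => i _.
exists (\sum_(k < p.+1) Cabs (rho k) * (Cabs (u i) / Cabs (z i - a k)) ^+ 2).
have : \forall s \near (0 : R), forall k, Cabs (s%:C * u i) <= 2^-1 * Cabs (z i - a k).
  apply: (@filter_forall _ _ _ _ (nbhs_filter (0 : R))) => k.
  have za : z i - a k != 0.
    rewrite subr_eq0; apply/eqP => E; apply: (zA i) => //; by exists k.
  have := @near0_scale_le (Cabs (u i)) (2^-1 * Cabs (z i - a k)).
  rewrite mulr_gt0 ?invr_gt0 ?Cabs_gt0// => /(_ isT).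
  by move/near0S; apply => s; rewrite CabsM Cabs_real.
move/near0S; apply => s /(@dphi_expand _ _ _ rho); rewrite mulrCA ReMr => /le_trans; apply.
rewrite mulr_suml; apply: ler_sum => k _.
by rewrite CabsM Cabs_real -[`|s| * _ / _]mulrA exprMn mulrCA real_normK ?num_real// mulrC.
Qed.

Lemma critical_equilibrium n (z u : nat -> C) :
  disc_critical (range a) F n z -> equilibrium F n z u = 0.
Proof.
move=> [zinj zA crit].
pose e k (c : C) (i : nat) : C := if i == k then c else 0.
suff E0 k : (k < n)%N -> equilibrium F n z (e k 1) = 0.
  rewrite (@equilibrium_eq _ _ _ _ (fun i => \sum_(k <- index_iota 0 n) u k * e k 1 i)).
    rewrite equilibrium_sum big_mkord big1// => k _; by rewrite E0 ?mulr0.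
  move=> i ni; rewrite big_mkord (bigD1 (Ordinal ni))//= /e eqxx mulr1 big1 ?addr0// => j.
  by rewrite -val_eqE /= eq_sym => /negbTE ->; rewrite mulr0.
move=> kn; have := crit k kn; rewrite /wirtinger.
have D (c : C) (g : R -> C) : (forall s, g s = s%:C * c) ->
    derive1 (fun s => disc_energy_phi F n z (fun j => if j == k then z k + g s else z j)) 0 =
    - complex.Re (equilibrium F n z (e k c)).
  move=> gE; apply: quad_expand_derive1 (energy_expand (e k c) zinj zA) => s.
  congr (disc_energy_phi _ _ _ _ - disc_energy_phi _ _ _ _); apply/funext => j.
    by rewrite gE /e; case: eqP => [->//|_]; rewrite mulr0 addr0.
  by rewrite gE mul0r addr0; case: eqP => [->|].
rewrite /pdx /pdy /line_x /line_y.
rewrite (D 1 (real_complex R)); last by move=> s; rewrite mulr1.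
rewrite (D 'i (fun s => s *i)); last first.
  by move=> s; apply/eqP; rewrite eq_complex /= !mul0r !mulr0 mulr1 subr0 addr0 !eqxx.
have -> : equilibrium F n z (e k 'i) = 'i * equilibrium F n z (e k 1).
  rewrite -[RHS]addr0 -[X in _ = _ + X](equilibrium0 F n z).
  rewrite -equilibrium_lin; apply: equilibrium_eq => i _.
  by rewrite /e; case: eqP; rewrite ?mulr1 ?mulr0 addr0.
rewrite ReMi opprK => /eqP; rewrite mulf_eq0 invr_eq0 pnatr_eq0 /= => /eqP.
case: (equilibrium _ _ _ _) => x y; simpc => -[/eqP].
by rewrite oppr_eq0 => /eqP -> /eqP; rewrite oppr_eq0 => /eqP ->.
Qed.

End DiscreteEquilibrium.

(** * Zeros do not concentrate away from the charges *)

Section Truncation.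
Set Implicit Arguments.
Unset Strict Implicit.
Variable R : realType.
Local Notation C := R[i].
Implicit Types x y w z : C.

(** The metric projection onto the disc of radius [e]. *)
Definition trunc (e : R) w : C := (e / Order.max e (Cabs w))%:C * w.

Lemma trunc_id (e : R) w : 0 < e -> Cabs w <= e -> trunc e w = w.
Proof. by move=> e0 we; rewrite /trunc max_l// divff ?gt_eqF// mul1r. Qed.

Lemma Cabs_trunc (e : R) w : 0 < e -> Cabs (trunc e w) = Order.min e (Cabs w).
Proof.
move=> e0; rewrite /trunc CabsM Cabs_real ger0_norm; last first.
  by rewrite divr_ge0 ?(ltW e0)// le_max (ltW e0).
have [we|we] := leP (Cabs w) e; first by rewrite divff ?gt_eqF// mul1r.
by rewrite divfK// gt_eqF// (lt_trans e0).
Qed.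

Lemma Cabs_trunc_le (e : R) w : 0 < e -> Cabs (trunc e w) <= e.
Proof. by move=> e0; rewrite Cabs_trunc// ge_min lexx. Qed.

Lemma trunc_lip (e : R) x y : 0 < e -> Cabs (trunc e x - trunc e y) <= 2 * Cabs (x - y).
Proof.
move=> e0; rewrite /trunc; set A := Order.max e _; set B := Order.max e _.
have eA : e <= A by rewrite le_max lexx.
have yB : Cabs y <= B by rewrite le_max lexx orbT.
have AB : `|B - A| <= Cabs (x - y).
  by rewrite distrC; exact: le_trans (maxr_dist e (Cabs x) (Cabs y)) (Cabs_dist x y).
have A0 : 0 < A by apply: lt_le_trans eA.
have B0 : 0 < B by rewrite lt_max e0.
have -> : (e / A)%:C * x - (e / B)%:C * y = (e / A)%:C * (x - y) + (e / A - e / B)%:C * y.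
  by rewrite rmorphB /=; ring.
apply: le_trans (CabsD _ _) _; rewrite !CabsM !Cabs_real.
have eA1 : 0 <= e / A <= 1 by rewrite divr_ge0 ?(ltW e0) ?(ltW A0)//= ler_pdivrMr// mul1r.
have yB1 : 0 <= Cabs y / B <= 1.
  by rewrite divr_ge0 ?Cabs_ge0 ?(ltW B0)//= ler_pdivrMr// mul1r.
have -> : e / A - e / B = (e / A) * ((B - A) / B) by field; rewrite !gt_eqF.
have eAn := ger0_norm (proj1 (andP eA1)).
rewrite eAn normrM eAn normrM normfV (gtr0_norm B0).
have -> : e / A * (`|B - A| / B) * Cabs y = (e / A) * (Cabs y / B) * `|B - A|.
  by field; rewrite !gt_eqF.
have aux (r s t q : R) : 0 <= r <= 1 -> 0 <= s <= 1 -> 0 <= t -> t <= q ->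
    r * q + r * s * t <= 2 * q.
  move=> /andP[r0 r1] /andP[s0 s1] t0 tq.
  have : r * q <= q by rewrite ler_piMl// (le_trans t0).
  have : r * s * t <= t by rewrite ler_piMl// mulr_ile1.
  lra.
exact: aux.
Qed.

(** The projection onto a convex set is a monotone map. *)
Lemma trunc_monotone (e : R) x y : 0 < e ->
  0 <= complex.Re ((trunc e x - trunc e y) * conjc (x - y)).
Proof.
move=> e0; rewrite /trunc; set g := e / _; set k := e / _.
have g0 : 0 <= g by rewrite divr_ge0 ?(ltW e0)// le_max (ltW e0).
have k0 : 0 <= k by rewrite divr_ge0 ?(ltW e0)// le_max (ltW e0).
have gx : g * Cabs x = Order.min e (Cabs x).
  by rewrite -Cabs_trunc// /trunc CabsM Cabs_real ger0_norm.
have ky : k * Cabs y = Order.min e (Cabs y).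
  by rewrite -Cabs_trunc// /trunc CabsM Cabs_real ger0_norm.
have mono : 0 <= (Order.min e (Cabs x) - Order.min e (Cabs y)) * (Cabs x - Cabs y).
  case: (leP e (Cabs x)) => ex; case: (leP e (Cabs y)) => ey.
  - by rewrite subrr mul0r.
  - by apply: mulr_ge0; lra.
  - by apply: mulr_le0; lra.
  - by rewrite -expr2 sqr_ge0.
rewrite -{}gx -{}ky in mono.
have -> : complex.Re ((g%:C * x - k%:C * y) * conjc (x - y)) =
    g * Cabs x ^+ 2 + k * Cabs y ^+ 2 - (g + k) * complex.Re (x * conjc y).
  by rewrite !Cabs_sqr; case: (x) (y) => p q [r s] /=; ring.
have : complex.Re (x * conjc y) <= Cabs x * Cabs y.
  by rewrite -(Cabs_conj y) -CabsM; apply: le_trans (Re_le_Cabs _); exact: ler_norm.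
move: (complex.Re _) (Cabs x) (Cabs y) mono => q r s mono; nra.
Qed.

Lemma Re_divE x w : complex.Re (x / w) = complex.Re (x * conjc w) / Cabs w ^+ 2.
Proof. by rewrite Cabs_sqr; case: x w => p q [r s] /=; ring. Qed.

End Truncation.

Section Concentration.
Set Implicit Arguments.
Unset Strict Implicit.
Variables (R : realType) (p : nat) (a rho : 'I_p.+1 -> R[i]).
Local Notation C := R[i].
Local Notation F := (dPhi a rho).

Lemma Re_equilibrium n (z u : nat -> C) :
  complex.Re (equilibrium F n z u) =
  \sum_(0 <= i < n) \sum_(0 <= j < n | j != i) complex.Re ((u i - u j) / (z i - z j)) +
  \sum_(0 <= i < n) \sum_(k < p.+1) complex.Re (rho k * (u i / (z i - a k))).
Proof.
rewrite /equilibrium ReB ReM2 !Re_sum; congr (_ + _).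
  by apply: eq_bigr => i _; rewrite Re_sum.
rewrite mulr_sumr -sumrN; apply: eq_bigr => i _.
rewrite -ReM2 -ReN -Re_sum; congr (complex.Re _).
rewrite /dPhi mulNr mulrN opprK mulr_suml mulr_sumr; apply: eq_bigr => k _.
by move: (_ - _)^-1 => v; field.
Qed.

(** Around a point far from the charges, test the equilibrium equations against
   the projection onto a small disc, localized by a cut-off of a larger scale:
   every pair of zeros in the small disc contributes almost 1, all other pairs
   contribute almost nonnegatively because the projection is monotone. *)
Lemma zeros_concentration n (z : nat -> C) (z0 : C) (d e M : R) :
  (forall u, equilibrium F n z u = 0) ->
  (forall i j, (i < n)%N -> (j < n)%N -> z i = z j -> i = j) ->
  0 < e -> e <= d / 2 -> (forall k, 2 * d <= Cabs (z0 - a k)) ->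
  \sum_(k < p.+1) Cabs (rho k) <= M * n%:R ->
  (\sum_(0 <= i < n) (Cabs (z i - z0) <= e)%R%:R) ^+ 2 <=
  2 * (1 + M) * (e / d) * n%:R ^+ 2 + n%:R :> R.
Proof.
move=> eq0 zinj e0 ed z0a rhoM.
have d0 : 0 < d by lra.
set r := e / d; have r2 : r <= 2^-1 by rewrite /r ler_pdivrMr//; lra.
have r0 : 0 <= r by rewrite divr_ge0 ?(ltW e0) ?(ltW d0).
pose chi (w : C) : R := Order.max 0 (1 - Cabs (w - z0) / d).
pose h (w : C) : C := trunc e (w - z0) * (chi w)%:C.
pose b (i : nat) : R := (Cabs (z i - z0) <= e)%R%:R.
have chi0 w : 0 <= chi w by rewrite le_max lexx.
have chi1 w : chi w <= 1.
  by rewrite ge_max ler01 gerBl divr_ge0 ?Cabs_ge0 ?(ltW d0).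
have chil w v : `|chi w - chi v| <= Cabs (w - v) / d.
  apply: le_trans (maxr_dist 0 (1 - Cabs (w - z0) / d) (1 - Cabs (v - z0) / d)) _.
  rewrite sub_subl -mulrBl normrM normfV (gtr0_norm d0) ler_pM2r ?invr_gt0//.
  by rewrite (CabsB w v) (le_trans (Cabs_dist _ _))// (_ : v - z0 - (w - z0) = v - w)//; ring.
have pair i j : (i < n)%N -> (j < n)%N -> j != i ->
    (1 - r) * (b i * b j) - r <= complex.Re ((h (z i) - h (z j)) / (z i - z j)).
  move=> ni nj ij.
  have zij : z i - z j != 0 by rewrite subr_eq0; apply: contraNneq ij => /zinj ->.
  set x := z i - z0; set y := z j - z0.
  have -> : h (z i) - h (z j) = ((chi (z i) + chi (z j)) / 2)%:C * (trunc e x - trunc e y)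
      + ((chi (z i) - chi (z j)) / 2)%:C * (trunc e x + trunc e y).
    rewrite /h -/x -/y !rmorphM /= fmorphV rmorphD rmorphB rmorphD rmorph1 /=.
    by field.
  rewrite [(_ + _) / (z i - z j)]mulrDl ReD -!(mulrA _%:C) !ReMr.
  have xy : z i - z j = x - y by rewrite /x /y; ring.
  rewrite xy in zij *; have xyp : 0 < Cabs (x - y) by rewrite Cabs_gt0.
  have first : (1 - r) * (b i * b j) <=
      (chi (z i) + chi (z j)) / 2 * complex.Re ((trunc e x - trunc e y) / (x - y)).
    rewrite /b; case: (leP (Cabs _) e) => xe; last first.
      rewrite mul0r mulr0 mulr_ge0 ?divr_ge0 ?addr_ge0// Re_divE.
      by rewrite divr_ge0 ?sqr_ge0 ?trunc_monotone.
    case: (leP (Cabs _) e) => ye; last first.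
      rewrite mulr0 mulr0 mulr_ge0 ?divr_ge0 ?addr_ge0// Re_divE.
      by rewrite divr_ge0 ?sqr_ge0 ?trunc_monotone.
    rewrite !trunc_id// divff//= !mulr1.
    have D w : Cabs (w - z0) <= e -> 1 - r <= chi w.
      by move=> we; rewrite le_max lerD2l lerN2 ler_pM2r ?invr_gt0// we orbT.
    by have := D _ xe; have := D _ ye; lra.
  have second : - r <=
      (chi (z i) - chi (z j)) / 2 * complex.Re ((trunc e x + trunc e y) / (x - y)).
    rewrite lerNl; apply: le_trans (ler_norm _) _; rewrite normrN normrM.
    apply: le_trans (ler_wpM2l _ (Re_le_Cabs _)) _ => //.
    rewrite CabsM CabsV normrM (@ger0_norm _ 2^-1)//.
    have := chil (z i) (z j); rewrite xy => cl.
    have t2 : Cabs (trunc e x + trunc e y) <= 2 * e.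
      by apply: le_trans (CabsD _ _) _; rewrite mulr_natl lerD ?Cabs_trunc_le.
    have -> : r = (Cabs (x - y) / d / 2) * (2 * e / Cabs (x - y)).
      by rewrite /r; field; rewrite !gt_eqF.
    by apply: ler_pM; rewrite ?mulr_ge0 ?invr_ge0 ?Cabs_ge0 ?ler_pM2r ?invr_gt0.
  lra.
have field_ i : - (r * (M * n%:R)) <=
    \sum_(k < p.+1) complex.Re (rho k * (h (z i) / (z i - a k))).
  rewrite lerNl -sumrN; apply: le_trans (ler_wpM2l r0 rhoM).
  rewrite mulr_sumr; apply: ler_sum => k _.
  apply: le_trans (ler_norm _) _; rewrite normrN; apply: le_trans (Re_le_Cabs _) _.
  rewrite CabsM mulrC; apply: ler_wpM2r; first exact: Cabs_ge0.
  rewrite CabsM CabsV /h CabsM Cabs_real (ger0_norm (chi0 _)).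
  have [zd|zd] := leP d (Cabs (z i - z0)).
    have -> : chi (z i) = 0.
      by apply: max_l; rewrite subr_le0 ler_pdivlMr// mul1r.
    by rewrite mulr0 mul0r.
  have da : d <= Cabs (z i - a k).
    by have := Cabs_triangle z0 (z i) (a k); have := z0a k; rewrite (CabsB z0 (z i)); lra.
  apply: ler_pM; rewrite ?mulr_ge0 ?invr_ge0 ?Cabs_ge0//.
    apply: le_trans (_ : e * 1 <= _); last by rewrite mulr1.
    by apply: ler_pM; rewrite ?Cabs_ge0 ?Cabs_trunc_le.
  by rewrite lef_pV2 ?posrE// (lt_le_trans d0).
set S : R := \sum_(0 <= i < n) b i.
have S0 : 0 <= S by rewrite sumr_ge0// => i _; rewrite ler0n.
have Sn : S <= n%:R.
  rewrite /S big_mkord -[n in leRHS]card_ord -sumr_const.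
  by apply: ler_sum => i _; rewrite lern1 leq_b1.
have bb i : b i * b i = b i by rewrite /b; case: (_ <= _); rewrite ?mulr1 ?mulr0.
have sumb : \sum_(0 <= i < n) \sum_(0 <= j < n | j != i) (b i * b j) = S ^+ 2 - S.
  rewrite {2}/S expr2 mulr_suml -sumrB !big_mkord; apply: eq_bigr => i _.
  have -> : S = b i + \sum_(j < n | j != i) b j by rewrite /S big_mkord (bigD1 i).
  by rewrite mulrDr bb addrAC subrr add0r mulr_sumr big_mkord.
have nn i : (i < n)%N -> \sum_(0 <= j < n | j != i) r <= n%:R * r.
  move=> ni; rewrite big_mkord -[n in n%:R]card_ord mulr_natl -sumr_const.
  by rewrite [leRHS](bigD1 (Ordinal ni))//= lerDr.
have := congr1 (@complex.Re R) (eq0 (fun i => h (z i))); rewrite Re_equilibrium /=.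
have L1 : (1 - r) * (S ^+ 2 - S) - n%:R * (n%:R * r) <=
    \sum_(0 <= i < n) \sum_(0 <= j < n | j != i)
      complex.Re ((h (z i) - h (z j)) / (z i - z j)).
  rewrite -sumb mulr_sumr [X in _ - X * _](_ : _ = \sum_(0 <= i < n) 1); last first.
    by rewrite big_mkord sumr_const card_ord.
  rewrite mulr_suml -sumrB !big_mkord; apply: ler_sum => i _; rewrite mul1r.
  apply: le_trans (lerB (lexx _) (nn i (ltn_ord i))) _.
  rewrite mulr_sumr -sumrB !big_mkord; apply: ler_sum => j ij.
  by apply: pair.
have L2 : - (n%:R * (r * (M * n%:R))) <=
    \sum_(0 <= i < n) \sum_(k < p.+1) complex.Re (rho k * (h (z i) / (z i - a k))).
  rewrite -mulrN mulr_natl -[n in _ *+ n]card_ord -sumr_const big_mkord.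
  by apply: ler_sum => i _.
move=> E.
have L3 : (1 - r) * (S ^+ 2 - S) <= r * (1 + M) * n%:R ^+ 2.
  by rewrite expr2; nra.
have L4 : 0 <= r * (1 + M) * n%:R ^+ 2.
  have [S1|S1] := leP 0 (S ^+ 2 - S).
    by apply: le_trans L3; rewrite mulr_ge0//; lra.
  have M0 : 0 <= M * n%:R by apply: le_trans rhoM; rewrite sumr_ge0// => k _; exact: Cabs_ge0.
  rewrite -mulrA mulr_ge0// expr2 mulrA mulr_ge0// mulrDl mul1r addr_ge0//.
have : S ^+ 2 - S <= 2 * (r * (1 + M) * n%:R ^+ 2).
  have [S1|S1] := leP 0 (S ^+ 2 - S); last by lra.
  move: (S ^+ 2 - S) (r * (1 + M) * _) L3 L4 S1 => s t; nra.
lra.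
Qed.

End Concentration.

(** * Averages over the zeros and weak limits *)

Section Averages.
Set Implicit Arguments.
Unset Strict Implicit.
Variable R : realType.
Local Notation C := R[i].

Lemma lip_continuous (f : C -> R) (L : R) :
  (forall x y, `|f x - f y| <= L * Cabs (x - y)) -> continuous f.
Proof.
move=> lf; pose K := `|L| + 1; have K0 : 0 < K by rewrite ltr_wpDl.
have gc : continuous (fun x => K^-1 * f x).
  apply: lip1_continuous => x y; rewrite -mulrBr normrM normfV (gtr0_norm K0).
  rewrite ler_pdivrMl//; apply: le_trans (lf x y) _; apply: (ler_wpM2r (Cabs_ge0 _)).
  by rewrite /K (le_trans (ler_norm L))// lerDl.
have -> : f = (fun r : R => K * r) \o (fun x => K^-1 * f x).
  by apply/funext => x /=; rewrite mulVKf// gt_eqF.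
by move=> x; apply: continuous_comp; [exact: gc|exact: mulrl_continuous].
Qed.

Definition avg (n : nat) (z : nat -> C) (f : C -> R) : R :=
  n%:R^-1 * \sum_(0 <= i < n) f (z i).

Definition avg2 (n : nat) (z : nat -> C) (f : C -> C -> R) : R :=
  (n%:R ^+ 2)^-1 * \sum_(0 <= i < n) \sum_(0 <= j < n) f (z i) (z j).

Lemma ge0_integral_normalized n z (f : C -> R) :
  measurable_fun [set: borelC R] f -> (forall x, 0 <= f x) ->
  (\int[normalized_measure n z]_x (f x)%:E)%E = (avg n z f)%:E.
Proof.
move=> mf f0; have mf' := (measurable_EFinP _ _).2 mf.
rewrite /normalized_measure ge0_integral_mscale//; last by move=> x _; rewrite lee_fin.
rewrite /disc_measure ge0_integral_measure_sum//; last by move=> x _; rewrite lee_fin.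
rewrite /avg EFinM big_mkord -sumEFin; congr (_ * _)%E; apply: eq_bigr => i _.
by rewrite integral_dirac// diracT mul1e.
Qed.

Lemma Rintegral_normalized n z (f : C -> R) : measurable_fun [set: borelC R] f ->
  Rintegral (normalized_measure n z) setT f = avg n z f.
Proof.
move=> mf; rewrite /Rintegral integralE.
have -> : ((fun x : borelC R => (f x)%:E)^\+ = (fun x => (Order.max (f x) 0)%:E))%E.
  by apply/funext => x; rewrite funeposE EFin_max.
have -> : ((fun x : borelC R => (f x)%:E)^\- = (fun x => (Order.max (- f x) 0)%:E))%E.
  by apply/funext => x; rewrite funenegE EFin_max EFinN.
have m1 : measurable_fun [set: borelC R] (fun x => Order.max (f x) 0).
  by apply: measurable_maxr => //; exact: measurable_cst.
have m2 : measurable_fun [set: borelC R] (fun x => Order.max (- f x) 0).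
  by apply: measurable_maxr; [exact: measurableT_comp|exact: measurable_cst].
rewrite (ge0_integral_normalized n z m1); last by move=> x; rewrite le_max lexx orbT.
rewrite (ge0_integral_normalized n z m2); last by move=> x; rewrite le_max lexx orbT.
rewrite -EFinB /= /avg -mulrBr -sumrB; congr (_ * _); apply: eq_bigr => i _.
have [f0|f0] := leP (f (z i)) 0; first by rewrite max_l ?oppr_ge0// sub0r opprK.
by rewrite max_r ?subr0// oppr_le0 ltW.
Qed.

Lemma avg2_dist n z (f g : C -> C -> R) M : (0 < n)%N ->
  (forall x y, `|f x y - g x y| <= M) -> `|avg2 n z f - avg2 n z g| <= M.
Proof.
move=> n0 fM; have n20 : 0 < n%:R ^+ 2 :> R by rewrite exprn_gt0// ltr0n.
rewrite /avg2 -mulrBr normrM normfV (gtr0_norm n20) ler_pdivrMl//.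
rewrite -sumrB; apply: le_trans (ler_norm_sum _ _ _) _.
have H i : `|\sum_(0 <= j < n) f (z i) (z j) - \sum_(0 <= j < n) g (z i) (z j)| <= n%:R * M.
  rewrite -sumrB; apply: le_trans (ler_norm_sum _ _ _) _.
  by rewrite big_mkord mulr_natl -[n in _ *+ n]card_ord -sumr_const; apply: ler_sum.
rewrite big_mkord expr2 -mulrA mulr_natl -[n in _ *+ n]card_ord -sumr_const.
by apply: ler_sum.
Qed.

Lemma avg2_tensor n z (I : finType) (c : I -> I -> R) (f : I -> C -> R) :
  avg2 n z (fun x y => \sum_k \sum_l c k l * (f k x * f l y)) =
  \sum_k \sum_l c k l * (avg n z (f k) * avg n z (f l)).
Proof.
rewrite /avg2 /avg.
transitivity ((n%:R ^+ 2)^-1 * \sum_k \sum_l c k l *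
   ((\sum_(0 <= i < n) f k (z i)) * \sum_(0 <= j < n) f l (z j))).
  congr (_ * _); under eq_bigr do rewrite exchange_big /=.
  rewrite exchange_big /=; apply: eq_bigr => k _.
  under eq_bigr do rewrite exchange_big /=.
  rewrite exchange_big /=; apply: eq_bigr => l _.
  rewrite mulr_suml mulr_sumr; apply: eq_bigr => i _.
  by rewrite !mulr_sumr.
rewrite mulr_sumr; apply: eq_bigr => k _; rewrite mulr_sumr; apply: eq_bigr => l _.
by rewrite -exprVn; ring.
Qed.

(** Tent functions over a fine grid, normalized; the lower bound put on the
   denominator keeps the quotients continuous off the disc, where their sum
   falls below 1. *)
Lemma partition_unity (r d : R) : 0 < d ->
  exists (I : finType) (c : I -> C) (f : I -> C -> R),
  [/\ forall k, continuous (f k),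
      forall k, exists r', forall x, r' < Cabs x -> f k x = 0,
      forall k x, 0 <= f k x /\ (f k x != 0 -> Cabs (x - c k) <= d),
      forall x, \sum_k f k x <= 1 &
      forall x, Cabs x <= r -> \sum_k f k x = 1].
Proof.
move=> d0; pose s := d / 4; have s0 : 0 < s by rewrite divr_gt0.
pose q := (Num.truncn (2 * r / s)).+1.
pose I : finType := ('I_q * 'I_q)%type.
pose c (k : I) : C := (- r + k.1%:R * s) +i* (- r + k.2%:R * s).
pose g (k : I) (x : C) : R := Order.max 0 (d - Cabs (x - c k)).
pose S x := \sum_k g k x.
pose D x := Order.max (d / 2) (S x).
have g0 k x : 0 <= g k x by rewrite le_max lexx.
have D0 x : 0 < D x by rewrite lt_max divr_gt0.
have D1 x : S x <= D x by rewrite le_max lexx orbT.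
have glip k x y : `|g k x - g k y| <= Cabs (x - y).
  apply: le_trans (maxr_dist 0 (d - Cabs (x - c k)) (d - Cabs (y - c k))) _.
  rewrite sub_subl.
  by rewrite (CabsB x y) (le_trans (Cabs_dist _ _))// (_ : y - c k - (x - c k) = y - x)//; ring.
have Slip x y : `|S x - S y| <= #|I|%:R * Cabs (x - y).
  rewrite -sumrB; apply: le_trans (ler_norm_sum _ _ _) _.
  by rewrite mulr_natl -sumr_const; apply: ler_sum.
have gd k x : g k x <= d by rewrite ge_max (ltW d0) gerBl Cabs_ge0.
exists I, c, (fun k x => g k x / D x).
have fl k x y : `|g k x / D x - g k y / D y| <=
    (2 / d + 4 / d * #|I|%:R) * Cabs (x - y).
  have -> : g k x / D x - g k y / D y =
      (g k x - g k y) / D x + g k y * (D y - D x) / (D x * D y).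
    by field; rewrite !gt_eqF.
  have Dd w : (D w)^-1 <= 2 / d.
    by rewrite -[2 / d]invf_div lef_pV2 ?posrE ?divr_gt0// le_max lexx.
  have Dd0 w : 0 <= (D w)^-1 by rewrite invr_ge0 ltW.
  rewrite [leRHS]mulrDl; apply: le_trans (ler_normD _ _) _; apply: lerD.
    rewrite normrM (ger0_norm (Dd0 x)) mulrC; exact: ler_pM.
  rewrite normrM (ger0_norm (_ : 0 <= (D x * D y)^-1)); last by rewrite invr_ge0 mulr_ge0// ltW.
  rewrite normrM (ger0_norm (g0 _ _)) invfM.
  have DS : `|D y - D x| <= #|I|%:R * Cabs (x - y).
    by rewrite distrC; exact: le_trans (maxr_dist (d / 2) (S x) (S y)) (Slip x y).
  have -> : 4 / d * #|I|%:R * Cabs (x - y) =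
      (d * (#|I|%:R * Cabs (x - y))) * (2 / d * (2 / d)) by field; rewrite gt_eqF.
  apply: ler_pM; rewrite ?mulr_ge0//; last exact: ler_pM.
  by apply: ler_pM.
split.
- by move=> k; apply: lip_continuous (fl k).
- move=> k; exists (Cabs (c k) + d) => x xc.
  have -> : g k x = 0; last by rewrite mul0r.
  apply: max_l; have := Cabs_dist x (c k).
  have := ler_norm (Cabs x - Cabs (c k)); lra.
- move=> k x; split; first by rewrite divr_ge0// ltW.
  apply: contra_neqT; rewrite -ltNge => xd.
  rewrite /g max_l ?mul0r//; lra.
- by move=> x; rewrite -mulr_suml ler_pdivrMr// mul1r; exact: D1.
- move=> x xr; rewrite -mulr_suml.
  suff H : d / 2 <= S x by rewrite /D max_r// divff// gt_eqF// (lt_le_trans _ H)// divr_gt0.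
  have ex (t : R) : `|t| <= r -> exists i : 'I_q, `|t - (- r + i%:R * s)| <= s.
    rewrite ler_norml => /andP[t1 t2].
    have ts : 0 <= (t + r) / s by rewrite divr_ge0 ?(ltW s0)//; lra.
    have /andP[i1 i2] := truncn_itv ts.
    have iq : (Num.truncn ((t + r) / s) < q)%N.
      by rewrite ltnS le_truncn// ler_pM2r ?invr_gt0//; lra.
    exists (Ordinal iq) => /=; move: i1 i2.
    rewrite ler_pdivlMr// ltr_pdivrMr//; move: (Num.truncn _) => N.
    have -> : N.+1%:R * s = N%:R * s + s by rewrite -natr1 mulrDl mul1r.
    move=> i1 i2.
    by rewrite ler_norml; apply/andP; split; lra.
  have [i Hi] := ex _ (le_trans (Re_le_Cabs x) xr).
  have [j Hj] := ex _ (le_trans (Im_le_Cabs x) xr).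
  have xc : Cabs (x - c (i, j)) <= d / 2.
    apply: le_trans (Cabs_le_ReIm _) _.
    have -> : complex.Re (x - c (i, j)) = complex.Re x - (- r + i%:R * s).
      by rewrite ReB.
    have -> : complex.Im (x - c (i, j)) = complex.Im x - (- r + j%:R * s).
      by case: (x) => u v; rewrite /c /=.
    by apply: le_trans (lerD Hi Hj) _; rewrite /s; lra.
  rewrite /S (bigD1 (i, j))//=; apply: ler_wpDr; first by rewrite sumr_ge0.
  by rewrite le_max; apply/orP; right; lra.
Qed.

End Averages.

Lemma dist_triangle3 (R : realType) (x y z w b c d : R) :
  `|x - y| <= b -> `|y - z| <= c -> `|z - w| <= d -> `|x - w| <= b + c + d.
Proof.
move=> xy yz zw; apply: le_trans (ler_distD z _ _) _; apply: lerD zw.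
by apply: le_trans (ler_distD y _ _) _; exact: lerD.
Qed.

Section WeakLimit.
Set Implicit Arguments.
Unset Strict Implicit.
Variable R : realType.
Local Notation C := R[i].
Variable mu : {finite_measure set (borelC R) -> \bar R}.

Definition test_function (f : C -> R) :=
  continuous f /\ exists r, forall z, r < Cabs z -> f z = 0.

(** The neighbourhoods of [mu] traced on the indices: along this filter the
   integrals of all test functions converge, so that a limit point can be
   handled as a limit. *)
Definition weak_filter (N : set nat)
    (nu : nat -> {measure set (borelC R) -> \bar R}) : set_system nat :=
  [set P | exists (m : nat) (f : 'I_m -> C -> R) (e : R) (n0 : nat),
    [/\ forall i, test_function (f i), 0 < e &
        forall n, N n -> (n0 <= n)%N ->
          (forall i, `|Rintegral (nu n) setT (f i) - Rintegral mu setT (f i)| < e) ->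
          P n]].

Lemma weak_filter_proper N nu :
  weak_limit_point N nu mu -> ProperFilter (weak_filter N nu).
Proof.
move=> wl; apply: Build_ProperFilter.
  move=> [m [f [e [n0 [tf e0 H]]]]].
  have [n [Nn n0n Hn]] := wl m f (fun i => (tf i).1) (fun i => (tf i).2) e n0 e0.
  exact: (H n).
split.
- by exists 0%N, (fun _ _ => 0), 1, 0%N; split => // -[].
- move=> P Q [m [f [e [n0 [tf e0 H]]]]] [m' [f' [e' [n0' [tf' e0' H']]]]].
  pose g (i : 'I_(m + m')) := match fintype.split i with inl i => f i | inr i => f' i end.
  exists (m + m')%N, g, (Order.min e e'), (maxn n0 n0'); split.
  + by move=> i; rewrite /g; case: fintype.split.
  + by rewrite lt_min e0.
  + move=> n Nn; rewrite geq_max => /andP[n0n n0n'] Hg; split.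
      apply: H => // i; have := Hg (lshift m' i); rewrite lt_min => /andP[+ _].
      by rewrite /g (unsplitK (inl i)).
    apply: H' => // i; have := Hg (rshift m i); rewrite lt_min => /andP[_].
    by rewrite /g (unsplitK (inr i)).
- move=> P Q PQ [m [f [e [n0 [tf e0 H]]]]].
  by exists m, f, e, n0; split => // n Nn n0n Hn; apply: PQ; exact: H.
Qed.

Lemma weak_filter_cvg N nu f : weak_limit_point N nu mu -> test_function f ->
  Rintegral (nu n) setT f @[n --> weak_filter N nu] --> Rintegral mu setT f.
Proof.
move=> wl tf; have FF := weak_filter_proper wl.
apply/cvgrPdist_lt => e e0; exists 1%N, (fun=> f), e, 0%N; split => // n _ _.
by move=> /(_ ord0); rewrite distrC.
Qed.

Lemma weak_filter_within N nu (P : nat -> Prop) :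
  (\forall n \near within N \oo, P n) -> weak_filter N nu P.
Proof.
move=> [n0 _ H]; exists 0%N, (fun _ _ => 0), 1, n0; split => //; first by case.
by move=> n Nn n0n _; apply: H.
Qed.

Lemma prod_fin : ((mu \x mu) [set: borelC R * borelC R] < +oo)%E.
Proof.
rewrite -setXTT product_measure1E// lte_mul_pinfty//.
  by rewrite ge0_fin_numE// fin_num_fun_lty//; exact: fin_num_measure.
by rewrite fin_num_fun_lty//; exact: fin_num_measure.
Qed.

Lemma mass_fin : (mu [set: borelC R] < +oo)%E.
Proof. by rewrite fin_num_fun_lty//; exact: fin_num_measure. Qed.

Lemma Rintegral_tensor (f g : C -> R) M :
  measurable_fun [set: borelC R] f -> measurable_fun [set: borelC R] g ->
  (forall x, `|f x| <= M) -> (forall x, `|g x| <= M) ->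
  Rintegral (mu \x mu)%E setT (fun p : borelC R * borelC R => f p.1 * g p.2) =
  Rintegral mu setT f * Rintegral mu setT g.
Proof.
move=> mf mg fM gM.
have M0 : 0 <= M by apply: le_trans (fM 0).
have if_ : mu.-integrable setT (EFin \o f) by exact: integrable_bnd mass_fin mf _.
have ig : mu.-integrable setT (EFin \o g) by exact: integrable_bnd mass_fin mg _.
have mfg : measurable_fun setT (fun p : borelC R * borelC R => f p.1 * g p.2).
  by apply: measurable_funM;
    [exact: measurableT_comp mf measurable_fst|exact: measurableT_comp mg measurable_snd].
have ifg : (mu \x mu)%E.-integrable setT
    (EFin \o (fun p : borelC R * borelC R => f p.1 * g p.2)).
  apply: (@integrable_bnd _ _ _ _ _ _ (M * M)) => //; first exact: prod_fin.
  by move=> p _; rewrite normrM ler_pM.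
rewrite /Rintegral -(integral12_prod_meas1 ifg).
have EG : (\int[mu]_y (g y)%:E = (fine (\int[mu]_y (g y)%:E))%:E)%E.
  by rewrite fineK//; exact: integrable_fin_num.
rewrite -[RHS]/(fine (\int[mu]_x (f x)%:E) * fine (\int[mu]_y (g y)%:E)).
set c := fine (\int[mu]_y (g y)%:E) in EG *.
rewrite -[c in RHS]/(fine c%:E) -fineM//; last exact: integrable_fin_num.
congr fine; rewrite -integralZr//; apply: eq_integral => x _.
by rewrite /fubini_F -EG -integralZl//; apply: eq_integral => y _; rewrite EFinM.
Qed.

(** Uniform approximation by finite combinations of products of test functions
   reduces the convergence of double averages to that of single ones. *)
Lemma avg2_cvg N (zeta : nat -> nat -> C) (K : C -> C -> R) (L B : R) :
  weak_limit_point N (fun n => normalized_measure n (zeta n)) mu ->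
  measurable_fun setT (fun p : borelC R * borelC R => K p.1 p.2) ->
  (forall x y, `|K x y| <= B) ->
  (forall x y x' y', `|K x y - K x' y'| <= L * (Cabs (x - x') + Cabs (y - y'))) ->
  (forall e, 0 < e -> exists r, forall x y, r < Cabs x \/ r < Cabs y -> `|K x y| <= e) ->
  avg2 n (zeta n) K @[n --> weak_filter N (fun n => normalized_measure n (zeta n))] -->
  Rintegral (mu \x mu)%E setT (fun p : borelC R * borelC R => K p.1 p.2).
Proof.
move=> wl mK KB KL K0; set G := weak_filter _ _.
have GF : ProperFilter G := weak_filter_proper wl.
have L0 : 0 <= `|L| by [].
pose m2 := fine ((mu \x mu)%E [set: borelC R * borelC R]).
have m20 : 0 <= m2 by rewrite fine_ge0.
apply/cvgrPdist_le => eps eps0.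
pose e := eps / (m2 + 2).
have e0 : 0 < e by rewrite divr_gt0// ltr_wpDl.
have [r Kr] := K0 (e / 2) (divr_gt0 e0 (ltr0n _ 2)).
(* moving each point by at most this distance changes [K] by at most [e / 2] *)
pose d := e / (4 * (`|L| + 1)).
have d0 : 0 < d by rewrite divr_gt0// mulr_gt0// ltr_wpDl.
have [I [c [f [fc fs f0 f1 fr]]]] := partition_unity r d0.
have fle k x : `|f k x| <= 1.
  rewrite ger0_norm; last by have [] := f0 k x.
  apply: le_trans (f1 x); rewrite (bigD1 k)//= lerDl sumr_ge0// => l _.
  by have [] := f0 l x.
have mf k : measurable_fun [set: borelC R] (f k) := continuous_borelC (fc k).
have f0s x : 0 <= \sum_k f k x by rewrite sumr_ge0// => k _; have [] := f0 k x.
have q0 x y : 0 <= (\sum_k f k x) * (\sum_l f l y) by rewrite mulr_ge0.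
have q1 x y : (\sum_k f k x) * (\sum_l f l y) <= 1 by rewrite mulr_ile1.
pose T x y := \sum_k \sum_l K (c k) (c l) * (f k x * f l y).
have KT x y : `|K x y - T x y| <= e.
  have TE : T x y = \sum_k \sum_l (K (c k) (c l) - K x y) * (f k x * f l y) +
      K x y * ((\sum_k f k x) * (\sum_l f l y)).
    rewrite mulr_suml mulr_sumr -big_split /=; apply: eq_bigr => k _.
    rewrite !mulr_sumr -big_split /=; apply: eq_bigr => l _; ring.
  have A : `|\sum_k \sum_l (K (c k) (c l) - K x y) * (f k x * f l y)| <= e / 2.
    apply: (@le_trans _ _ (\sum_k \sum_l e / 2 * (f k x * f l y))).
      apply: le_trans (ler_norm_sum _ _ _) _; apply: ler_sum => k _.
      apply: le_trans (ler_norm_sum _ _ _) _; apply: ler_sum => l _.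
      have [fk0 fkc] := f0 k x; have [fl0 flc] := f0 l y.
      rewrite normrM (ger0_norm (mulr_ge0 fk0 fl0)).
      have [->|fk] := eqVneq (f k x) 0; first by rewrite mul0r !mulr0.
      have [->|fl] := eqVneq (f l y) 0; first by rewrite !mulr0.
      rewrite ler_wpM2r ?mulr_ge0// distrC; apply: le_trans (KL _ _ _ _) _.
      apply: (@le_trans _ _ (`|L| * (d + d))).
        apply: le_trans (ler_wpM2r _ (ler_norm L)) _; first by rewrite addr_ge0 ?Cabs_ge0.
        by rewrite ler_wpM2l// lerD ?fkc ?flc.
      have -> : `|L| * (d + d) = e / 2 * (`|L| / (`|L| + 1)).
        by rewrite /d; field; rewrite gt_eqF// ltr_wpDl.
      apply: ler_piMr; first by rewrite divr_ge0 ?(ltW e0).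
      by rewrite ler_pdivrMr ?ltr_wpDl// mul1r lerDl.
    have -> : \sum_k \sum_l e / 2 * (f k x * f l y) =
        e / 2 * ((\sum_k f k x) * (\sum_l f l y)).
      rewrite mulr_suml mulr_sumr; apply: eq_bigr => k _.
      by rewrite !mulr_sumr.
    by apply: ler_piMr; [rewrite divr_ge0 ?(ltW e0)|exact: q1].
  have B' : `|K x y - K x y * ((\sum_k f k x) * (\sum_l f l y))| <= e / 2.
    have H : `|K x y| <= e / 2 ->
        `|K x y - K x y * ((\sum_k f k x) * (\sum_l f l y))| <= e / 2.
      apply: le_trans; rewrite -{1}[K x y]mulr1 -mulrBr normrM ler_piMr//.
      have := q0 x y; have := q1 x y; move: (_ * _) => q q01 q00.
      by rewrite ger0_norm; lra.
    have [xr|xr] := leP (Cabs x) r; last by apply: H; apply: Kr; left.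
    have [yr|yr] := leP (Cabs y) r; last by apply: H; apply: Kr; right.
    by rewrite !fr// !mulr1 subrr normr0 divr_ge0 ?(ltW e0).
  rewrite TE opprD addrCA addrC; apply: le_trans (ler_normD _ _) _.
  by rewrite (splitr e) lerD// normrN.
have ifT k l : (mu \x mu)%E.-integrable setT
    (EFin \o (fun p : borelC R * borelC R => K (c k) (c l) * (f k p.1 * f l p.2))).
  apply: (@integrable_bnd _ _ _ _ _ _ `|K (c k) (c l)|) => //; first exact: prod_fin.
    apply: measurable_funM; first exact: measurable_cst.
    by apply: measurable_funM;
      [exact: measurableT_comp (mf k) measurable_fst
      |exact: measurableT_comp (mf l) measurable_snd].
  by move=> p _; rewrite normrM ler_piMr// normrM mulr_ile1.
have ifTk k := Rintegral_sum (index_enum I) (ifT k).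
have [iT RT] := Rintegral_sum (index_enum I) (fun k => (ifTk k).1).
have RTE : Rintegral (mu \x mu)%E setT (fun p : borelC R * borelC R => T p.1 p.2) =
    \sum_k \sum_l K (c k) (c l) * (Rintegral mu setT (f k) * Rintegral mu setT (f l)).
  rewrite RT; apply: eq_bigr => k _; rewrite (ifTk k).2; apply: eq_bigr => l _.
  rewrite RintegralZl//; first by rewrite (@Rintegral_tensor _ _ 1).
  apply: (@integrable_bnd _ _ _ _ _ _ 1) => //; first exact: prod_fin.
    by apply: measurable_funM;
      [exact: measurableT_comp (mf k) measurable_fst
      |exact: measurableT_comp (mf l) measurable_snd].
  by move=> p _; rewrite normrM mulr_ile1.
have cT : avg2 n (zeta n) T @[n --> G] -->
    Rintegral (mu \x mu)%E setT (fun p : borelC R * borelC R => T p.1 p.2).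
  rewrite RTE; under eq_fun do rewrite avg2_tensor.
  have cf k : avg n (zeta n) (f k) @[n --> G] --> Rintegral mu setT (f k).
    have := @weak_filter_cvg _ _ (f k) wl (conj (fc k) (fs k)).
    by under eq_fun do rewrite (Rintegral_normalized _ _ (mf k)).
  apply: cvg_big => [|k _]; first exact: add_continuous.
  apply: cvg_big => [|l _]; first exact: add_continuous.
  by apply: cvgM; [exact: cvg_cst|exact: cvgM].
have n0 : \forall n \near G, (0 < n)%N.
  by apply: weak_filter_within; apply: cvg_within; exact: nbhs_infty_gt.
have RK : `|Rintegral (mu \x mu)%E setT (fun p : borelC R * borelC R => K p.1 p.2) -
    Rintegral (mu \x mu)%E setT (fun p : borelC R * borelC R => T p.1 p.2)| <= e * m2.
  apply: Rintegral_dist => //; first exact: prod_fin.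
  by apply: (@integrable_bnd _ _ _ _ _ _ B) => //; exact: prod_fin.
have := cT; move=> /cvgrPdist_le /(_ e e0); apply: filterS2 n0 => n n0 H.
have KTn := avg2_dist (zeta n) n0 KT.
have -> : eps = e * m2 + e + e by rewrite /e; field; rewrite gt_eqF// ltr_wpDl.
by rewrite (distrC (avg2 _ _ K)) in KTn; exact: dist_triangle3 RK H KTn.
Qed.

End WeakLimit.

(** * The regularized interaction kernel *)

Section RegularizedKernel.
Set Implicit Arguments.
Unset Strict Implicit.
Variable R : realType.
Local Notation C := R[i].
Implicit Types (x y u v w : C) (d : R) (h : C -> C).

(** A Lipschitz regularization of the inverse, exact outside the disc of radius
   [d]; for [d = 0] it is the inverse itself. *)
Definition rinv d u : C := ((Order.max (d ^+ 2) (Cabs u ^+ 2))^-1)%:C * conjc u.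

Lemma rinv_large d u : 0 <= d -> d <= Cabs u -> rinv d u = u^-1.
Proof.
move=> d0 du; rewrite /rinv max_r ?lerXn2r ?nnegrE ?Cabs_ge0//.
rewrite Cabs_sqr; case: u {du} => a b /=.
by apply/eqP; rewrite eq_complex /= !mul0r subr0 addr0 mulrC eqxx /= mulrN mulrC.
Qed.

Lemma rinv0E u : rinv 0 u = u^-1.
Proof. by rewrite rinv_large// Cabs_ge0. Qed.

Lemma rinv00 d : rinv d 0 = 0.
Proof. by rewrite /rinv rmorph0 mulr0. Qed.

Lemma rinv_max_ge0 d u : 0 <= Order.max (d ^+ 2) (Cabs u ^+ 2).
Proof. by rewrite le_max sqr_ge0. Qed.

Lemma Cabs_rinv d u : Cabs (rinv d u) = (Order.max (d ^+ 2) (Cabs u ^+ 2))^-1 * Cabs u.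
Proof. by rewrite /rinv CabsM Cabs_real Cabs_conj ger0_norm// invr_ge0 rinv_max_ge0. Qed.

Lemma Cabs_mul_rinv d u : Cabs u * Cabs (rinv d u) <= 1.
Proof.
rewrite Cabs_rinv mulrCA -expr2.
have [->|u0] := eqVneq u 0; first by rewrite Cabs0 expr0n mulr0.
have p : 0 < Cabs u ^+ 2 by rewrite exprn_gt0// Cabs_gt0.
by rewrite ler_pdivrMl ?mulr1 ?le_max ?lexx ?orbT// lt_max p orbT.
Qed.

Lemma Cabs_rinv_le d u : 0 < d -> Cabs (rinv d u) <= d^-1.
Proof.
move=> d0; rewrite Cabs_rinv ler_pdivrMl; last by rewrite lt_max exprn_gt0.
rewrite ler_pdivlMr//; have [ud|ud] := leP (Cabs u) d.
  rewrite le_max; apply/orP; left; rewrite expr2; apply: ler_wpM2r => //; exact: ltW.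
rewrite le_max; apply/orP; right; rewrite expr2; apply: ler_wpM2l; first exact: Cabs_ge0.
exact: ltW.
Qed.

Lemma Cabs_mulr_rinv (c : R) w d u : Cabs w <= c * Cabs u -> 0 <= c ->
  Cabs (w * rinv d u) <= c.
Proof.
move=> wu c0; rewrite CabsM; apply: le_trans (ler_wpM2r (Cabs_ge0 _) wu) _.
by rewrite -mulrA ler_piMr// Cabs_mul_rinv.
Qed.

Lemma rinv_lip d u v : 0 < d -> Cabs (rinv d u - rinv d v) <= 3 / d ^+ 2 * Cabs (u - v).
Proof.
move=> d0; rewrite /rinv; set A := Order.max _ _; set B := Order.max _ (Cabs v ^+ 2).
have d20 : 0 < d ^+ 2 by rewrite exprn_gt0.
have dA : d ^+ 2 <= A by rewrite le_max lexx.
have dB : d ^+ 2 <= B by rewrite le_max lexx.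
have uA : Cabs u ^+ 2 <= A by rewrite le_max lexx orbT.
have vB : Cabs v ^+ 2 <= B by rewrite le_max lexx orbT.
have A0 : 0 < A by apply: lt_le_trans dA.
have B0 : 0 < B by apply: lt_le_trans dB.
have AB : `|B - A| <= Cabs (u - v) * (Cabs u + Cabs v).
  rewrite distrC; apply: le_trans (maxr_dist (d ^+ 2) (Cabs u ^+ 2) (Cabs v ^+ 2)) _.
  rewrite subr_sqr normrM (ger0_norm (addr_ge0 (Cabs_ge0 _) (Cabs_ge0 _))).
  by rewrite ler_wpM2r ?Cabs_dist ?addr_ge0 ?Cabs_ge0.
have -> : A^-1%:C * conjc u - B^-1%:C * conjc v =
    (A^-1)%:C * conjc (u - v) + (A^-1 - B^-1)%:C * conjc v.
  by rewrite !rmorphB /=; ring.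
apply: le_trans (CabsD _ _) _; rewrite !CabsM !Cabs_real !Cabs_conj.
have -> : A^-1 - B^-1 = (B - A) / (A * B) by field; rewrite !gt_eqF.
rewrite normrM (@ger0_norm _ A^-1) ?invr_ge0 ?(ltW A0)//.
rewrite (@ger0_norm _ (A * B)^-1) ?invr_ge0 ?mulr_ge0 ?(ltW A0) ?(ltW B0)//.
have q0 := Cabs_ge0 (u - v).
have Ad : A^-1 <= (d ^+ 2)^-1 by rewrite lef_pV2 ?posrE.
have first : A^-1 * Cabs (u - v) <= (d ^+ 2)^-1 * Cabs (u - v) by rewrite ler_wpM2r.
have second : `|B - A| / (A * B) * Cabs v <= 2 * (d ^+ 2)^-1 * Cabs (u - v).
  apply: (@le_trans _ _ (Cabs (u - v) * ((Cabs u + Cabs v) * Cabs v / (A * B)))).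
    rewrite [leRHS](_ : _ = Cabs (u - v) * (Cabs u + Cabs v) / (A * B) * Cabs v); last first.
      by field; rewrite !gt_eqF.
    by rewrite ler_wpM2r ?Cabs_ge0// ler_wpM2r// invr_ge0 mulr_ge0// ltW.
  rewrite [leRHS]mulrC; apply: ler_wpM2l => //.
  rewrite ler_pdivrMr ?mulr_gt0// mulrC -mulrA mulrA; move: dA dB uA vB.
  have := Cabs_ge0 u; have := Cabs_ge0 v.
  have -> : Cabs v * (Cabs u + Cabs v) = Cabs u * Cabs v + Cabs v ^+ 2 by ring.
  move: (Cabs u) (Cabs v) => s t t0 s0 dA dB uA vB.
  have st : s * t * d ^+ 2 <= A * B.
    have : (s * t) ^+ 2 <= A * B by rewrite exprMn; apply: ler_pM => //; exact: sqr_ge0.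
    have dd : d ^+ 2 * d ^+ 2 <= A * B by apply: ler_pM => //; exact: ltW.
    move: (s * t) (d ^+ 2) dd d20 => q e ee e0 qq.
    have := sqr_ge0 (q - e); rewrite sqrrB -expr2 in ee *; lra.
  have tt : t ^+ 2 * d ^+ 2 <= A * B.
    by rewrite mulrC; apply: ler_pM => //; [exact: ltW|exact: sqr_ge0].
  rewrite -[X in _ <= X]mulrA [(d ^+ 2)^-1 * _]mulrC mulrA ler_pdivlMr// mulrDl; lra.
have -> : 3 / d ^+ 2 * Cabs (u - v) =
    (d ^+ 2)^-1 * Cabs (u - v) + 2 * (d ^+ 2)^-1 * Cabs (u - v) by ring.
exact: lerD.
Qed.

Lemma Cmeas_rinv (dT : measure_display) (T : measurableType dT) (f : T -> C) d :
  Cmeas f -> Cmeas (fun t => rinv d (f t)).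
Proof.
move=> mf; apply: CmeasM; last exact: Cmeas_conj.
apply: Cmeas_real; apply: (measurableT_comp (@measurable_invr R)).
apply: measurable_maxr; first exact: measurable_cst.
by apply: measurable_funX; exact: measurable_Cabs.
Qed.

Definition lipC (L : R) h := forall x y, Cabs (h x - h y) <= L * Cabs (x - y).

Lemma Cmeas_lipC L h : lipC L h -> @Cmeas R _ (borelC R) h.
Proof.
move=> hL; split; apply: continuous_borelC; apply: (lip_continuous (L := L)) => x y.
  by apply: le_trans (hL x y); rewrite -ReB Re_le_Cabs.
apply: le_trans (hL x y); rewrite (_ : _ - _ = complex.Im (h x - h y)) ?Im_le_Cabs//.
by case: (h x) (h y) => ? ? [].
Qed.

Lemma Cmeas_fst h : @Cmeas R _ (borelC R) h ->
  Cmeas (fun p : borelC R * borelC R => h p.1).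
Proof.
by move=> [h1 h2]; split;
  [exact: (measurableT_comp h1 measurable_fst)|exact: (measurableT_comp h2 measurable_fst)].
Qed.

Lemma Cmeas_snd h : @Cmeas R _ (borelC R) h ->
  Cmeas (fun p : borelC R * borelC R => h p.2).
Proof.
by move=> [h1 h2]; split;
  [exact: (measurableT_comp h1 measurable_snd)|exact: (measurableT_comp h2 measurable_snd)].
Qed.

Lemma lipC_id : lipC 1 id.
Proof. by move=> x y; rewrite mul1r. Qed.

Lemma Cmeas_id : @Cmeas R _ (borelC R) (@id C).
Proof. exact: Cmeas_lipC lipC_id. Qed.

(** The real part of the divided difference of [h], regularized near the
   diagonal: the first variation of the kernel [logk] is minus its value for
   [d = 0]. *)
Definition divdiff d h x y : R := complex.Re ((h x - h y) * rinv d (x - y)).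

Lemma divdiff_diag d h x : divdiff d h x x = 0.
Proof. by rewrite /divdiff subrr mul0r. Qed.

Lemma divdiff_bnd L d h x y : lipC L h -> 0 <= L -> `|divdiff d h x y| <= L.
Proof.
by move=> hL L0; apply: le_trans (Re_le_Cabs _) _; exact: (Cabs_mulr_rinv d (hL x y) L0).
Qed.

Lemma measurable_divdiff d h : @Cmeas R _ (borelC R) h ->
  measurable_fun setT (fun p : borelC R * borelC R => divdiff d h p.1 p.2).
Proof.
move=> mh; apply: (CmeasM _ _).1; first by apply: CmeasB; [exact: Cmeas_fst|exact: Cmeas_snd].
by apply: Cmeas_rinv; apply: CmeasB; [exact: (Cmeas_fst Cmeas_id)|exact: (Cmeas_snd Cmeas_id)].
Qed.

(** The constants blow up as [d] tends to 0: this is only used at a fixed scale. *)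
Lemma divdiff_lip L H d h : 0 < d -> 0 <= L -> lipC L h -> (forall x, Cabs (h x) <= H) ->
  forall x y x' y', `|divdiff d h x y - divdiff d h x' y'| <=
    (L / d + 6 * H / d ^+ 2) * (Cabs (x - x') + Cabs (y - y')).
Proof.
move=> d0 L0 hL hH x y x' y'; rewrite /divdiff -ReB; apply: le_trans (Re_le_Cabs _) _.
have -> : (h x - h y) * rinv d (x - y) - (h x' - h y') * rinv d (x' - y') =
   ((h x - h x') - (h y - h y')) * rinv d (x - y) +
   (h x' - h y') * (rinv d (x - y) - rinv d (x' - y')) by ring.
set q := Cabs (x - x') + _; apply: le_trans (CabsD _ _) _; rewrite [leRHS]mulrDl.
rewrite [Cabs (_ * rinv _ _)]CabsM [Cabs (_ * (rinv _ _ - _))]CabsM.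
have H0 : 0 <= H by apply: le_trans (hH 0); exact: Cabs_ge0.
apply: lerD.
  rewrite mulrAC; apply: ler_pM; rewrite ?Cabs_ge0 ?Cabs_rinv_le//.
  by apply: le_trans (Cabs_sub_le _ _) _; rewrite mulrDr lerD.
have -> : 6 * H / d ^+ 2 * q = (H + H) * (3 / d ^+ 2 * q) by field; rewrite gt_eqF.
apply: ler_pM; rewrite ?Cabs_ge0//.
  by apply: le_trans (Cabs_sub_le _ _) _; exact: lerD.
apply: le_trans (rinv_lip _ _ d0) _; apply: ler_wpM2l.
  by rewrite divr_ge0// exprn_ge0// ltW.
have -> : x - y - (x' - y') = (x - x') - (y - y') by ring.
exact: Cabs_sub_le.
Qed.

Lemma divdiff_infty H r d h : 0 < d -> (forall x, Cabs (h x) <= H) ->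
  (forall x, r < Cabs x -> h x = 0) ->
  forall e, 0 < e -> exists r', forall x y, r' < Cabs x \/ r' < Cabs y ->
    `|divdiff d h x y| <= e.
Proof.
move=> d0 hH hr e e0.
have H0 : 0 <= H by apply: le_trans (hH 0); exact: Cabs_ge0.
have He : 0 <= H / e by rewrite divr_ge0// ltW.
have key x y : r + H / e < Cabs x -> Cabs ((h x - h y) * rinv d (x - y)) <= e.
  move=> xr; rewrite hr ?sub0r; last by lra.
  rewrite mulNr CabsN; have [yr|yr] := leP (Cabs y) r; last first.
    by rewrite hr// mul0r Cabs0 ltW.
  apply: Cabs_mulr_rinv (ltW e0); apply: le_trans (hH y) _.
  rewrite mulrC -ler_pdivrMr//.
  by have := ler_norm (Cabs x - Cabs y); have := Cabs_dist x y; lra.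
exists (r + H / e) => x y [xr|yr]; apply: le_trans (Re_le_Cabs _) _; first exact: key.
have -> : (h x - h y) * rinv d (x - y) = (h y - h x) * rinv d (y - x).
  rewrite /rinv (CabsB y x) -(opprB y x) rmorphN /=; ring.
exact: key.
Qed.

(** The regularization only affects pairs of nearby points one of which is moved
   by [h]. *)
Lemma divdiff_dist d L h x y : 0 <= d -> lipC L h -> 0 <= L ->
  `|divdiff d h x y - divdiff 0 h x y| <=
  2 * L * ((h x != 0)%:R * (Cabs (y - x) <= d)%R%:R +
       (h y != 0)%:R * (Cabs (x - y) <= d)%R%:R).
Proof.
move=> d0 hL L0; rewrite (CabsB y x).
have [xd|xd] := leP (Cabs (x - y)) d; last first.
  by rewrite /divdiff rinv0E (rinv_large d0 (ltW xd)) subrr normr0 !mulr0 addr0 mulr0.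
have [hx|hx] := eqVneq (h x) 0; have [hy|hy] := eqVneq (h y) 0; last 3 first.
- rewrite mul0r mulr1 add0r mulr1; apply: le_trans (ler_normB _ _) _.
  by rewrite mulr_natl lerD// divdiff_bnd.
- rewrite mul0r mulr1 addr0 mulr1; apply: le_trans (ler_normB _ _) _.
  by rewrite mulr_natl lerD// divdiff_bnd.
- rewrite !mulr1; apply: le_trans (ler_normB _ _) _.
  apply: (@le_trans _ _ (2 * L)); first by rewrite mulr_natl lerD// divdiff_bnd.
  by rewrite ler_peMr ?mulr_ge0// lerDl.
by rewrite /divdiff hx hy subrr !mul0r subrr normr0 addr0 mulr0.
Qed.

End RegularizedKernel.

(** * The limit equation *)

Lemma cvg_norm_le (R : realType) (T : Type) (F : set_system T) (f : T -> R) (l c : R) :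
  ProperFilter F -> f @ F --> l -> (\forall t \near F, `|f t| <= c) -> `|l| <= c.
Proof.
move=> FF /cvgrPdist_le fl fc; apply/ler_addgt0Pr => e e0.
have [t [flt fct]] := filter_ex (filterI (fl e e0) fc).
by rewrite -[l](subrK (f t)) (le_trans (ler_normD _ _))// addrC lerD.
Qed.

Section LimitEquation.
Set Implicit Arguments.
Unset Strict Implicit.
Variables (R : realType) (p : nat) (a : 'I_p.+1 -> R[i]).
Local Notation C := R[i].
Variables (rho_ : nat -> 'I_p.+1 -> C) (rho : 'I_p.+1 -> C) (zeta : nat -> nat -> C).
Variables (N : set nat) (mu : {finite_measure set (borelC R) -> \bar R}).
Hypothesis crit : forall n, disc_critical (range a) (dPhi a (rho_ n)) n (zeta n).
Hypothesis rhoN : forall k, rho_ n k / n%:R @[n --> within N \oo] --> rho k.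
Hypothesis wl : weak_limit_point N (fun n => normalized_measure n (zeta n)) mu.
Local Notation G := (weak_filter mu N (fun n => normalized_measure n (zeta n))).

Let GF0 : ProperFilter G := weak_filter_proper wl.

Lemma Cabs_nat n : Cabs (n%:R : C) = n%:R :> R.
Proof. by rewrite -(rmorph_nat (real_complex R)) Cabs_real ger0_norm. Qed.

Lemma continuous_Cabs : continuous (@Cabs R).
Proof. by apply: lip1_continuous => x y; exact: Cabs_dist. Qed.

Lemma rho_cvg (f : C -> R) k : continuous f -> f (rho_ n k / n%:R) @[n --> G] --> f (rho k).
Proof.
move=> fc A fA; apply: weak_filter_within.
exact: (cvg_comp _ _ (@rhoN k) (fc (rho k)) A fA).
Qed.

Lemma near_pos : \forall n \near G, (0 < n)%N.
Proof. by apply: weak_filter_within; apply: cvg_within; exact: nbhs_infty_gt. Qed.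

Lemma near_ge (c : R) : \forall n \near G, c <= n%:R.
Proof.
apply: weak_filter_within; apply: cvg_within.
by apply: filterS (nbhs_infty_ger c).
Qed.

Definition charge_bound : R := \sum_(k < p.+1) Cabs (rho k) + 1.
Local Notation M := charge_bound.

Lemma charge_bound_gt0 : 0 < M.
Proof. by rewrite ltr_wpDl// sumr_ge0// => k _; exact: Cabs_ge0. Qed.

Lemma near_charge : \forall n \near G, \sum_(k < p.+1) Cabs (rho_ n k) <= M * n%:R.
Proof.
have GF := GF0.
have H : \sum_(k < p.+1) Cabs (rho_ n k / n%:R) @[n --> G] --> \sum_(k < p.+1) Cabs (rho k).
  apply: cvg_big => [|k _]; first exact: add_continuous.
  exact: rho_cvg continuous_Cabs.
have := @cvgr_le _ _ _ filter_filter _ _ H M; rewrite ltrDl => /(_ GF ltr01).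
apply: filterS2 near_pos => n n0; apply: contraTT; rewrite -!ltNge.
rewrite -ltr_pdivlMr ?ltr0n// mulr_suml.
by under [X in _ -> _ < X]eq_bigr do rewrite CabsM CabsV Cabs_nat.
Qed.

Lemma near_concentration (d e : R) : 0 < e -> e <= d / 2 ->
  \forall n \near G, forall z0, (forall k, 2 * d <= Cabs (z0 - a k)) ->
    \sum_(0 <= i < n) (Cabs (zeta n i - z0) <= e)%R%:R <=
    Num.sqrt ((3 + 2 * M) * (e / d)) * n%:R :> R.
Proof.
have GF := GF0; move=> e0 ed; have d0 : 0 < d by lra.
apply: filterS3 near_charge near_pos (near_ge (d / e)) => n nM n0 nd z0 z0a.
have [zinj _ _] := crit n.
have := zeros_concentration (fun u => critical_equilibrium u (crit n)) zinj e0 ed z0a nM.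
set S := \sum_(0 <= i < n) _ => HS.
have S0 : 0 <= S by rewrite sumr_ge0// => i _; rewrite ler0n.
have n0' : 0 < n%:R :> R by rewrite ltr0n.
have ed0 : 0 <= e / d by apply: divr_ge0; exact: ltW.
have M0 := charge_bound_gt0.
rewrite -[leRHS]ger0_norm ?mulr_ge0 ?sqrtr_ge0// -ler_sqr ?nnegrE//.
rewrite real_normK ?num_real// exprMn sqr_sqrtr; last by rewrite mulr_ge0//; lra.
apply: le_trans HS _.
have : n%:R <= e / d * n%:R ^+ 2 :> R.
  rewrite expr2 mulrA ler_peMl//.
  by rewrite mulrC -ler_pdivrMr ?divr_gt0// mul1r invf_div.
move: (e / d * n%:R ^+ 2) (mulrA (2 * (1 + M)) (e / d) (n%:R ^+ 2))
  (mulrA (3 + 2 * M) (e / d) (n%:R ^+ 2)) => q <- <- nq.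
lra.
Qed.

(** For [d = 0], the real part of [- 2 Phi' h], where [Phi] has the charges [r]. *)
Definition fieldterm (r : 'I_p.+1 -> C) d (h : C -> C) (z : C) : R :=
  \sum_(k < p.+1) complex.Re (r k * (h z * rinv d (z - a k))).

(** For [d = 0] this is minus the first variation of the energy of [mu] along
   [h]. *)
Definition weak_crit d h : R :=
  Rintegral (mu \x mu)%E setT (fun q : borelC R * borelC R => divdiff d h q.1 q.2) +
  Rintegral mu setT (fieldterm rho d h).

Lemma discrete_weak_crit n (h : C -> C) : (0 < n)%N ->
  avg2 n (zeta n) (divdiff 0 h) +
  avg n (zeta n) (fieldterm (fun k => rho_ n k / n%:R) 0 h) = 0.
Proof.
move=> n0; have n0' : n%:R != 0 :> R by rewrite pnatr_eq0 -lt0n.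
have := congr1 (@complex.Re R) (critical_equilibrium (fun i => h (zeta n i)) (crit n)).
rewrite Re_equilibrium /= => E.
rewrite -[RHS](mulr0 (n%:R ^+ 2)^-1) -[X in _ * X]E mulrDr /avg2 /avg; congr (_ + _).
  congr (_ * _); rewrite !big_mkord; apply: eq_bigr => i _.
  rewrite !big_mkord (bigD1 i)//= divdiff_diag add0r; apply: eq_bigr => j _.
  by rewrite /divdiff rinv0E.
rewrite expr2 invfM -mulrA; congr (_ * _); rewrite mulr_sumr; apply: eq_bigr => i _.
rewrite /fieldterm mulr_sumr; apply: eq_bigr => k _.
rewrite rinv0E -ReMr; congr (complex.Re _).
rewrite fmorphV rmorph_nat; ring.
Qed.

(** If few zeros are close to any given zero moved by [h], few pairs of zeros feel
   the regularization. *)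
Lemma avg2_divdiff_dist n (h : C -> C) (d e L c : R) : (0 < n)%N -> 0 <= e ->
  lipC L h -> 0 <= L -> 0 <= c ->
  (forall z0, h z0 != 0 -> \sum_(0 <= i < n) (Cabs (zeta n i - z0) <= e)%R%:R <= c * n%:R) ->
  `|avg2 n (zeta n) (divdiff e h) - avg2 n (zeta n) (divdiff 0 h)| <= 4 * L * c.
Proof.
move=> n0 e0 hL L0 c0 hc; have n20 : 0 < n%:R ^+ 2 :> R by rewrite exprn_gt0// ltr0n.
rewrite /avg2 -mulrBr normrM normfV (gtr0_norm n20) ler_pdivrMl//.
pose b i j : R := (Cabs (zeta n j - zeta n i) <= e)%R%:R.
pose s i : R := (h (zeta n i) != 0)%:R.
apply: (@le_trans _ _ (\sum_(0 <= i < n) \sum_(0 <= j < n)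
    2 * L * (s i * b i j + s j * b j i))).
  rewrite -sumrB; apply: le_trans (ler_norm_sum _ _ _) _; apply: ler_sum => i _.
  rewrite -sumrB; apply: le_trans (ler_norm_sum _ _ _) _; apply: ler_sum => j _.
  exact: divdiff_dist.
have S1 : \sum_(0 <= i < n) \sum_(0 <= j < n) s i * b i j <= n%:R * (c * n%:R).
  rewrite big_mkord mulr_natl -[n in _ *+ n]card_ord -sumr_const; apply: ler_sum => i _.
  rewrite -mulr_sumr /s; have [h0|h0] := eqVneq (h (zeta n i)) 0; last by rewrite mul1r hc.
  by rewrite mul0r mulr_ge0.
have -> : \sum_(0 <= i < n) \sum_(0 <= j < n) 2 * L * (s i * b i j + s j * b j i) =
    4 * L * \sum_(0 <= i < n) \sum_(0 <= j < n) s i * b i j.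
  have -> : \sum_(0 <= i < n) \sum_(0 <= j < n) 2 * L * (s i * b i j + s j * b j i) =
      2 * L * (\sum_(0 <= i < n) \sum_(0 <= j < n) s i * b i j +
               \sum_(0 <= i < n) \sum_(0 <= j < n) s j * b j i).
    rewrite -big_split mulr_sumr; apply: eq_bigr => i _ /=.
    by rewrite -big_split mulr_sumr.
  by rewrite [X in _ + X]exchange_big /=; ring.
have -> : n%:R ^+ 2 * (4 * L * c) = 4 * L * (n%:R * (c * n%:R)) by ring.
by rewrite ler_wpM2l// mulr_ge0.
Qed.

(** Off the charges the zeros do not cluster, so that regularizing the kernel
   costs little uniformly in the number of zeros, and the regularized identities
   pass to the limit. *)
Lemma weak_crit_bound (L H r d e : R) (h : C -> C) : 0 <= L -> lipC L h ->
  (forall z, Cabs (h z) <= H) -> (forall z, r < Cabs z -> h z = 0) ->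
  (forall z k, Cabs (z - a k) < 2 * d -> h z = 0) -> 0 < e -> e <= d / 2 ->
  `|weak_crit e h| <= 4 * L * Num.sqrt ((3 + 2 * M) * (e / d)).
Proof.
have GF := GF0; move=> L0 hL hH hr had e0 ed.
have d0 : 0 < d by lra.
have mh := Cmeas_lipC hL.
have hz z k : h z * rinv e (z - a k) = h z * rinv 0 (z - a k).
  have [za|za] := ltP (Cabs (z - a k)) (2 * d); first by rewrite (had _ _ za) !mul0r.
  by rewrite rinv0E rinv_large//; lra.
have c1 : avg2 n (zeta n) (divdiff e h) @[n --> G] -->
    Rintegral (mu \x mu)%E setT (fun q : borelC R * borelC R => divdiff e h q.1 q.2).
  apply: avg2_cvg wl (measurable_divdiff e mh) _ (divdiff_lip e0 L0 hL hH) _.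
    by move=> x y; exact: divdiff_bnd.
  exact: divdiff_infty e0 hH hr.
pose g k z := h z * rinv e (z - a k).
have gl k : lipC (L / e + 3 * H / e ^+ 2) (g k).
  move=> x y; rewrite /g.
  have -> : h x * rinv e (x - a k) - h y * rinv e (y - a k) =
    (h x - h y) * rinv e (x - a k) + h y * (rinv e (x - a k) - rinv e (y - a k)) by ring.
  rewrite [leRHS]mulrDl; apply: le_trans (CabsD _ _) _; apply: lerD.
    rewrite CabsM mulrAC; apply: ler_pM; rewrite ?Cabs_ge0 ?Cabs_rinv_le//; exact: hL.
  have -> : 3 * H / e ^+ 2 * Cabs (x - y) = H * (3 / e ^+ 2 * Cabs (x - y)).
    by field; rewrite gt_eqF.
  rewrite CabsM; apply: ler_pM; rewrite ?Cabs_ge0//.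
  apply: le_trans (rinv_lip _ _ e0) _.
  by have -> : x - a k - (y - a k) = x - y by ring.
have gs k : exists r, forall z, r < Cabs z -> g k z = 0.
  by exists r => z /hr hz0; rewrite /g hz0 mul0r.
have gRe k : test_function (fun z => complex.Re (g k z)).
  split; last by have [r' H'] := gs k; exists r' => z /H' ->.
  apply: lip_continuous => x y; rewrite -ReB; apply: le_trans (Re_le_Cabs _) (gl k x y).
have gIm k : test_function (fun z => complex.Im (g k z)).
  split; last by have [r' H'] := gs k; exists r' => z /H' ->.
  apply: lip_continuous => x y; apply: le_trans (gl k x y).
  rewrite (_ : _ - _ = complex.Im (g k x - g k y)) ?Im_le_Cabs//.
  by case: (g k x) (g k y) => ? ? [].
have gB k z : Cabs (g k z) <= H / e.
  rewrite /g CabsM; apply: ler_pM; rewrite ?Cabs_ge0 ?Cabs_rinv_le//.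
have iRe k : mu.-integrable setT (EFin \o (fun z => complex.Re (g k z))).
  apply: (@integrable_bnd _ _ _ _ _ _ (H / e)) => //; first exact: mass_fin.
    exact: (continuous_borelC (gRe k).1).
  by move=> z _; apply: le_trans (Re_le_Cabs _) (gB k z).
have iIm k : mu.-integrable setT (EFin \o (fun z => complex.Im (g k z))).
  apply: (@integrable_bnd _ _ _ _ _ _ (H / e)) => //; first exact: mass_fin.
    exact: (continuous_borelC (gIm k).1).
  by move=> z _; apply: le_trans (Im_le_Cabs _) (gB k z).
have fE (s : 'I_p.+1 -> C) z : fieldterm s e h z = \sum_(k < p.+1)
    (complex.Re (s k) * complex.Re (g k z) - complex.Im (s k) * complex.Im (g k z)).
  by apply: eq_bigr => k _; rewrite ReM.
have iterm k : mu.-integrable setT (EFin \o (fun z =>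
    complex.Re (rho k) * complex.Re (g k z) - complex.Im (rho k) * complex.Im (g k z))).
  apply: (@eq_integrable _ _ _ _ _ _ _ _ _ (integrableB measurableT
     (integrableZl measurableT (complex.Re (rho k)) (iRe k))
     (integrableZl measurableT (complex.Im (rho k)) (iIm k)))) => //.
have RE : Rintegral mu setT (fieldterm rho e h) = \sum_(k < p.+1)
    (complex.Re (rho k) * Rintegral mu setT (fun z => complex.Re (g k z)) -
     complex.Im (rho k) * Rintegral mu setT (fun z => complex.Im (g k z))).
  rewrite (eq_Rintegral mu (g := fun z => \sum_(k < p.+1)
    (complex.Re (rho k) * complex.Re (g k z) - complex.Im (rho k) * complex.Im (g k z)))); last first.
    by move=> z _; exact: fE.
  rewrite (Rintegral_sum _ iterm).2; apply: eq_bigr => k _.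
  rewrite RintegralB//; [by rewrite !RintegralZl| |].
    exact: (integrableZl measurableT (complex.Re (rho k)) (iRe k)).
  exact: (integrableZl measurableT (complex.Im (rho k)) (iIm k)).
have c2 : avg n (zeta n) (fieldterm (fun k => rho_ n k / n%:R) e h) @[n --> G] -->
    Rintegral mu setT (fieldterm rho e h).
  have -> : (fun n => avg n (zeta n) (fieldterm (fun k => rho_ n k / n%:R) e h)) =
     (fun n => \sum_(k < p.+1)
       (complex.Re (rho_ n k / n%:R) * avg n (zeta n) (fun z => complex.Re (g k z)) -
        complex.Im (rho_ n k / n%:R) * avg n (zeta n) (fun z => complex.Im (g k z)))).
    apply/funext => n; rewrite /avg; under eq_bigr do rewrite fE.
    rewrite exchange_big mulr_sumr; apply: eq_bigr => k _ /=.
    by rewrite sumrB -!mulr_sumr; ring.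
  have ct (f : C -> R) : test_function f ->
      avg n (zeta n) f @[n --> G] --> Rintegral mu setT f.
    move=> tf; have := weak_filter_cvg wl tf.
    by under eq_fun do rewrite (Rintegral_normalized _ _ (continuous_borelC tf.1)).
  rewrite RE; apply: cvg_big => [|k _]; first exact: add_continuous.
  apply: cvgB; apply: cvgM.
  - by apply: rho_cvg; exact: continuous_Re.
  - exact: ct.
  - by apply: rho_cvg; exact: continuous_Im.
  - exact: ct.
apply: cvg_norm_le (cvgD c1 c2) _.
apply: filterS2 near_pos (near_concentration e0 ed) => n n0 conc /=.
have E := discrete_weak_crit h n0.
suff : `|avg2 n (zeta n) (divdiff e h) + avg n (zeta n)
    (fieldterm (fun k => rho_ n k / n%:R) e h)| <= 4 * L * Num.sqrt ((3 + 2 * M) * (e / d)).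
  by [].
have -> : fieldterm (fun k => rho_ n k / n%:R) e h = fieldterm (fun k => rho_ n k / n%:R) 0 h.
  by apply/funext => z; apply: eq_bigr => k _; rewrite hz.
rewrite -[X in `|X|]subr0 -[X in _ - X]E opprD addrACA subrr addr0.
apply: avg2_divdiff_dist => //; first exact: ltW.
move=> z0 hz0; apply: conc => k; rewrite leNgt; apply: contra hz0 => za.
by rewrite (had _ _ za).
Qed.

End LimitEquation.

Section LimitEquationExact.
Set Implicit Arguments.
Unset Strict Implicit.
Variables (R : realType) (p : nat) (a : 'I_p.+1 -> R[i]).
Local Notation C := R[i].
Variables (rho_ : nat -> 'I_p.+1 -> C) (rho : 'I_p.+1 -> C) (zeta : nat -> nat -> C).
Variables (N : set nat) (mu : {finite_measure set (borelC R) -> \bar R}).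

Lemma trunc0 (e : R) : trunc e 0 = 0 :> C.
Proof. by rewrite /trunc mulr0. Qed.

Lemma measurable_fieldterm (r : 'I_p.+1 -> C) d (h : C -> C) :
  @Cmeas R _ (borelC R) h -> measurable_fun [set: borelC R] (fieldterm a r d h).
Proof.
move=> mh; rewrite /fieldterm.
have -> : (fun z => \sum_(k < p.+1) complex.Re (r k * (h z * rinv d (z - a k)))) =
    (fun z => complex.Re (\sum_(k < p.+1) (r k * (h z * rinv d (z - a k))))).
  by apply/funext => z; rewrite Re_sum.
apply: (@Cmeas_sum R _ (borelC R) _ _
  (fun (k : 'I_p.+1) z => r k * (h z * rinv d (z - a k))) _).1 => k.
apply: CmeasM; first exact: Cmeas_cst.
apply: CmeasM => //; apply: Cmeas_rinv; apply: CmeasB; [exact: Cmeas_id|exact: Cmeas_cst].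
Qed.

Lemma fieldterm_bnd (r : 'I_p.+1 -> C) d (h : C -> C) L z : 0 <= L -> lipC L h ->
  (forall k, h (a k) = 0) -> `|fieldterm a r d h z| <= \sum_(k < p.+1) Cabs (r k) * L.
Proof.
move=> L0 hL ha; apply: le_trans (ler_norm_sum _ _ _) _; apply: ler_sum => k _.
apply: le_trans (Re_le_Cabs _) _; rewrite CabsM; apply: ler_wpM2l; first exact: Cabs_ge0.
by apply: Cabs_mulr_rinv => //; rewrite -[h z]subr0 -(ha k).
Qed.

Let eps (k : nat) : R := k.+1%:R^-1.

Let eps0 k : 0 < eps k. Proof. by rewrite invr_gt0. Qed.

Let eps1 k : eps k <= 1. Proof. by rewrite invf_le1// ler1n. Qed.

Lemma eps_small (w c : R) : 0 < c -> \forall k \near \oo, w * eps k <= c.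
Proof.
move=> c0; have c0' : 0 < c / (`|w| + 1) by rewrite divr_gt0// ltr_wpDl.
apply: filterS (near_infty_natSinv_lt (PosNum c0')) => k /= /ltW kc.
apply: (@le_trans _ _ ((`|w| + 1) * eps k)).
  by rewrite ler_wpM2r ?(ltW (eps0 k))// (le_trans (ler_norm w))// lerDl.
by rewrite mulrC -ler_pdivlMr// ltr_wpDl.
Qed.

Let eps3 k : eps k ^+ 3 <= eps k.
Proof. by rewrite exprS ler_piMr ?(ltW (eps0 k))// exprn_ile1// ?eps1 ?ltW. Qed.

Lemma rinv_cvg (c w u : C) (w_ : nat -> C) : (forall k, Cabs (w_ k - w) <= 2 * eps k) ->
  complex.Re (c * (w_ k * rinv (eps k ^+ 3) u)) @[k --> \oo] -->
  complex.Re (c * (w * rinv 0 u)).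
Proof.
move=> ww; have [->|u0] := eqVneq u 0.
  rewrite rinv00 !mulr0; under eq_fun do rewrite rinv00 !mulr0.
  exact: cvg_cst.
have up : 0 < Cabs u by rewrite Cabs_gt0.
apply/cvgrPdist_le => e e0.
apply: filterS2 (eps_small 1 up) (eps_small (Cabs c * (Cabs u)^-1 * 2) e0) => k ku ke.
rewrite rinv0E rinv_large ?exprn_ge0 ?(ltW (eps0 k))//; last first.
  by apply: le_trans (eps3 k) _; rewrite -[eps k]mul1r.
rewrite -ReB; apply: le_trans (Re_le_Cabs _) _; apply: le_trans ke.
have -> : c * (w / u) - c * (w_ k / u) = c * u^-1 * (w - w_ k) by ring.
rewrite -!mulrA CabsM; apply: ler_wpM2l; first exact: Cabs_ge0.
rewrite CabsM CabsV; apply: ler_wpM2l; first by rewrite invr_ge0 Cabs_ge0.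
by rewrite CabsB.
Qed.

Hypothesis crit : forall n, disc_critical (range a) (dPhi a (rho_ n)) n (zeta n).
Hypothesis rhoN : forall k, rho_ n k / n%:R @[n --> within N \oo] --> rho k.
Hypothesis wl : weak_limit_point N (fun n => normalized_measure n (zeta n)) mu.
Local Notation M := (charge_bound rho).

(** Truncating the values of [h] near 0 makes it vanish near the charges, where
   no control on the clustering of zeros is available.  With truncation scale
   [e] the field vanishes up to a distance of order [e] from the charges, and the
   regularization scale [e ^ 3] makes the bound of the previous estimate of order
   [e]. *)
Lemma weak_crit0 (L H r : R) (h : C -> C) : 0 < L -> lipC L h ->
  (forall z, Cabs (h z) <= H) -> (forall z, r < Cabs z -> h z = 0) ->
  (forall k, h (a k) = 0) -> weak_crit a rho mu 0 h = 0.
Proof.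
move=> L0 hL hH hr ha.
pose hk k z := h z - trunc (eps k) (h z).
have hkh k z : Cabs (hk k z - h z) <= eps k.
  by rewrite /hk addrAC subrr sub0r CabsN Cabs_trunc_le.
have hkL k : lipC (3 * L) (hk k).
  move=> x y; rewrite /hk.
  have -> : h x - trunc (eps k) (h x) - (h y - trunc (eps k) (h y)) =
    h x - h y - (trunc (eps k) (h x) - trunc (eps k) (h y)) by ring.
  apply: le_trans (Cabs_sub_le _ _) _.
  have := trunc_lip (h x) (h y) (eps0 k); have := hL x y.
  by move: (Cabs _) (Cabs _) (Cabs _) => s t q; lra.
have hkH k z : Cabs (hk k z) <= H + 1.
  have := Cabs_triangle (hk k z) (h z) 0; rewrite !subr0 => /le_trans; apply.
  by rewrite addrC lerD// (le_trans (hkh k z)).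
have hkr k z : r < Cabs z -> hk k z = 0 by move=> /hr hz; rewrite /hk hz trunc0 subrr.
have hka k i : hk k (a i) = 0 by rewrite /hk ha trunc0 subrr.
have hkd k z i : Cabs (z - a i) < 2 * (eps k / (2 * L)) -> hk k z = 0.
  move=> zi; rewrite /hk trunc_id ?subrr//; apply/ltW.
  have := hL z (a i); rewrite ha subr0 => /le_lt_trans; apply.
  rewrite mulrC -ltr_pdivlMr//; apply: lt_le_trans zi _.
  by rewrite le_eqVlt; apply/orP; left; apply/eqP; field; rewrite gt_eqF.
have cvg : weak_crit a rho mu (eps k ^+ 3) (hk k) @[k --> \oo] --> weak_crit a rho mu 0 h.
  have L3 : 0 <= 3 * L by rewrite mulr_ge0// ltW.
  apply: cvgD.
    apply: (@Rintegral_bounded_cvg _ _ _ _ _ _ (3 * L)); first exact: prod_fin.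
    - by move=> k; apply: measurable_divdiff; exact: Cmeas_lipC (hkL k).
    - by move=> k q; apply: divdiff_bnd (hkL k) L3.
    - move=> q; have := @rinv_cvg 1 (h q.1 - h q.2) (q.1 - q.2) (fun k => hk k q.1 - hk k q.2).
      rewrite mul1r; under eq_fun do rewrite mul1r; apply => k.
      have -> : hk k q.1 - hk k q.2 - (h q.1 - h q.2) =
         (hk k q.1 - h q.1) - (hk k q.2 - h q.2) by ring.
      by apply: le_trans (Cabs_sub_le _ _) _; rewrite mulr_natl lerD.
  apply: (@Rintegral_bounded_cvg _ _ _ _ _ _ (\sum_(k < p.+1) Cabs (rho k) * (3 * L))).
  - exact: mass_fin.
  - by move=> k; apply: measurable_fieldterm; exact: Cmeas_lipC (hkL k).
  - by move=> k z; exact: fieldterm_bnd.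
  - move=> z; apply: cvg_big => [|i _]; first exact: add_continuous.
    apply: rinv_cvg => k; apply: le_trans (hkh k z) _.
    by rewrite ler_peMl// ?ler1n// ltW.
have M0 : 0 < 3 + 2 * M by have := charge_bound_gt0 rho; lra.
apply/eqP; rewrite -normr_eq0; apply/eqP/le_anti; rewrite normr_ge0 andbT.
apply/ler_addgt0Pr => e e0; rewrite add0r; apply: cvg_norm_le cvg _.
have L20 : 0 < (4 * L)^-1 by rewrite invr_gt0 mulr_gt0.
apply: filterS2 (eps_small 1 L20)
  (eps_small (4 * (3 * L) * Num.sqrt ((3 + 2 * M) * (2 * L))) e0) => k k1 k2.
have dk : eps k ^+ 3 <= eps k / (2 * L) / 2.
  rewrite exprS -mulrA ler_wpM2l ?(ltW (eps0 k))//.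
  have -> : (2 * L)^-1 / 2 = (4 * L)^-1 by field; rewrite gt_eqF.
  apply: le_trans k1; rewrite mul1r expr2 ler_piMr ?(ltW (eps0 k))//.
have L3 : 0 <= 3 * L by rewrite mulr_ge0// ltW.
have := weak_crit_bound crit rhoN wl L3 (hkL k) (hkH k) (hkr k) (hkd k)
  (exprn_gt0 3 (eps0 k)) dk.
move/le_trans; apply; apply: le_trans k2.
rewrite -(mulrA (4 * (3 * L))) ler_wpM2l ?mulr_ge0 ?(ltW L0)//.
have -> : eps k ^+ 3 / (eps k / (2 * L)) = 2 * L * eps k ^+ 2.
  by field; rewrite !gt_eqF.
rewrite mulrA sqrtrM ?mulr_ge0 ?(ltW M0) ?(ltW L0)// sqrtr_sqr ger0_norm//.
exact: ltW.
Qed.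

Lemma exists_dist z0 : ~ range a z0 ->
  exists2 d : R, 0 < d & forall k, 2 * d <= Cabs (z0 - a k).
Proof.
move=> z0a; pose s := \sum_(k < p.+1) (Cabs (z0 - a k))^-1.
have k0 k : 0 < Cabs (z0 - a k).
  by rewrite Cabs_gt0 subr_eq0; apply/eqP => E; apply: z0a; exists k.
have ks k : (Cabs (z0 - a k))^-1 <= s.
  rewrite /s (bigD1 k)//= lerDl sumr_ge0// => i _; rewrite invr_ge0; exact: Cabs_ge0.
have s0 : 0 < s by apply: lt_le_trans (ks ord0); rewrite invr_gt0.
exists (s^-1 / 2) => [|k]; first by rewrite divr_gt0 ?invr_gt0.
by rewrite mulrC divfK// -[leRHS]invrK lef_pV2 ?posrE ?invr_gt0.
Qed.

Lemma measurable_C1 (z0 : C) : measurable ([set z0] : set (borelC R)).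
Proof.
have cf : continuous (fun z => Cabs (z - z0)).
  apply: lip1_continuous => x y; apply: le_trans (Cabs_dist _ _) _.
  by rewrite (_ : x - z0 - (y - z0) = x - y)//; ring.
have := continuous_borelC cf measurableT (measurable_set1 0).
rewrite setTI (_ : _ @^-1` _ = [set z0])//; apply/seteqP; split => z /=.
  by move/eqP; rewrite Cabs_eq0 subr_eq0 => /eqP.
by move=> ->; rewrite subrr Cabs0.
Qed.

(** Averages over the zeros of a bump supported in a small disc are bounded by the
   fraction of zeros in this disc. *)
Lemma no_atoms z0 : ~ range a z0 -> mu [set z0] = 0%E.
Proof.
move=> z0a; have GF := weak_filter_proper wl.
have [d d0 z0d] := exists_dist z0a.
have mfin : mu [set z0] \is a fin_num by apply: fin_num_measure; exact: measurable_C1.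
pose x := fine (mu [set z0]).
have x0 : 0 <= x by rewrite fine_ge0.
have M0 : 0 < 3 + 2 * M by have := charge_bound_gt0 rho; lra.
have key e : 0 < e -> e <= d / 2 -> x <= Num.sqrt ((3 + 2 * M) * (e / d)).
  move=> e0 ed; pose f (z : C) : R := Order.max 0 (1 - Cabs (z - z0) / e).
  have f0 z : 0 <= f z by rewrite le_max lexx.
  have fe z : f z <= (Cabs (z - z0) <= e)%R%:R.
    rewrite /f; have [ze|ze] := leP (Cabs (z - z0)) e.
      by rewrite ge_max ler01 gerBl divr_ge0 ?Cabs_ge0 ?(ltW e0).
    by rewrite ge_max lexx subr_le0 ler_pdivlMr// mul1r ltW.
  have tf : test_function f.
    split.
      apply: (lip_continuous (L := e^-1)) => z w.
      apply: le_trans (maxr_dist 0 (1 - Cabs (z - z0) / e) (1 - Cabs (w - z0) / e)) _.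
      rewrite sub_subl -mulrBl normrM.
      rewrite normfV (gtr0_norm e0) mulrC ler_pM2l ?invr_gt0// (CabsB z w).
      by rewrite (le_trans (Cabs_dist _ _))// (_ : w - z0 - (z - z0) = w - z)//; ring.
    exists (Cabs z0 + e) => z ze; apply: max_l; rewrite subr_le0 ler_pdivlMr// mul1r.
    by have := Cabs_dist z z0; have := ler_norm (Cabs z - Cabs z0); lra.
  have mf := continuous_borelC tf.1.
  have f1 z : `|f z| <= 1 by rewrite ger0_norm// (le_trans (fe z))// lern1 leq_b1.
  have xf : x <= Rintegral mu setT f.
    have -> : x = Rintegral mu setT (\1_[set z0] : borelC R -> R).
      by rewrite /Rintegral integral_indic ?setIT//; exact: measurable_C1.
    apply: le_Rintegral => //.
    - apply: (@integrable_bnd _ _ _ _ _ _ 1) => //; first exact: mass_fin.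
        by apply: measurable_indic; exact: measurable_C1.
      by move=> z _; rewrite normr_nat lern1 leq_b1.
    - apply: (@integrable_bnd _ _ _ _ _ _ 1) => //; first exact: mass_fin.
      by move=> z _; exact: f1.
    - move=> z _; have [|_] := boolP (z \in _); last exact: f0.
      by rewrite inE /= => ->; rewrite /f subrr Cabs0 mul0r subr0 max_r.
  apply: le_trans xf _; apply: le_trans (ler_norm _) _.
  apply: cvg_norm_le (weak_filter_cvg wl tf) _.
  apply: filterS2 (near_pos zeta N mu) (near_concentration crit rhoN wl e0 ed) => n n0 /(_ _ z0d) H.
  rewrite (Rintegral_normalized _ _ mf) ger0_norm; last first.
    by rewrite mulr_ge0 ?invr_ge0// sumr_ge0.
  rewrite /avg ler_pdivrMl ?ltr0n// [leRHS]mulrC; apply: le_trans H.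
  by apply: ler_sum => i _; exact: fe.
suff : x = 0 by move=> E; rewrite -[LHS]fineK// -/x E.
apply/eqP; apply: contraT => xn0.
have xp : 0 < x by rewrite lt_neqAle eq_sym xn0.
(* at this scale the estimate reads [x ^ 2 <= x ^ 2 / 2] *)
pose e := Order.min (d / 2) (x ^+ 2 * d / (2 * (3 + 2 * M))).
have e0 : 0 < e by rewrite lt_min !divr_gt0// ?mulr_gt0// exprn_gt0.
have := key e e0; rewrite ge_min lexx => /(_ isT).
rewrite -ler_sqr ?nnegrE ?sqrtr_ge0// sqr_sqrtr; last first.
  by rewrite mulr_ge0 ?(ltW M0)// divr_ge0 ?ltW.
have : (3 + 2 * M) * (e / d) <= x ^+ 2 / 2.
  rewrite mulrA ler_pdivrMr// mulrC -ler_pdivlMr//.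
  rewrite ge_min; apply/orP; right; rewrite le_eqVlt; apply/orP; left.
  by apply/eqP; field; rewrite gt_eqF.
have : 0 < x ^+ 2 by rewrite exprn_gt0.
lra.
Qed.

End LimitEquationExact.

(** * Variations of the continuous energy *)

Section ContinuousVariation.
Set Implicit Arguments.
Unset Strict Implicit.
Variables (R : realType) (p : nat) (a rho : 'I_p.+1 -> R[i]).
Local Notation C := R[i].
Local Notation F := (dPhi a rho).
Variable mu : {finite_measure set (borelC R) -> \bar R}.

Lemma measurable_integral_snd d1 d2 (T1 : measurableType d1) (T2 : measurableType d2)
    (m : {sigma_finite_measure set T2 -> \bar R}) (g : T1 * T2 -> \bar R) :
  measurable_fun setT g -> measurable_fun setT (fun x => \int[m]_y g (x, y))%E.
Proof.
move=> mg; rewrite [X in measurable_fun _ X](_ : _ = (fun x =>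
    \int[m]_y (g^\+ (x, y)) - \int[m]_y (g^\- (x, y)))%E).
  apply: emeasurable_funB; apply: (@measurable_fun_fubini_tonelli_F _ _ T1 T2) => //.
    by apply: measurable_funepos.
  by apply: measurable_funeneg.
apply/funext => x; rewrite integralE.
by congr (_ - _)%E; apply: eq_integral => y _; rewrite ?funeposE ?funenegE.
Qed.

Lemma measurable_dphi (g : C -> C) : @Cmeas R _ (borelC R) g ->
  measurable_fun [set: borelC R] (fun z => dphi F z (z + g z)).
Proof.
move=> mg.
pose phi (q : borelC R * R) : R :=
  complex.Re (F (q.1 + q.2%:C * g q.1) * g q.1) * \1_(`[0%R, 1%R]%classic) q.2.
have mphi : measurable_fun setT (EFin \o phi).
  apply/measurable_EFinP; apply: measurable_funM; last first.
    by apply: measurableT_comp measurable_snd; exact: measurable_indic.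
  have m1 (f : C -> C) : @Cmeas R _ (borelC R) f ->
      Cmeas (fun q : borelC R * R => f q.1).
    by move=> [f1 f2]; split;
      [exact: measurableT_comp f1 measurable_fst|exact: measurableT_comp f2 measurable_fst].
  apply: (CmeasM _ (m1 _ mg)).1; apply: Cmeas_dPhi; apply: CmeasD.
    exact: m1 (@Cmeas_id R).
  by apply: CmeasM (m1 _ mg); apply: Cmeas_real; exact: measurable_snd.
have := measurable_integral_snd (@lebesgue_measure R) mphi.
move=> /(measurableT_comp (@fine_measurable R _ measurableT)).
rewrite (_ : fine \o _ = (fun z => dphi F z (z + g z)))//.
apply/funext => z /=; rewrite /dphi /Rintegral [in RHS]integral_mkcond; congr fine.
apply: eq_integral => s _; rewrite /phi /patch indicE /=.
have -> : z + g z - z = g z by rewrite addrC addKr.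
by case: (s \in _); rewrite ?mulr1 ?mulr0.
Qed.

Lemma measurable_logk_comp (d : measure_display) (T : measurableType d) (f g : T -> C) :
  Cmeas f -> Cmeas g -> measurable_fun setT (fun q => logk (f q) (g q)).
Proof.
move=> mf mg; apply: measurableT_comp => //.
apply: (measurableT_comp (@measurable_ln R)).
by apply: measurable_Cabs; exact: CmeasB.
Qed.

Lemma Cmeas_variation (h : C -> C) t : @Cmeas R _ (borelC R) h ->
  @Cmeas R _ (borelC R) (Defs.variation h t).
Proof. by move=> mh; apply: CmeasD (@Cmeas_id R) (CmeasM (Cmeas_cst _ t) mh). Qed.

Lemma measurable_denergy (T : C -> C) : @Cmeas R _ (borelC R) T ->
  measurable_fun setT (fun q : borelC R * borelC R =>
    logk (T q.1) (T q.2) - logk q.1 q.2).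
Proof.
move=> mT; apply: measurable_funB; apply: measurable_logk_comp.
- exact: Cmeas_fst.
- exact: Cmeas_snd.
- exact: (Cmeas_fst (@Cmeas_id R)).
- exact: (Cmeas_snd (@Cmeas_id R)).
Qed.

Lemma fieldterm_dPhi (g : C -> C) z :
  2 * complex.Re (F z * g z) = - fieldterm a rho 0 g z.
Proof.
rewrite -ReM2 /fieldterm -Re_sum -ReN; congr (complex.Re _).
rewrite /dPhi mulNr mulrN mulr_suml mulr_sumr; congr (- _); apply: eq_bigr => k _.
by rewrite rinv0E; move: (_ - _)^-1 => v; field.
Qed.

(** The increments of the energy along a Lipschitz displacement vanishing at the
   charges agree with their first-order part up to a quadratic error that is
   uniform in the points, as the displacement is small relative to all mutual
   distances. *)
Lemma denergy_phi_expand (g : C -> C) (l : R) : 0 <= l -> l <= 4^-1 -> lipC l g ->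
  (forall k, g (a k) = 0) ->
  `|denergy_phi F mu (fun z => z + g z) + weak_crit a rho mu 0 g| <=
  (6 * fine ((mu \x mu)%E [set: borelC R * borelC R]) +
   2 * (\sum_(k < p.+1) Cabs (rho k)) * fine (mu [set: borelC R])) * l ^+ 2.
Proof.
move=> l0 l4 gl ga.
have mg := Cmeas_lipC gl.
have E1 (q : borelC R * borelC R) : `|logk (q.1 + g q.1) (q.2 + g q.2) - logk q.1 q.2
      - - divdiff 0 g q.1 q.2| <= 6 * l ^+ 2.
  case: q => x y /=; rewrite (opprK (divdiff _ _ _ _)) /divdiff rinv0E.
  apply: le_trans (logk_expand _) _.
    by apply: le_trans (gl x y) _; rewrite ler_wpM2r ?Cabs_ge0.
  rewrite ler_wpM2l// lerXn2r ?nnegrE ?divr_ge0 ?Cabs_ge0//.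
  have [->|xy] := eqVneq x y; first by rewrite !subrr Cabs0 mul0r.
  by rewrite ler_pdivrMr ?Cabs_gt0 ?subr_eq0.
pose c := \sum_(k < p.+1) Cabs (rho k).
have c0 : 0 <= c by rewrite sumr_ge0// => k _; exact: Cabs_ge0.
have E2 z : `|dphi F z (z + g z) - complex.Re (F z * g z)| <= c * l ^+ 2.
  have gz k : Cabs (g z) <= l * Cabs (z - a k) by rewrite -[g z]subr0 -(ga k).
  apply: le_trans (dphi_expand _ _) _ => [k|].
    by apply: le_trans (gz k) _; rewrite ler_wpM2r ?Cabs_ge0//; lra.
  rewrite mulr_suml; apply: ler_sum => k _; rewrite ler_wpM2l ?Cabs_ge0//.
  rewrite lerXn2r ?nnegrE ?divr_ge0 ?Cabs_ge0//.
  have [E|za] := eqVneq z (a k); first by rewrite E subrr Cabs0 invr0 mulr0.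
  by rewrite ler_pdivrMr ?Cabs_gt0 ?subr_eq0.
have l20 : 0 <= l ^+ 2 by rewrite sqr_ge0.
have idd : (mu \x mu)%E.-integrable setT
    (EFin \o (fun q : borelC R * borelC R => - divdiff 0 g q.1 q.2)).
  apply: (@integrable_bnd _ _ _ _ _ _ l) => //; first exact: prod_fin.
    by apply: measurableT_comp => //; exact: measurable_divdiff.
  by move=> q _; rewrite normrN; exact: divdiff_bnd.
have iE : (mu \x mu)%E.-integrable setT (EFin \o (fun q : borelC R * borelC R =>
    logk (q.1 + g q.1) (q.2 + g q.2) - logk q.1 q.2)).
  apply: (@integrable_bnd _ _ _ _ _ _ (6 * l ^+ 2 + l)) => //; first exact: prod_fin.
    by apply: (@measurable_denergy (fun z => z + g z)); exact: CmeasD (@Cmeas_id R) mg.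
  move=> q _; rewrite -[X in `|X|](subrK (- divdiff 0 g q.1 q.2)).
  by apply: le_trans (ler_normD _ _) _; rewrite lerD// normrN; exact: divdiff_bnd.
have mF : measurable_fun [set: borelC R] (fun z => complex.Re (F z * g z)).
  by apply: (CmeasM _ mg).1; exact: (Cmeas_dPhi a rho (@Cmeas_id R)).
have bF z : `|complex.Re (F z * g z)| <= c * l.
  have := fieldterm_bnd rho 0 z l0 gl ga; rewrite -mulr_suml -/c -[X in X <= _]normrN.
  rewrite -fieldterm_dPhi normrM ger0_norm// => H.
  by apply: le_trans H; rewrite ler_peMl// ler1n.
have iF : mu.-integrable setT (EFin \o (fun z => complex.Re (F z * g z))).
  by apply: (@integrable_bnd _ _ _ _ _ _ (c * l)) => //; exact: mass_fin.
have iD : mu.-integrable setT (EFin \o (fun z => dphi F z (z + g z))).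
  apply: (@integrable_bnd _ _ _ _ _ _ (c * l ^+ 2 + c * l)) => //; first exact: mass_fin.
    exact: measurable_dphi.
  move=> z _; rewrite -[X in `|X|](subrK (complex.Re (F z * g z))).
  by apply: le_trans (ler_normD _ _) _; rewrite lerD.
have B1 := Rintegral_dist measurableT (prod_fin mu) iE idd (fun q _ => E1 q).
have B2 := Rintegral_dist measurableT (mass_fin mu) iD iF (fun z _ => E2 z).
have N1 : Rintegral (mu \x mu)%E setT (fun q : borelC R * borelC R => - divdiff 0 g q.1 q.2) =
    - Rintegral (mu \x mu)%E setT (fun q : borelC R * borelC R => divdiff 0 g q.1 q.2).
  rewrite -mulN1r -RintegralZl//; last first.
    apply: (@integrable_bnd _ _ _ _ _ _ l) => //; first exact: prod_fin.
      exact: measurable_divdiff.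
    by move=> q _; exact: divdiff_bnd.
  by apply: eq_Rintegral => q _; rewrite mulN1r.
have N2 : Rintegral mu setT (fieldterm a rho 0 g) =
    - (2 * Rintegral mu setT (fun z => complex.Re (F z * g z))).
  rewrite -mulNr -RintegralZl//; apply: eq_Rintegral => z _.
  by rewrite mulNr fieldterm_dPhi opprK.
rewrite /denergy_phi /weak_crit N2 /denergy /=.
move: B1 B2; rewrite N1 -/c.
set A := Rintegral (mu \x mu)%E _ _; set B := Rintegral (mu \x mu)%E _ _.
set D := Rintegral mu _ _; set E := Rintegral mu _ _.
rewrite opprK => B1 B2.
have -> : B + 2 * D + (A - 2 * E) = (B + A) + 2 * (D - E) by ring.
apply: le_trans (ler_normD _ _) _; rewrite normrM (@ger0_norm _ 2)//.
rewrite [leRHS]mulrDl; apply: lerD; first by rewrite mulrAC.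
have -> : 2 * c * fine (mu [set: borelC R]) * l ^+ 2 =
  2 * (c * l ^+ 2 * fine (mu [set: borelC R])) by ring.
by rewrite ler_wpM2l.
Qed.

Lemma measurable_neq (h h' : C -> C) : @Cmeas R _ (borelC R) h ->
  @Cmeas R _ (borelC R) h' -> measurable ([set z | h z <> h' z] : set (borelC R)).
Proof.
move=> mh mh'.
have := measurable_Cabs (CmeasB mh mh') measurableT (measurableC (measurable_set1 0)).
rewrite setTI (_ : _ @^-1` _ = [set z | h z <> h' z])//; apply/seteqP; split => z /=.
  by move=> H E; apply: H; rewrite E subrr Cabs0.
by move=> H /eqP; rewrite Cabs_eq0 subr_eq0 => /eqP.
Qed.

(** Fields that agree almost everywhere also do so simultaneously at both points of
   almost every pair. *)
Lemma denergy_phi_ae (h h' : C -> C) t : @Cmeas R _ (borelC R) h ->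
  @Cmeas R _ (borelC R) h' -> mu [set z | h z <> h' z] = 0%E ->
  denergy_phi F mu (Defs.variation h t) = denergy_phi F mu (Defs.variation h' t).
Proof.
move=> mh mh' hh'; have mB := measurable_neq mh mh'.
pose B : set (borelC R) := [set z | h z <> h' z].
rewrite -/B in hh' mB.
have E1 : denergy mu (Defs.variation h t) = denergy mu (Defs.variation h' t).
  rewrite /denergy /Rintegral.
  have mv g : @Cmeas R _ (borelC R) g -> measurable_fun setT
      (EFin \o (fun q : borelC R * borelC R =>
        logk (Defs.variation g t q.1) (Defs.variation g t q.2) - logk q.1 q.2)).
    by move=> mg; apply/measurable_EFinP; apply: measurable_denergy; exact: Cmeas_variation.
  have mB1 : measurable (B `*` [set: borelC R]) by exact: measurableX.
  have mB2 : measurable ([set: borelC R] `*` B) by exact: measurableX.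
  have n1 : (mu \x mu)%E (B `*` [set: borelC R]) = 0%E.
    by apply: etrans (product_measure1E mu mu mB measurableT) _; rewrite [X in (X * _)%E]hh' mul0e.
  have n2 : (mu \x mu)%E ([set: borelC R] `*` B) = 0%E.
    by apply: etrans (product_measure1E mu mu measurableT mB) _; rewrite [X in (_ * X)%E]hh' mule0.
  rewrite (@ae_eq_integral _ _ _ (mu \x mu)%E _ _ _ measurableT (mv h mh) (mv h' mh'))//.
  exists ((B `*` [set: borelC R]) `|` ([set: borelC R] `*` B)); split.
  - exact: measurableU.
  - exact: null_set_setU.
  - move=> [x y] /= H; apply: contrapT => /not_orP[H1 H2]; apply: H => _.
    have hx : h x = h' x by apply: contrapT => ?; apply: H1.
    have hy : h y = h' y by apply: contrapT => ?; apply: H2.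
    by rewrite /Defs.variation hx hy.
have E2 : Rintegral mu setT (fun z => dphi F z (Defs.variation h t z)) =
    Rintegral mu setT (fun z => dphi F z (Defs.variation h' t z)).
  rewrite /Rintegral.
  have mv g : @Cmeas R _ (borelC R) g ->
      measurable_fun [set: borelC R] (EFin \o (fun z => dphi F z (Defs.variation g t z))).
    move=> mg; apply/measurable_EFinP; apply: (@measurable_dphi (fun z => t * g z)).
    exact: CmeasM (Cmeas_cst _ t) mg.
  rewrite (@ae_eq_integral _ _ _ mu _ _ _ measurableT (mv h mh) (mv h' mh'))//.
  by exists B; split => // z /= H hz; apply: H => _; rewrite /Defs.variation hz.
by rewrite /denergy_phi E1 E2.
Qed.

End ContinuousVariation.

(** * Localization of smooth vector fields *)

Section Smooth.
Set Implicit Arguments.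
Unset Strict Implicit.
Variable R : realType.
Local Notation C := R[i].

Lemma normCE (z : C) : `|z| = (Cabs z)%:C.
Proof. by case: z => x y; rewrite normc_def. Qed.

Lemma gt0_complex (e : C) : 0 < e -> exists2 r : R, 0 < r & e = r%:C.
Proof.
case: e => x y; rewrite ltcE /= => /andP[/eqP -> x0].
by exists x.
Qed.

Lemma quadratic_cvg0 (D : C -> R) (r K : R) : 0 < r ->
  (forall t, Cabs t <= r -> `|D t| <= K * Cabs t ^+ 2) ->
  (D t)%:C / t @[t --> (0 : C)^'] --> (0 : C).
Proof.
move=> r0 DK; apply/cvgr0Pnorm_lt => _ /gt0_complex[e e0 ->].
have d0 : 0 < Order.min r (e / (`|K| + 1)) by rewrite lt_min r0 divr_gt0// ltr_wpDl.
have := @dnbhs0_lt C C (Order.min r (e / (`|K| + 1)))%:C; rewrite ltcR => /(_ d0).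
rewrite !near_withinE; apply: filterS => t + t0; move=> /(_ t0).
rewrite normCE ltcR lt_min => /andP[tr te].
have tp : 0 < Cabs t by rewrite Cabs_gt0; exact: t0.
rewrite normCE ltcR CabsM CabsV Cabs_real ltr_pdivrMr//.
apply: le_lt_trans (DK t (ltW tr)) _; rewrite expr2 mulrA ltr_pM2r//.
apply: le_lt_trans (ler_wpM2r (ltW tp) (ler_norm K)) _.
move: te; rewrite ltr_pdivlMr ?ltr_wpDl// mulrDr mulr1 mulrC; lra.
Qed.

Lemma continuous_complex2 : continuous (fun q : R * R => q.1 +i* q.2 : C).
Proof.
move=> [s t]; apply/cvgrPdist_lt => _ /gt0_complex[e e0 ->].
have e2 : 0 < e / 2 by rewrite divr_gt0.
exists (ball s (e / 2), ball t (e / 2)) => /= [|[s' t'] [/= ss tt]].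
  by split; exact: nbhsx_ballx.
rewrite normCE ltcR; apply: le_lt_trans (Cabs_le_ReIm _) _ => /=.
by rewrite (splitr e) ltrD.
Qed.

Lemma bounded_on_square (f : C -> R) (c : R) : continuous f ->
  exists2 B : R, 0 <= B & forall x y : R, `|x| <= c -> `|y| <= c -> `|f (x +i* y)| <= B.
Proof.
move=> fc.
pose K : set (R * R) := `[- c, c]%classic `*` `[- c, c]%classic.
have Kc : compact K by apply: compact_setX; exact: segment_compact.
have gc : continuous (fun q : R * R => f (q.1 +i* q.2)).
  by move=> q; apply: continuous_comp; [exact: continuous_complex2|exact: fc].
have := compact_bounded (continuous_compact (continuous_subspaceT gc) Kc).
move=> [B [_ HB]]; exists (`|B| + 1) => [|x y xc yc]; first by rewrite addr_ge0.
apply: (HB (`|B| + 1)); first by rewrite (le_lt_trans (ler_norm B))// ltrDl.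
by exists (x, y) => //; split; rewrite /= in_itv /= -ler_norml.
Qed.

Lemma line_lip (g dg : R -> R) (B x y : R) : (forall s, is_derive s (1:R) g (dg s)) ->
  (forall s, Order.min x y <= s <= Order.max x y -> `|dg s| <= B) ->
  `|g x - g y| <= B * `|x - y|.
Proof.
move=> gd; wlog xy : x y / x <= y => [H|] dB.
  have [|/ltW yx] := leP x y; first by move/H; apply.
  by rewrite distrC (distrC x); apply: H yx _; rewrite minC maxC.
have gcont : {within `[x, y], continuous g}.
  apply: continuous_subspaceT => s.
  by have [d _] := gd s; apply/differentiable_continuous/derivable1_diffP.
have [c cxy E] := MVT_segment xy (fun s _ => gd s) gcont.
rewrite distrC E normrM (distrC x); apply: ler_wpM2r => //.
by apply: dB; rewrite (min_l xy) (max_r xy); move: cxy; rewrite in_itv.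
Qed.

Lemma is_derive_line (f : R -> R) (s : R) :
  derivable (fun u => f (u + s)) 0 1 -> is_derive s (1:R) f (derive1 (fun u => f (u + s)) 0).
Proof.
move=> df.
have H : is_derive (s - s) (1:R) (fun u => f (u + s)) (derive1 (fun u => f (u + s)) 0).
  by rewrite subrr; split; rewrite ?derive1E.
have S : is_derive s (1:R) (fun u : R => u - s) 1.
  by apply: is_derive_eq; rewrite subr0.
have := @is_derive1_comp R (fun u => f (u + s)) (fun u => u - s) s _ _ H S; rewrite mulr1.
rewrite (_ : _ \o _ = f)//; apply/funext => u /=; by rewrite subrK.
Qed.

Lemma C1_lip_square (g : C -> R) (c : R) : Ck 1 g ->
  exists2 L : R, 0 <= L & forall x y x' y' : R,
    `|x| <= c -> `|y| <= c -> `|x'| <= c -> `|y'| <= c ->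
    `|g (x +i* y) - g (x' +i* y')| <= L * (`|x - x'| + `|y - y'|).
Proof.
move=> [_ [dx dy [cx _] [cy _]]].
have [B B0 HB] := bounded_on_square c cx; have [B' B'0 HB'] := bounded_on_square c cy.
exists (B + B') => [|x y x' y' xc yc xc' yc']; first exact: addr_ge0.
have itv (u v s : R) : `|u| <= c -> `|v| <= c -> Order.min u v <= s <= Order.max u v -> `|s| <= c.
  rewrite !ler_norml => /andP[? ?] /andP[? ?].
  by case: (leP u v) => ? /andP[? ?]; apply/andP; split; lra.
have Hx : `|g (x +i* y) - g (x' +i* y)| <= B * `|x - x'|.
  apply: (@line_lip (fun s => g (s +i* y)) (fun s => pdx g (s +i* y))) => s; last first.
    by move=> H; apply: HB => //; exact: itv H.
  have E : line_x g (s +i* y) = (fun u => g ((u + s) +i* y)).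
    by apply/funext => u; rewrite /line_x; congr g; apply/eqP; rewrite eq_complex /= addrC addr0 !eqxx.
  rewrite /pdx E; apply: (@is_derive_line (fun s => g (s +i* y))).
  by rewrite -E; exact: dx.
have Hy : `|g (x' +i* y) - g (x' +i* y')| <= B' * `|y - y'|.
  apply: (@line_lip (fun s => g (x' +i* s)) (fun s => pdy g (x' +i* s))) => s; last first.
    by move=> H; apply: HB' => //; exact: itv H.
  have E : line_y g (x' +i* s) = (fun u => g (x' +i* (u + s))).
    by apply/funext => u; rewrite /line_y; congr g; apply/eqP; rewrite eq_complex /= addr0 addrC !eqxx.
  rewrite /pdy E; apply: (@is_derive_line (fun s => g (x' +i* s))).
  by rewrite -E; exact: dy.
apply: le_trans (ler_distD (g (x' +i* y)) _ _) _.
have := normr_ge0 (x - x'); have := normr_ge0 (y - y').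
move: Hx Hy; move: `|x - x'| `|y - y'| `|_ - _| `|_ - _| => s t q q'; nra.
Qed.

(** Composing with the projection onto a square makes a locally Lipschitz field
   globally Lipschitz, without changing it on the square. *)
Lemma smooth_square_lip (h : C -> C) (c : R) : 0 <= c -> smoothC h ->
  exists (g : C -> C) (L : R),
    [/\ 0 <= L, lipC L g & forall z, Cabs z <= c -> g z = h z].
Proof.
move=> c0 hs; have [h1 h2] := hs 1%N.
have [L1 L10 HL1] := C1_lip_square c h1; have [L2 L20 HL2] := C1_lip_square c h2.
pose cl (x : R) : R := Order.max (- c) (Order.min c x).
have clc x : `|cl x| <= c.
  by rewrite ler_norml le_max lexx ge_max ge_min lexx (le_trans _ c0)// oppr_le0.
have cl_id x : `|x| <= c -> cl x = x.
  by rewrite ler_norml /cl => /andP[? ?]; rewrite min_r// max_r.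
have cl_lip x y : `|cl x - cl y| <= `|x - y|.
  exact: le_trans (maxr_dist (- c) (Order.min c x) (Order.min c y)) (minr_dist c x y).
pose pi (z : C) : C := cl (complex.Re z) +i* cl (complex.Im z).
exists (h \o pi), (2 * (L1 + L2)); split.
- by rewrite mulr_ge0// addr_ge0.
- move=> z w /=.
  have := HL1 _ _ _ _ (clc (complex.Re z)) (clc (complex.Im z)) (clc (complex.Re w)) (clc (complex.Im w)).
  have := HL2 _ _ _ _ (clc (complex.Re z)) (clc (complex.Im z)) (clc (complex.Re w)) (clc (complex.Im w)).
  rewrite -/(pi z) -/(pi w) => I2 I1.
  have S : `|cl (complex.Re z) - cl (complex.Re w)| + `|cl (complex.Im z) - cl (complex.Im w)|
      <= 2 * Cabs (z - w).
    rewrite mulr_natl; apply: lerD; apply: le_trans (cl_lip _ _) _.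
      by rewrite -ReB Re_le_Cabs.
    have -> : complex.Im z - complex.Im w = complex.Im (z - w) by case: (z) (w) => ? ? [].
    exact: Im_le_Cabs.
  apply: le_trans (Cabs_le_ReIm _) _.
  have -> : complex.Im (h (pi z) - h (pi w)) = complex.Im (h (pi z)) - complex.Im (h (pi w)).
    by case: (h (pi z)) (h (pi w)) => ? ? [].
  rewrite ReB; apply: le_trans (lerD I1 I2) _; rewrite -mulrDl -mulrA mulrCA.
  by rewrite ler_wpM2l// addr_ge0.
- move=> z zc /=; congr h; rewrite /pi !cl_id; first by case: z zc.
    by apply: le_trans zc; exact: Im_le_Cabs.
  by apply: le_trans zc; exact: Re_le_Cabs.
Qed.

Lemma lipC_cutoff (g : C -> C) (L r : R) : 0 <= L -> 0 <= r -> lipC L g ->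
  exists (h : C -> C) (L' H : R),
  [/\ 0 < L', lipC L' h, forall z, Cabs (h z) <= H, forall z, r + 1 < Cabs z -> h z = 0 &
      forall z, (g z = 0 -> h z = 0) /\ (Cabs z <= r -> h z = g z)].
Proof.
move=> L0 r0 gL; pose c := r + 1; have c0 : 0 <= c by rewrite addr_ge0.
pose H := Cabs (g 0) + L * c.
have H0 : 0 <= H by rewrite addr_ge0 ?Cabs_ge0// mulr_ge0.
have gH z : Cabs z <= c -> Cabs (g z) <= H.
  move=> zc; have := Cabs_triangle (g z) (g 0) 0; rewrite !subr0 => /le_trans; apply.
  by rewrite addrC lerD2l; apply: le_trans (gL z 0) _; rewrite subr0 ler_wpM2l.
have [chi [chi01 chil chic chir]] : exists chi : C -> R,
    [/\ forall z, 0 <= chi z <= 1, forall z w, `|chi z - chi w| <= Cabs (z - w),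
        forall z, c < Cabs z -> chi z = 0 & forall z, Cabs z <= r -> chi z = 1].
  exists (fun z => Order.max 0 (Order.min 1 (c - Cabs z))); split => z.
  - by rewrite le_max lexx ge_max ler01 ge_min lexx.
  - move=> w; apply: le_trans (maxr_dist 0 _ _) _; apply: le_trans (minr_dist 1 _ _) _.
    by rewrite sub_subl CabsB Cabs_dist.
  - by move=> zc; apply: max_l; rewrite ge_min subr_le0 (ltW zc) orbT.
  - by move=> zr; rewrite min_l ?max_r// /c addrAC lerDr subr_ge0.
have [h hE] : exists h, forall z, h z = (chi z)%:C * g z by exists (fun z => (chi z)%:C * g z).
have h0 z : c < Cabs z -> h z = 0 by move=> /chic; rewrite hE => ->; rewrite mul0r.
have lip1 z w : Cabs z <= c -> Cabs (h z - h w) <= (H + L) * Cabs (z - w).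
  move=> zc; rewrite !hE.
  have -> : (chi z)%:C * g z - (chi w)%:C * g w =
    (chi z - chi w)%:C * g z + (chi w)%:C * (g z - g w).
    by rewrite rmorphB /=; ring.
  have /andP[w0 w1] := chi01 w.
  apply: le_trans (CabsD _ _) _; rewrite [leRHS]mulrDl !CabsM !Cabs_real; apply: lerD.
    by rewrite mulrC; apply: ler_pM; rewrite ?Cabs_ge0 ?gH.
  by rewrite ger0_norm//; apply: le_trans (gL z w); rewrite ler_piMl ?Cabs_ge0.
exists h, (H + L + 1), H; split.
- by rewrite ltr_wpDl// addr_ge0.
- move=> z w; apply: (@le_trans _ _ ((H + L) * Cabs (z - w))); last first.
    by rewrite ler_wpM2r ?Cabs_ge0// lerDl.
  have [zc|zc] := leP (Cabs z) c; first exact: lip1.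
  have [wc|wc] := leP (Cabs w) c; first by rewrite CabsB (CabsB z); exact: lip1.
  by rewrite !h0// subrr Cabs0 mulr_ge0 ?Cabs_ge0// addr_ge0.
- move=> z; have [zc|/h0 ->] := leP (Cabs z) c; last by rewrite Cabs0.
  have /andP[z0 z1] := chi01 z.
  rewrite hE CabsM Cabs_real ger0_norm//; apply: le_trans (gH z zc).
  by rewrite ler_piMl ?Cabs_ge0.
- exact: h0.
- by move=> z; split => [gz|zr]; rewrite hE ?gz ?mulr0// chir// mul1r.
Qed.

End Smooth.

(** * Criticality and compactness of the limits *)

Section Limits.
Set Implicit Arguments.
Unset Strict Implicit.
Variables (R : realType) (p : nat) (a : 'I_p.+1 -> R[i]).
Local Notation C := R[i].
Variables (rho_ : nat -> 'I_p.+1 -> C) (rho : 'I_p.+1 -> C) (zeta : nat -> nat -> C).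
Variables (N : set nat) (mu : {finite_measure set (borelC R) -> \bar R}).
Hypothesis crit : forall n, disc_critical (range a) (dPhi a (rho_ n)) n (zeta n).
Hypothesis rhoN : forall k, rho_ n k / n%:R @[n --> within N \oo] --> rho k.
Hypothesis wl : weak_limit_point N (fun n => normalized_measure n (zeta n)) mu.
Local Notation M := (charge_bound rho).
Local Notation G := (weak_filter mu N (fun n => normalized_measure n (zeta n))).

Lemma Lipschitz_critical (L H r : R) (h : C -> C) : 0 < L -> lipC L h ->
  (forall z, Cabs (h z) <= H) -> (forall z, r < Cabs z -> h z = 0) ->
  (forall k, h (a k) = 0) ->
  (denergy_phi (dPhi a rho) mu (Defs.variation h t))%:C / t @[t --> (0 : C)^'] --> (0 : C).
Proof.
move=> L0 hL hH hr ha.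
set K := 6 * fine ((mu \x mu)%E [set: borelC R * borelC R]) +
   2 * (\sum_(k < p.+1) Cabs (rho k)) * fine (mu [set: borelC R]).
apply: (@quadratic_cvg0 _ _ (4 * L)^-1 (K * L ^+ 2)); first by rewrite invr_gt0 mulr_gt0.
move=> t tL; pose g z := t * h z.
have gl : lipC (Cabs t * L) g.
  by move=> x y; rewrite /g -mulrBr CabsM -mulrA ler_wpM2l ?Cabs_ge0.
have l0 : 0 <= Cabs t * L by rewrite mulr_ge0 ?Cabs_ge0// ltW.
have l4 : Cabs t * L <= 4^-1.
  by rewrite -ler_pdivlMr// -invfM.
have ga k : g (a k) = 0 by rewrite /g ha mulr0.
have W0 : weak_crit a rho mu 0 g = 0.
  apply: (weak_crit0 crit rhoN wl (L := Cabs t * L + 1) (H := Cabs t * H) (r := r)) => //.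
  - by rewrite ltr_wpDl.
  - by move=> x y; apply: le_trans (gl x y) _; rewrite ler_wpM2r ?Cabs_ge0// lerDl.
  - by move=> z; rewrite /g CabsM ler_wpM2l ?Cabs_ge0.
  - by move=> z /hr hz; rewrite /g hz mulr0.
have := denergy_phi_expand rho mu l0 l4 gl ga; rewrite W0 addr0 -/K.
have -> : K * (Cabs t * L) ^+ 2 = K * L ^+ 2 * Cabs t ^+ 2 by ring.
by [].
Qed.

(** A smooth field only has to be kept on the disc that contains the part of the
   measure it moves; beyond, it is cut off to be Lipschitz with bounded support. *)
Lemma limit_cont_critical : cont_critical (range a) (dPhi a rho) mu.
Proof.
split=> [z|h hs hA [r hr]]; first exact: (no_atoms crit rhoN wl).
pose r1 := `|r|; have r10 : 0 <= r1 := normr_ge0 r.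
have c0 : 0 <= r1 + 1 by rewrite addr_ge0.
have [g [L [L0 gL gh]]] := smooth_square_lip c0 hs.
have [h' [L' [H [L'0 h'L h'H h'r h'g]]]] := lipC_cutoff L0 r10 gL.
have h'0 z : h z = 0 -> h' z = 0.
  move=> hz; have [zc|/h'r//] := leP (Cabs z) (r1 + 1).
  by apply: (h'g z).1; rewrite gh.
have h'h z : Cabs z <= r1 -> h' z = h z.
  by move=> zr; rewrite (h'g z).2// gh// (le_trans zr)// lerDl.
have mh : @Cmeas R _ (borelC R) h.
  by have [[c1 _] [c2 _]] := hs 0%N; split; exact: continuous_borelC.
have mh' := Cmeas_lipC h'L.
have mz : @Cmeas R _ (borelC R) (fun=> 0) by exact: Cmeas_cst.
have hh' : mu [set z | h z <> h' z] = 0%E.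
  have mr : measurable ([set z | r < Cabs z] : set (borelC R)).
    have := continuous_borelC (@continuous_Cabs R) measurableT (measurable_itv `]r, +oo[).
    rewrite setTI (_ : _ @^-1` _ = [set z | r < Cabs z])//.
    by apply/seteqP; split => z /=; rewrite in_itv /= andbT.
  have mA : measurable ([set z | r < Cabs z /\ h z <> 0] : set (borelC R)).
    by have := measurableI _ _ mr (measurable_neq mh mz).
  apply: (subset_measure0 (measurable_neq mh mh') mA _ hr) => z /= hz; split.
    rewrite ltNge; apply/negP => zr; apply: hz; rewrite h'h//.
    by rewrite (le_trans zr)// ler_norm.
  by move=> hz0; apply: hz; rewrite hz0 h'0.
have ha k : h' (a k) = 0 by apply/h'0/hA; exists k.
have E t : denergy_phi (dPhi a rho) mu (Defs.variation h t) =
    denergy_phi (dPhi a rho) mu (Defs.variation h' t).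
  exact: denergy_phi_ae mh mh' hh'.
rewrite (_ : (fun t => _) = (fun t =>
    (denergy_phi (dPhi a rho) mu (Defs.variation h' t))%:C / t)).
  exact: Lipschitz_critical L'0 h'L h'H h'r ha.
by apply/funext => t; rewrite E.
Qed.

Lemma exists_max (f : nat -> R) n : (0 < n)%N ->
  exists2 i, (i < n)%N & forall j, (j < n)%N -> f j <= f i.
Proof.
elim: n => // -[|n] IH _; first by exists 0%N => // -[].
have [i ni fi] := IH isT.
have [fn|fn] := leP (f n.+1) (f i).
  exists i => [|j]; first exact: ltn_trans ni _.
  by rewrite ltnS leq_eqVlt => /predU1P[->//|/fi].
exists n.+1 => // j; rewrite ltnS leq_eqVlt => /predU1P[->//|/fi fj].
exact: le_trans fj (ltW fn).
Qed.

Lemma Re_div_ge_half (z w : C) : Cabs w <= Cabs z -> z != w ->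
  2^-1 <= complex.Re (z / (z - w)).
Proof.
move=> wz zw; have p0 : 0 < Cabs (z - w) ^+ 2 by rewrite exprn_gt0// Cabs_gt0 subr_eq0.
rewrite Re_divE ler_pdivlMr// normB_sqr.
have -> : complex.Re (z * conjc (z - w)) = Cabs z ^+ 2 - complex.Re (z * conjc w).
  by rewrite Cabs_sqr; case: (z) (w) => s t [s' t'] /=; ring.
have : Cabs w ^+ 2 <= Cabs z ^+ 2 by rewrite lerXn2r ?nnegrE ?Cabs_ge0.
lra.
Qed.

(** The zero of largest modulus feels a repulsion of real part at least 1/2 from
   each of the others; far away, the charges act as their total charge at the
   origin, which is too weak to balance this. *)
Lemma zeros_bounded : - 2^-1 < complex.Re (\sum_(k < p.+1) rho k) ->
  exists r0 : R, \forall n \near G, forall i, (i < n)%N -> Cabs (zeta n i) <= r0.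
Proof.
move=> rho12; have GF := weak_filter_proper wl.
pose A := \sum_(k < p.+1) Cabs (a k).
have A0 : 0 <= A by rewrite sumr_ge0// => k _; exact: Cabs_ge0.
have aA k : Cabs (a k) <= A.
  by rewrite /A (bigD1 k)//= lerDl sumr_ge0// => i _; exact: Cabs_ge0.
have M0 := charge_bound_gt0 rho.
(* beyond this radius [z / (z - a_k)] differs from 1 by at most [1 / (8 M)] *)
exists (A + 8 * M * (A + 1)).
have rho12n : \forall n \near G, - 2^-1 <= \sum_(k < p.+1) complex.Re (rho_ n k / n%:R).
  rewrite Re_sum in rho12.
  have H : \sum_(k < p.+1) complex.Re (rho_ n k / n%:R) @[n --> G] -->
      \sum_(k < p.+1) complex.Re (rho k).
    apply: cvg_big => [|k _]; first exact: add_continuous.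
    by apply: (rho_cvg zeta mu rhoN); exact: continuous_Re.
  exact: (@cvgr_ge _ _ _ (@filter_filter _ _ GF) _ _ H _ rho12).
apply: filterS3 rho12n (near_charge rhoN wl) (near_ge zeta N mu 3) => n rn nM n3.
have n0 : 0 < n%:R :> R by apply: lt_le_trans n3.
have n0' : (0 < n)%N by rewrite -(ltr0n R).
have [i0 ni0 imax] := exists_max (fun i => Cabs (zeta n i)) n0'.
suff H : Cabs (zeta n i0) <= A + 8 * M * (A + 1) by move=> i /imax /le_trans; apply.
rewrite leNgt; apply/negP => zbig; set z := zeta n i0 in zbig imax.
pose b (i : nat) : R := (i == i0)%:R.
have [zinj _ _] := crit n.
have := congr1 (@complex.Re R) (critical_equilibrium (fun i => (b i)%:C * z) (crit n)).
rewrite Re_equilibrium /= => E.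
have pair i j : (i < n)%N -> (j < n)%N -> j != i -> (b i + b j) / 2 <=
    complex.Re (((b i)%:C * z - (b j)%:C * z) / (zeta n i - zeta n j)).
  move=> ni nj ji; have zij : zeta n i != zeta n j.
    by apply: contraNneq ji => /zinj ->.
  rewrite /b; case: (eqVneq i i0) => [ii|ii]; case: (eqVneq j i0) => [jj|jj].
  - by move: ji; rewrite ii jj eqxx.
  - rewrite addr0 mul1r rmorph0 mul0r subr0 rmorph1 mul1r.
    rewrite ii -/z; apply: Re_div_ge_half; first exact: imax.
    by rewrite /z -ii.
  - rewrite add0r mul1r rmorph0 mul0r sub0r rmorph1 mul1r.
    have -> : - z / (zeta n i - zeta n j) = z / (zeta n j - zeta n i).
      by rewrite -(opprB (zeta n j)) invrN mulrNN.
    rewrite jj -/z; apply: Re_div_ge_half; first exact: imax.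
    by rewrite /z -jj eq_sym.
  - by rewrite addr0 mul0r rmorph0 !mul0r subr0 mul0r.
have sb : \sum_(0 <= i < n) b i = 1.
  rewrite big_mkord (bigD1 (Ordinal ni0))//= /b eqxx big1 ?addr0// => i.
  by rewrite -val_eqE /= => /negbTE ->.
have L1 : n%:R - 1 <= \sum_(0 <= i < n) \sum_(0 <= j < n | j != i)
    complex.Re (((b i)%:C * z - (b j)%:C * z) / (zeta n i - zeta n j)).
  apply: (@le_trans _ _ (\sum_(0 <= i < n) \sum_(0 <= j < n | j != i) (b i + b j) / 2)).
    have -> : n%:R - 1 = \sum_(0 <= i < n) ((b i * n%:R + 1) / 2 - b i) :> R.
      rewrite sumrB -mulr_suml big_split /= -mulr_suml sb mul1r.
      by rewrite big_mkord sumr_const card_ord; field.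
    rewrite le_eqVlt; apply/orP; left; apply/eqP; rewrite !big_mkord.
    apply: eq_bigr => i _; rewrite big_mkord.
    have -> : b i * n%:R + 1 = \sum_(j < n) (b i + b j).
      by rewrite big_split /= sumr_const card_ord mulr_natr -sb big_mkord.
    rewrite mulr_suml (bigD1 i)//=.
    have -> : (b i + b i) / 2 = b i by field.
    by rewrite addrAC subrr add0r.
  rewrite !big_mkord; apply: ler_sum => i _; rewrite !big_mkord; apply: ler_sum => j ij.
  exact: pair.
have zA k : z - a k != 0 /\ Cabs (a k / (z - a k)) <= (8 * M)^-1.
  have d : 8 * M * (A + 1) <= Cabs (z - a k).
    by have := Cabs_dist z (a k); have := ler_norm (Cabs z - Cabs (a k)); have := aA k; lra.
  have d0 : 0 < Cabs (z - a k) by apply: lt_le_trans d; rewrite !mulr_gt0// ltr_wpDl.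
  split; first by rewrite -Cabs_gt0.
  rewrite CabsM CabsV ler_pdivrMr// mulrC ler_pdivlMr ?mulr_gt0// mulrC.
  apply: le_trans d; rewrite ler_wpM2l ?mulr_ge0 ?(ltW M0)//.
  by rewrite (le_trans (aA k))// lerDl.
have L2 : - (n%:R / 2) - n%:R / 8 <= \sum_(0 <= i < n) \sum_(k < p.+1)
    complex.Re (rho_ n k * ((b i)%:C * z / (zeta n i - a k))).
  rewrite big_mkord (bigD1 (Ordinal ni0))//= [X in _ <= _ + X]big1 ?addr0; last first.
    move=> i; rewrite -val_eqE /= /b => /negbTE ->.
    by apply: big1 => k _; rewrite rmorph0 !mul0r mulr0.
  rewrite /b eqxx -/z.
  have -> : \sum_(k < p.+1) complex.Re (rho_ n k * ((1%:R)%:C * z / (z - a k))) =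
     \sum_(k < p.+1) complex.Re (rho_ n k) +
     \sum_(k < p.+1) complex.Re (rho_ n k * (a k / (z - a k))).
    rewrite -big_split /=; apply: eq_bigr => k _; rewrite -ReD; congr (complex.Re _).
    by rewrite rmorph1 mul1r; have [zk _] := zA k; field.
  apply: lerD.
    have -> : \sum_(k < p.+1) complex.Re (rho_ n k) =
       n%:R * \sum_(k < p.+1) complex.Re (rho_ n k / n%:R).
      rewrite mulr_sumr; apply: eq_bigr => k _; rewrite -ReMr rmorph_nat mulrCA divff ?mulr1//.
      by rewrite pnatr_eq0 -lt0n -(ltr0n R).
    by rewrite -mulrN ler_wpM2l// ltW.
  rewrite lerNl -sumrN; apply: (@le_trans _ _ (\sum_(k < p.+1) Cabs (rho_ n k) * (8 * M)^-1)).
    apply: ler_sum => k _; apply: le_trans (ler_norm _) _; rewrite normrN.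
    apply: le_trans (Re_le_Cabs _) _; rewrite CabsM; apply: ler_wpM2l (zA k).2.
    exact: Cabs_ge0.
  rewrite -mulr_suml ler_pdivrMr ?mulr_gt0//; apply: le_trans nM _.
  by rewrite le_eqVlt; apply/orP; left; apply/eqP; field.
by move: E L1 L2; move: (\sum_(0 <= i < n) _) (\sum_(0 <= i < n) _) n3 => s t; lra.
Qed.

(** Cut-off functions equal to 1 on a disc containing all zeros have average 1, and
   so integral 1 in the limit. *)
Lemma limit_compact_mass : - 2^-1 < complex.Re (\sum_(k < p.+1) rho k) ->
  compact_supp mu /\ mu setT = 1%E.
Proof.
move=> /zeros_bounded[r0 Hr0]; have GF := weak_filter_proper wl.
pose f (r : R) (z : C) : R := Order.max 0 (Order.min 1 (r + 1 - Cabs z)).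
have f0 r z : 0 <= f r z by rewrite le_max lexx.
have f1 r z : f r z <= 1 by rewrite ge_max ler01 ge_min lexx.
have fr r z : Cabs z <= r -> f r z = 1.
  by move=> zr; rewrite /f min_l ?max_r// addrAC lerDr subr_ge0.
have tf r : test_function (f r).
  split.
    apply: (lip_continuous (L := 1)) => z w; rewrite mul1r.
    apply: le_trans (maxr_dist 0 _ _) _; apply: le_trans (minr_dist 1 _ _) _.
    by rewrite sub_subl CabsB Cabs_dist.
  by exists (r + 1) => z zr; apply: max_l; rewrite ge_min subr_le0 (ltW zr) orbT.
have mf r := continuous_borelC (tf r).1.
have If r : r0 <= r -> Rintegral mu setT (f r) = 1.
  move=> rr; apply/eqP; rewrite -subr_eq0 -normr_eq0; apply/eqP/le_anti.
  rewrite normr_ge0 andbT.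
  have c1 : Rintegral (normalized_measure n (zeta n)) setT (f r) - 1 @[n --> G] -->
      Rintegral mu setT (f r) - 1.
    by apply: cvgB; [exact: weak_filter_cvg|exact: cvg_cst].
  apply: cvg_norm_le c1 _; apply: filterS2 (near_pos zeta N mu) Hr0 => n n0 zr.
  have -> : Rintegral (normalized_measure n (zeta n)) setT (f r) = 1.
    rewrite Rintegral_normalized// /avg big_mkord (eq_bigr (fun=> 1)); last first.
      by move=> i _; rewrite fr// (le_trans (zr i _)).
    by rewrite sumr_const card_ord mulVf// pnatr_eq0 -lt0n.
  by rewrite subrr normr0.
have mass : fine (mu setT) = 1.
  have c1 := @Rintegral_bounded_cvg R _ _ mu (fun k => f (r0 + k%:R)) (cst 1) 1 (mass_fin mu).
  have {}c1 : Rintegral mu setT (f (r0 + k%:R)) @[k --> \oo] --> Rintegral mu setT (cst 1).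
    apply: c1 => // [k z|z]; first by rewrite ger0_norm.
    apply/cvgrPdist_le => e e0; apply: filterS (nbhs_infty_ger (Cabs z - r0)) => k zk.
    by rewrite /= fr -?lerBlDl// subrr normr0 ltW.
  move: c1; under eq_fun do rewrite If ?lerDl//.
  rewrite Rintegral_cst// mul1r => c1.
  by have /cvg_lim <- := c1; rewrite ?lim_cst.
have muT : mu setT = 1%E.
  by rewrite -[LHS]fineK ?mass//; exact: fin_num_measure.
split => //; exists (r0 + 1).
have mB : measurable ([set z | r0 + 1 < Cabs z] : set (borelC R)).
  have := continuous_borelC (@continuous_Cabs R) measurableT (measurable_itv `]r0 + 1, +oo[).
  rewrite setTI (_ : _ @^-1` _ = [set z | r0 + 1 < Cabs z])//.
  by apply/seteqP; split => z /=; rewrite in_itv /= andbT.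
have iB : mu.-integrable setT (EFin \o (\1_([set z | r0 + 1 < Cabs z] : set (borelC R)) : borelC R -> R)).
  apply: (@integrable_bnd _ _ _ _ _ _ 1) => //; first exact: mass_fin.
  by move=> z _; rewrite normr_nat lern1 leq_b1.
have if_ : mu.-integrable setT (EFin \o f r0).
  apply: (@integrable_bnd _ _ _ _ _ _ 1) => //; first exact: mass_fin.
  by move=> z _; rewrite ger0_norm.
have i1 : mu.-integrable setT (EFin \o (fun z => 1 - f r0 z)).
  apply: (@integrable_bnd _ _ _ _ _ _ 1) => //; first exact: mass_fin.
    by apply: measurable_funB => //; exact: measurable_cst.
  by move=> z _; rewrite ger0_norm ?subr_ge0// gerBl.
have i0 : mu.-integrable setT (EFin \o (cst 1 : borelC R -> R)).
  apply: (@integrable_bnd _ _ _ _ _ _ 1) => //; first exact: mass_fin.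
  by move=> z _; rewrite normr1.
have H : fine (mu [set z | r0 + 1 < Cabs z]) <= 0.
  have -> : fine (mu [set z | r0 + 1 < Cabs z]) =
      Rintegral mu setT (\1_([set z | r0 + 1 < Cabs z] : set (borelC R)) : borelC R -> R).
    by rewrite /Rintegral integral_indic ?setIT.
  apply: (@le_trans _ _ (Rintegral mu setT (fun z => 1 - f r0 z))).
    apply: le_Rintegral => // z _; have [|_] := boolP (z \in _); last by rewrite subr_ge0.
    rewrite inE /= => zr; rewrite lerBrDl.
    by rewrite /f max_l ?add0r// ge_min subr_le0 (ltW zr) orbT.
  by rewrite RintegralB// If// Rintegral_cst// mass mul1r subrr.
rewrite -[LHS]fineK; last exact: fin_num_measure.
by congr EFin; apply/le_anti; rewrite H fine_ge0.
Qed.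

End Limits.

Theorem theorem7p1 (R : realType) (p : nat) (a : 'I_p.+1 -> R[i])
    (rho_ : nat -> 'I_p.+1 -> R[i]) (rho : 'I_p.+1 -> R[i])
    (zeta : nat -> nat -> R[i]) (N : set nat)
    (mu : {finite_measure set (borelC R) -> \bar R}) :
  injective a ->
  (forall n : nat, disc_critical (range a) (dPhi a (rho_ n)) n (zeta n)) ->
  infinite_set N ->
  (forall k, (rho_ n k / n%:R @[n --> within N \oo] --> rho k)) ->
  weak_limit_point N (fun n => normalized_measure n (zeta n)) mu ->
  cont_critical (range a) (dPhi a rho) mu /\
  (- 2^-1 < complex.Re (\sum_(k < p.+1) rho k) ->
   [/\ compact_supp mu, mu setT = 1%E & cont_critical (range a) (dPhi a rho) mu]).
Proof.
move=> _ crit _ rhoN wl.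
have cc := limit_cont_critical crit rhoN wl; split=> // rho12.
by have [cs m1] := limit_compact_mass crit rhoN wl rho12.
Qed.
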